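(* Let $\alpha\in(0,\frac12]$, $\kappa=(\frac12)^{2-\alpha}$, $\gamma=\frac{4-2\kappa}{1-\kappa}$, $p_\alpha=\frac{2}{2-\alpha}$, let $Z$ be the limit process and let $N$ be a standard normal random variable. (i) For $p>p_\alpha$, almost surely, $V_p(Z)<\infty$ and, for $t\in(0,1]$, $$[Z]_t^{(p)}=W_{p,t}(Z)=\sum_{s\in\mathscr{D}\cap[0,t]}|\Delta Z(s)|^p,$$ where the convergence defining $[Z]_t^{(p)}$ (along partitions with mesh tending to $0$) also holds with respect to all moments. For the mean, $$\mathbb{E}\left[[Z]_t^{(p)}\right]=\gamma^{p/2}\,\mathbb{E}[|N|^p]\sum_{i=1}^\infty\kappa^{pi/2}\left\lfloor2^{i-1}t+\tfrac12\right\rfloor.$$ (ii) Almost surely, for any $t\in(0,1]$, $V_{p_\alpha,t}(Z)=W_{p_\alpha,t}(Z)=[Z]_t^{(p_\alpha)}=\infty$.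
   Context: Limit process: each $t\in[0,1)$ is written in binary using the expansion containing infinitely many digits $0$; and $1=\sum_{i\ge1}2^{-i}$. Let $\Theta:=\bigcup_{k\ge0}\{0,1\}^k$, $|\vartheta|$ the length of the word $\vartheta$, and $B_\vartheta\subset[0,1]$ the set of numbers whose binary expansion has prefix $\vartheta$. Let $\{N_\vartheta:\vartheta\in\Theta\}$ be independent standard normal random variables and $$Z_n(t):=\sum_{\vartheta\in\Theta:\,|\vartheta|<n}\left(\tfrac12\right)^{(1-\alpha/2)|\vartheta|}\left(\mathbf{1}_{\{t\in B_{\vartheta0}\}}-\mathbf{1}_{\{t\in B_{\vartheta1}\}}\right)N_\vartheta,\quad t\in[0,1].$$ The limit process $Z$ is the almost sure uniform limit of $(Z_n)_{n\ge0}$ on $[0,1]$ (this limit exists; $Z$ has c\`adl\`ag paths). Dyadics and jumps: $\mathscr{D}_k=\{i2^{-k}:i=1,\dots,2^k-1\}$, $\mathscr{D}=\bigcup_{k\ge1}\mathscr{D}_k$. For c\`adl\`ag $f$ on $[0,1]$ and $t\in(0,1]$: $f(t-)=\lim_{s\uparrow t}f(s)$, $\Delta f(t)=f(t)-f(t-)$. Variation: for $t\in(0,1]$, $\Pi(t)$ is the set of finite decompositions $\pi=\{\tau_1,\dots,\tau_k\}$, $0=\tau_1<\dots<\tau_k=t$, of $[0,t]$; $|\pi|=k$; $\mathrm{mesh}(\pi)=\max_{1\le i\le|\pi|-1}|\tau_{i+1}-\tau_i|$. For c\`adl\`ag $f$ and $p>0$, $$V_{p,t}(f):=\sup_{\pi\in\Pi(t)}\sum_{i=1}^{|\pi|-1}|f(\tau_{i+1})-f(\tau_i)|^p,\quad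 V_p(f):=V_{p,1}(f),$$ $$W_{p,t}(f):=\sum_{s\in N_f\cap[0,t]}|\Delta f(s)|^p,\quad N_f:=\text{set of discontinuity points of }f,$$ $$[f]_t^{(p)}:=\lim_{\pi\in\Pi(t),\ \mathrm{mesh}(\pi)\to0}\ \sum_{i=1}^{|\pi|-1}|f(\tau_{i+1})-f(\tau_i)|^p,$$ if this limit exists in $[0,\infty]$.
   Formalization: In the formula for the mean, the exponent of κ is p(i−1)/2 instead of the printed pi/2: a jump of Z at an odd multiple of 2^{-i} has variance γκ^{i−1} (e.g. γ at s=1/2), so the printed value is too small by the factor κ^{p/2}. *)

(* Defs.v *)
From HB Require Import structures.
From mathcomp Require Export all_boot all_order all_algebra.
From mathcomp Require Export all_classical all_reals all_analysis.
Export Order.TTheory GRing.Theory Num.Theory.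
Export numFieldNormedType.Exports.

Set Implicit Arguments.
Unset Strict Implicit.
Unset Printing Implicit Defensive.

#[global] Open Scope classical_set_scope.
#[global] Open Scope ring_scope.

Section binary_words.
Context {R : realType}.
Implicit Types (b : nat -> bool) (t : R) (v : seq bool).

(* The digit of weight 2^-(i+1) is b i. *)
Definition binary_expansion b t : Prop :=
  [series (b i)%:R / 2 ^+ i.+1 : R]_i @ \oo --> t /\
  if t == 1 then forall i, b i else forall n, exists2 i, (n <= i)%N & ~~ b i.

Definition cylinder v : set R :=
  [set t : R | t \in `[0, 1] /\
           exists2 b, binary_expansion b t & mkseq b (size v) = v].

(* The n-th approximation, as a function of the realisation x of the family
   of random variables indexed by words; a word of length k < n is a
   k-tuple. *)
Definition Zapprox (alpha : R) (x : seq bool -> R) (n : nat) (t : R) : R :=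
  \sum_(k < n) \sum_(v : k.-tuple bool)
    2^-1 `^ ((1 - alpha / 2) * k%:R) *
    (\1_(cylinder (rcons v false)) t - \1_(cylinder (rcons v true)) t) * x v.

End binary_words.

Section random_variables.
Context d (T : measurableType d) (R : realType) (P : probability T R).

Definition standard_normal (X : {RV P >-> R}) : Prop :=
  forall A : set R, measurable A -> distribution P X A = normal_prob 0 1 A.

Definition mutually_independent (I : choiceType) (X : I -> {RV P >-> R}) : Prop :=
  forall (J : seq I) (A : I -> set R), uniq J -> (forall i, measurable (A i)) ->
    P (\bigcap_(i in [set` J]) (X i @^-1` A i)) =
    (\prod_(i <- J) P (X i @^-1` A i))%E.

(* Cadlag paths are not part of the definition: almost surely they follow from
   the uniform convergence. *)
Definition limit_process (alpha : R) (xi : seq bool -> {RV P >-> R})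
    (Z : R -> {RV P >-> R}) : Prop :=
  {ae P, forall w, {uniform `[0, 1],
    (fun n => Zapprox alpha (fun v => xi v w) n) @ \oo --> (fun t => Z t w)}}.

End random_variables.

Section dyadics_and_variation.
Context {R : realType}.
Implicit Types (f : R -> R) (p t : R) (s : seq R).

Definition dyadic_level (k : nat) : set R :=
  [set i%:R / 2 ^+ k | i in [set i : nat | (1 <= i <= 2 ^ k - 1)%N]].

Definition dyadic : set R := \bigcup_(k in [set k | (1 <= k)%N]) dyadic_level k.

Definition jump f t : R := f t - lim (f u @[u --> t^'-]).

(* Only the restriction of f to [0, 1] matters. *)
Definition discontinuities f : set R :=
  [set t : R | t \in `[0, 1] /\ ~ (f u @[u --> within `[0, 1] (nbhs t)] --> f t)].

(* A decomposition of [0, t] is a list s with itv_partition 0 t s; its points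
   are 0 :: s, the initial point 0 being left out of s. *)
Definition mesh s : R :=
  \big[Num.max/0]_(0 <= i < size s) `|(0 :: s)`_i.+1 - (0 :: s)`_i|.

Definition power_sum p f s : R :=
  \sum_(0 <= i < size s) `|f (0 :: s)`_i.+1 - f (0 :: s)`_i| `^ p.

Definition Vvar p t f : \bar R :=
  ereal_sup [set (power_sum p f s)%:E | s in itv_partition 0 t].

Definition Wvar p t f : \bar R :=
  \esum_(s in discontinuities f `&` `[0, t]) (`|jump f s| `^ p)%:E.

(* The filter "mesh tending to 0" on the decompositions of [0, t]. *)
Definition mesh_to0 t : set_system (seq R) :=
  filter_from [set delta : R | 0 < delta]
    (fun delta => [set s | itv_partition 0 t s /\ mesh s < delta]).

Definition pvar_exists p t f : Prop :=
  cvg ((power_sum p f s)%:E @[s --> mesh_to0 t]).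

(* Meaningful when pvar_exists p t f holds. *)
Definition pvar p t f : \bar R := lim ((power_sum p f s)%:E @[s --> mesh_to0 t]).

End dyadics_and_variation.

(* Main.v *)
(** Let q = 2^-(1 - alpha/2), so that kappa = q^2.  The k-th layer of Z is q^k times
    a step function of the first k+1 digits whose values are +-N_v, |v| = k.  For
    p > p_alpha one has 2 q^p < 1.  Convexity with geometric weights then bounds the
    p-variation of the remainder Z - Z_n by a tail of the random series
    sum_k r^k sum_(|v| = k) |N_v|^p with 2 r < 1; this tail converges to 0 almost
    surely and with all its moments.  Along a decomposition of mesh less than 2^-n the power
    sum of the step function Z_n is exactly its sum of jumps, hence the power sums
    of Z converge to its sum of jumps.  The jump at an odd multiple of 2^-(k+1) is
    q^k (-2 N_v + sum_(j >= 1) q^j (N_(v10..0) + N_(v01..1))), a centered Gaussian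
    variable of variance gamma kappa^k, which gives the mean.

    At p = p_alpha one has q^p = 1/2.  The jumps of level k have standard deviation
    at least 2 q^k, so each of them is smaller than c q^k with probability at most
    c; by Markov's inequality, with probability at least 1 - 2c at least half of
    the jumps of level k in [0, 2^-m] exceed c q^k and contribute at least a constant to
    W.  This holds for infinitely many k with probability at least 1 - 2c, for
    every c > 0, so W is infinite; the power sums are asymptotically bounded below
    by partial sums of W.  *)

Require Import Defs.
From mathcomp Require Import ring lra zify measurable_realfun.

Set Implicit Arguments.
Unset Strict Implicit.
Unset Printing Implicit Defensive.

(** * Convexity inequalities *)

Section power_inequalities.
Context {R : realType}.
Implicit Types (p theta eta a b x : R).

(** Convexity is used with two different weights. A fixed [theta0] has a cost per layer
    [(1 - theta0)^(1 - p)] small enough to keep [2 * tail_ratio theta0 q p] below 1, which makes the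
    tail series integrable. In the comparison of power sums with jump sums a second weight [theta]
    tends to 0: the main factor [(1 - theta)^(1 - p)] tends to 1, while [theta^(1 - p)] may blow up
    but multiplies only the tail. So [theta] is fixed first and the level [n] afterwards. The path
    estimates are deterministic and uniform over all decompositions of small mesh; chance enters
    through the tail series alone. This uniformity gives the moments: a single measurable variable
    dominates the error for uncountably many decompositions. For [m >= 1] the m-th power of a tail
    is bounded by a tail of another such series, so first moments suffice. The law of a jump of Z is
    not computed directly: the jumps of the approximations are finite Gaussian combinations, whose
    moments and small-ball bounds pass to the limit. *)

Lemma convex_powR_weights p theta a b : 1 <= p -> 0 <= theta <= 1 ->
  0 <= a -> 0 <= b ->
  ((1 - theta) * a + theta * b) `^ p <= (1 - theta) * a `^ p + theta * b `^ p.
Proof.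
move=> p1 /andP[t0 t1] a0 b0.
have := convex_powR p1 (Itv01 t0 t1) (x := b) (y := a).
rewrite !inE /= !in_itv /= !andbT => /(_ b0 a0).
by rewrite convRE [X in X `^ _ <= _ -> _]convRE /= /unstable.onem addrC [X in _ <= X -> _]addrC.
Qed.

(* Convexity of the p-th power at the two points a / (1 - theta), b / theta. *)
Lemma powR_normD_le p theta a b : 1 <= p -> 0 < theta < 1 ->
  `|a + b| `^ p <=
  (1 - theta) `^ (1 - p) * `|a| `^ p + theta `^ (1 - p) * `|b| `^ p.
Proof.
move=> p1 /andP[t0 t1].
have h0 : 0 < 1 - theta by rewrite subr_gt0.
have p0 : 0 <= p by rewrite (le_trans _ p1).
apply: (@le_trans _ _ ((`|a| + `|b|) `^ p)).
  by apply: ge0_ler_powR; rewrite ?nnegrE ?addr_ge0 ?ler_normD.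
have E (s x : R) : 0 < s -> 0 <= x -> s * (s^-1 * x) `^ p = s `^ (1 - p) * x `^ p.
  move=> s0 x0; rewrite powRM ?invr_ge0 ?(ltW s0)// mulrA; congr (_ * _).
  rewrite powRB; last by rewrite (gt_eqF s0) implybT.
  rewrite powRr1 ?(ltW s0)//; congr (_ * _).
  by rewrite -powR_inv1 ?(ltW s0)// -powRrM mulN1r powRN.
rewrite -[X in _ <= X + _]E// -[X in _ <= _ + X]E//.
rewrite [X in X <= _](_ : _ =
    ((1 - theta) * ((1 - theta)^-1 * `|a|) + theta * (theta^-1 * `|b|)) `^ p).
  apply: convex_powR_weights => //; first by rewrite (ltW t0) (ltW t1).
  - by rewrite mulr_ge0// invr_ge0 ltW.
  - by rewrite mulr_ge0// invr_ge0 ltW.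
by rewrite !mulrA !divff ?gt_eqF// !mul1r.
Qed.

(** The two-point inequality is iterated, splitting off the first term with weight [theta]; term [k]
    has passed through [k - n] earlier splittings, each with factor [(1 - theta)^(1 - p)]. *)
Lemma powR_norm_sum_le p theta (Y : nat -> R) n N : 1 <= p -> 0 < theta < 1 ->
  (n <= N)%N ->
  `|\sum_(n <= k < N) Y k| `^ p <=
  theta `^ (1 - p) *
    \sum_(n <= k < N) ((1 - theta) `^ (1 - p)) ^+ (k - n) * `|Y k| `^ p.
Proof.
move=> p1 th nN; set L := theta `^ _; set K := (1 - theta) `^ _.
have p0 : p != 0 by rewrite gt_eqF// (lt_le_trans _ p1).
have [m ->] : exists m, N = (n + m)%N by exists (N - n)%N; rewrite subnKC.
elim: m n {N nN} => [|m IH] n.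
  by rewrite addn0 !big_geq// normr0 powR0// mulr0.
have nm : (n < n + m.+1)%N by rewrite addnS ltnS leq_addr.
rewrite (big_ltn nm) [in X in _ <= X](big_ltn nm) subnn expr0 mul1r mulrDr.
rewrite -addSnnS [Y n + _]addrC.
apply: (le_trans (powR_normD_le _ _ p1 th)); rewrite -/L -/K addrC lerD2l.
have K0 : 0 <= K by exact: powR_ge0.
apply: (le_trans (ler_wpM2l K0 (IH n.+1))).
rewrite mulrCA ler_wpM2l ?powR_ge0//.
rewrite big_distrr /= le_eqVlt; apply/orP; left; apply/eqP.
by apply: eq_big_nat => k /andP[nk _]; rewrite mulrA -exprS -subSn.
Qed.

Lemma powR_sum_le p (I : Type) (s : seq I) (y : I -> R) : 1 <= p ->
  (forall i, 0 <= y i) ->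
  (\sum_(i <- s) y i) `^ p <= (size s)%:R `^ (p - 1) * \sum_(i <- s) y i `^ p.
Proof.
move=> p1 y0; have p0 : p != 0 by rewrite gt_eqF// (lt_le_trans _ p1).
elim: s => [|i s IH]; first by rewrite !big_nil powR0// mulr0.
rewrite !big_cons /=; case: s IH => [|j s] IH.
  by rewrite !big_nil /= powR1 mul1r !addr0.
move: (j :: s) IH (isT : 0 < size (j :: s))%N => {j}s IH s0.
set n := size s in IH s0 *; set S := \sum_(j <- s) y j in IH *.
have S0 : 0 <= S by exact: sumr_ge0.
have n0 : 0 < n%:R :> R by rewrite ltr0n.
have n10 : 0 < n.+1%:R :> R by rewrite ltr0n.
(* With weight 1/(n+1) for the new term the constants combine exactly:
   [(n/(n+1))^(1-p) * n^(p-1) = (n+1)^(p-1)]. *)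
have th : 0 < (n.+1%:R^-1 : R) < 1.
  by rewrite invr_gt0 n10 invf_lt1// ltr1n ltnS.
have := powR_normD_le S (y i) p1 th.
rewrite !ger0_norm ?addr_ge0// addrC => /le_trans; apply.
have -> : 1 - n.+1%:R^-1 = n%:R / n.+1%:R :> R.
  by rewrite -[X in X - _](@divff _ n.+1%:R) ?gt_eqF// -[X in _ - X]mul1r -mulrBl -natr1 addrK.
have E : n.+1%:R^-1 `^ (1 - p) = n.+1%:R `^ (p - 1) :> R.
  by rewrite -powR_inv1 ?ler0n// -powRrM mulN1r opprB.
rewrite powRM ?invr_ge0 ?ler0n// E mulrDr addrC lerD2l.
rewrite mulrAC mulrC ler_wpM2l ?powR_ge0//.
apply: (le_trans (ler_wpM2l (@powR_ge0 R _ _) IH)).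
rewrite mulrA -powRD; last by rewrite (gt_eqF n0) implybT.
by rewrite addrA subrK subrr powRr0 mul1r.
Qed.

(** From [a + b <= 2 max(a, b)], which covers exponents below 1 as well. *)
Lemma powR_addr_le (m : R) a b : 0 < m -> 0 <= a -> 0 <= b ->
  (a + b) `^ m <= 2 `^ m * (a `^ m + b `^ m).
Proof.
move=> m0 a0 b0; wlog ab : a b a0 b0 / a <= b.
  by move=> H; case/orP: (le_total a b) => ?; [|rewrite addrC [X in _ * X]addrC]; exact: H.
apply: (@le_trans _ _ ((2 * b : R) `^ m)).
  by apply: ge0_ler_powR; rewrite ?nnegrE ?(ltW m0)// ?mulr_ge0 ?addr_ge0//; lra.
by rewrite powRM// ler_wpM2l ?powR_ge0// lerDr powR_ge0.
Qed.

(* For exponents m < 1, where E x^m -> 0 is deduced from E x -> 0. *)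
Lemma powR_le_affine (m : R) eta x : 0 < m <= 1 -> 0 < eta -> 0 <= x ->
  x `^ m <= eta `^ m + eta `^ (m - 1) * x.
Proof.
move=> /andP[m0 m1] e0 x0; have [xe|ex] := leP x eta.
  apply: (@le_trans _ _ (eta `^ m)); last by rewrite lerDl mulr_ge0 ?powR_ge0.
  by apply: ge0_ler_powR; rewrite ?nnegrE ?(ltW m0)// ltW.
apply: (@le_trans _ _ (eta `^ (m - 1) * x)); last by rewrite lerDr powR_ge0.
have x1 : 0 < x by exact: lt_trans ex.
rewrite -[X in X <= _](mulr_powRB1 x0 m0) mulrC ler_wpM2r//.
rewrite -[m - 1]opprB !powRN lef_pV2 ?posrE ?powR_gt0//.
by apply: ge0_ler_powR; rewrite ?nnegrE ?subr_ge0// ltW.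
Qed.

End power_inequalities.

(** * Binary expansions *)

Section dyadic_index.
Context {R : realType}.
Implicit Types (t : R) (n i j k : nat) (b : nat -> bool) (v : seq bool).

(* At t = 1 the index is 2^n - 1, because 1 is expanded with digits 1 only. *)
Definition idx n t : nat := minn (Num.trunc (2 ^+ n * t)) (2 ^ n).-1.

Definition dig t k : bool := odd (idx k.+1 t).

Lemma pow2_gt0 n : (0 < 2 ^+ n :> R).
Proof. by rewrite exprn_gt0. Qed.

Lemma pow2_ge0 n : (0 <= 2 ^+ n :> R).
Proof. by rewrite exprn_ge0. Qed.

Lemma pow2_neq0 n : (2 ^+ n != 0 :> R).
Proof. by rewrite gt_eqF ?pow2_gt0. Qed.

Lemma pow2E n : (2 ^ n)%:R = 2 ^+ n :> R.
Proof. by rewrite natrX. Qed.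

Lemma pow2V_gt0 n : 0 < (2 ^+ n)^-1 :> R.
Proof. by rewrite invr_gt0 pow2_gt0. Qed.

Lemma idx_lt n t : (idx n t < 2 ^ n)%N.
Proof.
have := expn_gt0 2 n; rewrite /idx /=; lia.
Qed.

(** The Galois connection from which most facts about [idx] follow; the bound [j < 2 ^ n]
    neutralises the cap in its definition. *)
Lemma leq_idx n t j : 0 <= t -> (j < 2 ^ n)%N ->
  (j <= idx n t)%N = (j%:R / 2 ^+ n <= t).
Proof.
move=> t0 jn; rewrite /idx leq_min truncn_ge_nat ?mulr_ge0 ?pow2_ge0//.
by rewrite ler_pdivrMr ?pow2_gt0// mulrC -ltnS prednK ?expn_gt0// jn andbT.
Qed.

Lemma idx_le n t : 0 <= t -> (idx n t)%:R / 2 ^+ n <= t.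
Proof. by move=> t0; rewrite -leq_idx ?idx_lt. Qed.

Lemma idx_dyadic n j : (j < 2 ^ n)%N -> idx n (j%:R / 2 ^+ n : R) = j.
Proof.
move=> jn; rewrite /idx mulrC divfK ?gt_eqF ?pow2_gt0// natrK; lia.
Qed.

Lemma idx_mono n t t' : 0 <= t -> t <= t' -> (idx n t <= idx n t')%N.
Proof.
move=> t0 tt'; rewrite leq_idx ?idx_lt ?(le_trans t0)//.
by rewrite (le_trans (idx_le _ _)).
Qed.

Lemma idx_step n t t' : 0 <= t -> 0 <= t' -> t' < t + (2 ^+ n)^-1 ->
  (idx n t' <= (idx n t).+1)%N.
Proof.
move=> t0 t0' tt'; case E : (idx n t') => [//|j].
rewrite ltnS leq_idx//; last by have := idx_lt n t'; lia.
have := idx_le n t0'; rewrite E -natr1 mulrDl mul1r => H.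
by have := le_lt_trans H tt'; rewrite ltrD2r => /ltW.
Qed.

Lemma lt_idxS n t : 0 <= t -> ((idx n t).+1 < 2 ^ n)%N ->
  t < (idx n t).+1%:R / 2 ^+ n.
Proof. by move=> t0 H; rewrite ltNge -leq_idx// ltnn. Qed.

Lemma idxS_ge n t : 0 <= t <= 1 -> t <= (idx n t).+1%:R / 2 ^+ n.
Proof.
move=> /andP[t0 t1]; have := idx_lt n t; rewrite leq_eqVlt => /predU1P[->|].
  by rewrite pow2E divff// gt_eqF// pow2_gt0.
by move/(lt_idxS t0)/ltW.
Qed.

Lemma idx_half n t : 0 <= t -> idx n t = (idx n.+1 t)./2.
Proof.
move=> t0; have E j : (j.*2)%:R / 2 ^+ n.+1 = j%:R / 2 ^+ n :> R.
  rewrite -mul2n natrM exprS invfM mulrACA divff ?mul1r//.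
have := idx_lt n t; have := idx_lt n.+1 t; rewrite expnS => l1 l2.
apply/eqP; rewrite eqn_leq; apply/andP; split.
  rewrite -(doubleK (idx n t)) half_leq// leq_idx//; last by rewrite expnS; lia.
  by rewrite E idx_le.
rewrite leq_idx//; last by rewrite ltn_half_double -mul2n.
by rewrite -E -leq_idx ?expnS//; lia.
Qed.

Lemma idx_div n m t : 0 <= t -> (n <= m)%N -> idx n t = (idx m t %/ 2 ^ (m - n))%N.
Proof.
move=> t0 nm; rewrite -{1}(subKn nm); have : (m - n <= m)%N by rewrite leq_subr.
elim: (m - n)%N => [|k IH] km; first by rewrite subn0 divn1.
rewrite idx_half// subnSK// IH 1?ltnW// -divn2 -divnMA -expnSr//.
Qed.

Lemma idxS n t : 0 <= t -> idx n.+1 t = (dig t n + (idx n t).*2)%N.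
Proof. by move=> t0; rewrite (idx_half n t0) /dig odd_double_half. Qed.

Lemma idx0 t : idx 0 t = 0%N.
Proof. by have := idx_lt 0 t; rewrite expn0; lia. Qed.

(** The integer written by the first [n] digits, most significant first. *)
Definition expansion_prefix (b : nat -> bool) n : nat :=
  iteri n (fun i m => (b i + m.*2)%N) 0%N.

Lemma expansion_prefixS b n :
  expansion_prefix b n.+1 = (b n + (expansion_prefix b n).*2)%N.
Proof. by []. Qed.

Lemma expansion_prefix_dig t n : 0 <= t -> expansion_prefix (dig t) n = idx n t.
Proof.
move=> t0; elim: n => [|n IH]; first by rewrite idx0.
by rewrite expansion_prefixS IH idxS.
Qed.

Lemma series_expansion b n :
  [series (b i)%:R / 2 ^+ i.+1 : R]_i n = (expansion_prefix b n)%:R / 2 ^+ n.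
Proof.
elim: n => [|n IH]; first by rewrite /series/= big_geq// mul0r.
rewrite seriesSr IH expansion_prefixS natrD mulrDl [LHS]addrC; congr (_ + _).
by rewrite -mul2n natrM exprS invfM mulrACA divff ?mul1r.
Qed.

Lemma expansion_prefix_ub b n k :
  ((expansion_prefix b (n + k)).+1 <= (expansion_prefix b n).+1 * 2 ^ k)%N.
Proof.
elim: k => [|k IH]; first by rewrite addn0 expn0 muln1.
rewrite addnS expansion_prefixS expnS; case: (b _) => /=; lia.
Qed.

Lemma binary_expansion_ge b t n :
  [series (b i)%:R / 2 ^+ i.+1 : R]_i @ \oo --> t ->
  (expansion_prefix b n)%:R / 2 ^+ n <= t.
Proof.
move=> bt; rewrite -series_expansion -(cvg_lim _ bt)//.
apply: nondecreasing_cvgn_le; last by apply/cvg_ex; exists t.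
by apply: nondecreasing_series => i _ _; rewrite divr_ge0// pow2_ge0.
Qed.

Lemma binary_expansion_le b t n :
  [series (b i)%:R / 2 ^+ i.+1 : R]_i @ \oo --> t ->
  t <= (expansion_prefix b n).+1%:R / 2 ^+ n.
Proof.
move=> bt; rewrite -(cvg_lim _ bt)//; apply: limr_le; first by apply/cvg_ex; exists t.
exists n => // m /= nm; rewrite series_expansion.
rewrite ler_pdivrMr ?pow2_gt0// mulrAC ler_pdivlMr ?pow2_gt0//.
rewrite -!pow2E -!natrM ler_nat.
rewrite -(subnKC nm) expnD; have := expansion_prefix_ub b n (m - n).
by have := expn_gt0 2 n; nia.
Qed.

(** The partial sums enclose [t] between consecutive multiples of 2^-n. A later digit 0 makes the
    upper inequality strict, which singles out [idx n t]; at [t = 1] all digits are 1 and the cap in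
    [idx] gives the same value. *)
Lemma binary_expansion_prefix b t n : 0 <= t <= 1 -> binary_expansion b t ->
  expansion_prefix b n = idx n t.
Proof.
move=> /andP[t0 t1] [bt]; case: eqP => [-> ball|/eqP tn1 binf].
  have -> : idx n (1 : R) = (2 ^ n).-1.
    by rewrite /idx mulr1 -pow2E natrK; apply/minn_idPr; lia.
  elim: n => [//|n IH]; rewrite expansion_prefixS IH ball expnS.
  by have := expn_gt0 2 n; lia.
have lt_t : t < (expansion_prefix b n).+1%:R / 2 ^+ n.
  have [i ni bi] := binf n.
  apply: le_lt_trans (binary_expansion_le i.+1 bt) _.
  rewrite ltr_pdivrMr ?pow2_gt0// mulrAC ltr_pdivlMr ?pow2_gt0//.
  rewrite -!pow2E -!natrM ltr_nat expansion_prefixS (negbTE bi) add0n.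
  rewrite expnS -(subnKC ni) expnD; have := expansion_prefix_ub b n (i - n).
  by have := expn_gt0 2 n; nia.
have bl m : (expansion_prefix b m < 2 ^ m)%N.
  by have := expansion_prefix_ub b 0 m; rewrite add0n /= mul1n.
apply/eqP; rewrite eqn_leq leq_idx// binary_expansion_ge//=.
rewrite -ltnS -(ltr_nat R).
have := le_lt_trans (idx_le n t0) lt_t.
by rewrite ltr_pM2r ?pow2V_gt0.
Qed.

Lemma binary_expansion_dig_unique b t i : 0 <= t <= 1 -> binary_expansion b t ->
  b i = dig t i.
Proof.
move=> t01 bt; rewrite /dig -(binary_expansion_prefix i.+1 t01 bt).
by rewrite expansion_prefixS oddD odd_double addbF oddb.
Qed.

Lemma binary_expansion_dig t : 0 <= t <= 1 -> binary_expansion (dig t) t.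
Proof.
move=> t01; have /andP[t0 t1] := t01; split.
  apply/cvgrPdist_le => /= e e0.
  have : (2^-1 : R) ^+ n @[n --> \oo] --> 0.
    by apply: cvg_expr; rewrite ger0_norm; lra.
  move/cvgrPdist_le => /(_ e e0)[N _ HN]; exists N => // n /= Nn.
  rewrite series_expansion expansion_prefix_dig//.
  have := HN n Nn; rewrite sub0r normrN ger0_norm ?exprn_ge0// exprVn.
  move=> /(le_trans _); apply; rewrite ger0_norm ?subr_ge0 ?idx_le//.
  have := idxS_ge n t01; rewrite -natr1 mulrDl mul1r; lra.
case: eqP => [-> i|/eqP tn1 n].
  rewrite /dig /idx mulr1 -pow2E natrK.
  have := expn_gt0 2 i; rewrite expnS => H.
  have -> : minn (2 * 2 ^ i) (2 * 2 ^ i).-1 = (1 + (2 ^ i).-1.*2)%N by lia.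
  by rewrite oddD odd_double.
apply: contrapT => H.
(* With only digits 1 from [n] on, the prefixes, which never exceed [t], would tend to the right end
   of the level-n interval of [t], a point strictly above [t]. *)
have alld i : (n <= i)%N -> dig t i.
  by move=> ni; apply: contrapT => di; apply: H; exists i => //; apply/negP.
have E k : (idx (n + k) t).+1 = ((idx n t).+1 * 2 ^ k)%N.
  elim: k => [|k IH]; first by rewrite addn0 muln1.
  by rewrite addnS idxS// alld ?leq_addr// expnS; lia.
have tlt : t < (idx n t).+1%:R / 2 ^+ n.
  have := idx_lt n t; rewrite leq_eqVlt => /predU1P[->|].
    by rewrite pow2E divff ?gt_eqF ?pow2_gt0// lt_neqAle tn1.
  exact: lt_idxS.
have : (2^-1 : R) ^+ k @[k --> \oo] --> 0.
  by apply: cvg_expr; rewrite ger0_norm; lra.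
have e0 : 0 < (idx n t).+1%:R / 2 ^+ n - t by rewrite subr_gt0.
move/cvgrPdist_lt => /(_ _ e0)[N _ /(_ N (leqnn N))].
rewrite sub0r normrN ger0_norm ?exprn_ge0// exprVn.
have := idx_le (n + N) t0.
have -> : (idx (n + N) t)%:R = ((idx n t).+1 * 2 ^ N)%:R - 1 :> R.
  by rewrite -E -natr1 addrK.
rewrite natrM pow2E mulrBl exprD invfM -mulrA [2 ^+ N * _]mulrC.
rewrite -[X in _ * X - _]mulrA mulVf ?gt_eqF ?pow2_gt0// mulr1 mul1r.
have : (2 ^+ n)^-1 * (2 ^+ N)^-1 <= (2 ^+ N)^-1 :> R.
  rewrite ler_piMl ?invr_ge0 ?pow2_ge0// invf_le1 ?pow2_gt0//.
  by rewrite -pow2E ler1n expn_gt0.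
by move=> *; lra.
Qed.

Lemma indic_cylinder v t : 0 <= t <= 1 ->
  \1_(cylinder v) t = (mkseq (dig t) (size v) == v)%:R :> R.
Proof.
move=> t01; rewrite indicE; congr (nat_of_bool _)%:R; apply/idP/eqP.
  rewrite inE => -[_ [b bt <-]]; rewrite size_mkseq.
  by apply: eq_mkseq => i; rewrite (binary_expansion_dig_unique i t01 bt).
move=> E; rewrite inE; split; first by rewrite /= in_itv.
by exists (dig t) => //; exact: binary_expansion_dig.
Qed.

(** The binary digits of [i] on [n] places, most significant first: sums over words of length [n]
    become sums over [i < 2 ^ n]. *)
Fixpoint word n i : seq bool :=
  if n is m.+1 then rcons (word m i./2) (odd i) else [::].

Lemma size_word n i : size (word n i) = n.
Proof. by elim: n i => //= n IH i; rewrite size_rcons IH. Qed.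

Lemma word_inj n i j : (i < 2 ^ n)%N -> (j < 2 ^ n)%N -> word n i = word n j -> i = j.
Proof.
elim: n i j => [|n IH] i j; first by rewrite expn0; lia.
rewrite expnS /= => il jl /rcons_inj[/IH E o].
rewrite -(odd_double_half i) -(odd_double_half j) o E//; lia.
Qed.

Lemma mkseq_dig t n : 0 <= t -> mkseq (dig t) n = word n (idx n t).
Proof.
move=> t0; elim: n => [//|n IH].
by rewrite mkseqS IH /= -idx_half.
Qed.

(* To be evaluated at i = idx k.+1 t: the k-th layer of the process only depends
   on the first k.+1 digits of t. *)
Definition layer (x : seq bool -> R) k i : R := (-1) ^+ odd i * x (word k i./2).

(** For each [k] only the word of the first [k] digits of [t] has a nonzero coefficient; the next
    digit decides the sign. *)
Lemma Zapprox_layer alpha x n t : 0 <= t <= 1 ->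
  Zapprox alpha x n t =
  \sum_(0 <= k < n) (2^-1 `^ (1 - alpha / 2)) ^+ k * layer x k (idx k.+1 t).
Proof.
move=> t01; have /andP[t0 t1] := t01.
rewrite /Zapprox big_mkord; apply: eq_bigr => k _.
rewrite -powR_mulrn ?powR_ge0// -powRrM.
have [v0 v0E] : exists v0 : k.-tuple bool, v0 = mkseq (dig t) k :> seq bool.
  exists [tuple dig t i | i < k].
  by rewrite /= /mkseq -val_enum_ord -map_comp.
rewrite (bigD1 v0)//= big1 ?addr0; last first.
  move=> v vv0; rewrite !indic_cylinder// !size_rcons !size_tuple !mkseqS.
  rewrite !eqseq_rcons -v0E.
  have -> : (tval v0 == tval v) = false by apply/eqP => /val_inj E; rewrite E eqxx in vv0.
  by rewrite subrr mulr0 mul0r.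
rewrite -mulrA; congr (_ * _).
rewrite !indic_cylinder// !size_rcons size_tuple !mkseqS !eqseq_rcons.
rewrite v0E eqxx /= /layer -idx_half// mkseq_dig//; congr (_ * _).
by rewrite /dig; case: (odd _); rewrite /= ?subr0 ?sub0r ?expr0 ?expr1.
Qed.

End dyadic_index.

Lemma continuous_powR_norm (R : realType) (p : R) : 1 <= p ->
  continuous (fun a : R => `|a| `^ p).
Proof.
move=> p1 a; have p0 : 0 < p by exact: lt_le_trans p1.
have [->|a0] := eqVneq a 0.
  apply/cvgrPdist_le => /= e e0; rewrite normr0 powR0 ?gt_eqF//.
  have m0 : 0 < Num.min e 1 by rewrite lt_min e0 ltr01.
  apply/nbhs_ballP; exists (Num.min e 1) => //= b.
  rewrite /ball /= sub0r normrN lt_min => /andP[be b1].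
  rewrite sub0r normrN ger0_norm ?powR_ge0//.
  have [->|b0] := eqVneq b 0; first by rewrite normr0 powR0 ?gt_eqF// ltW.
  by rewrite (le_trans (ge1r_powR _ p1)) ?(ltW be)// normr_gt0 b0 ltW.
apply: (@continuous_comp _ _ _ (fun a : R => `|a|) (fun x => x `^ p)).
  exact: norm_continuous.
apply: differentiable_continuous; apply/derivable1_diffP.
by apply: derivable_powR; rewrite in_itv /= andbT normr_gt0.
Qed.

(** * Power sums along decompositions *)

Section partitions.
Context {R : realType}.
Implicit Types (p t delta x y : R) (f g : R -> R) (s : seq R).

Definition unit_step delta x y := [&& 0 <= x, x < y, y <= 1 & y - x < delta].

Definition step_sum (G : R -> R -> R) x s : R :=
  \sum_(0 <= i < size s) G (x :: s)`_i (x :: s)`_i.+1.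

Lemma step_sum_cons G x y s : step_sum G x (y :: s) = G x y + step_sum G y s.
Proof. by rewrite /step_sum big_nat_recl. Qed.

(** With [m = idx n] each step is charged to the range of indices it crosses; consecutive ranges are
    adjacent, so the charges add up without overlap. *)
Lemma step_sum_le (e : rel R) G (m : R -> nat) (phi : nat -> R) x s : path e x s ->
  (forall y z, e y z -> (m y <= m z)%N /\ G y z <= \sum_(m y <= j < m z) phi j) ->
  step_sum G x s <= \sum_(m x <= j < m (last x s)) phi j.
Proof.
move=> es H; suff [] : (m x <= m (last x s))%N /\
  step_sum G x s <= \sum_(m x <= j < m (last x s)) phi j by [].
elim: s x es => [|y s IH] x /=; first by rewrite /step_sum !big_geq.
move=> /andP[/H[xy Gxy] /IH[ys Gys]]; split; first exact: leq_trans ys.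
by rewrite step_sum_cons (big_cat_nat xy ys) lerD.
Qed.

Lemma step_sum_ge (e : rel R) G (m : R -> nat) (phi : nat -> R) x s : path e x s ->
  (forall y z, e y z -> (m y <= m z)%N /\ \sum_(m y <= j < m z) phi j <= G y z) ->
  \sum_(m x <= j < m (last x s)) phi j <= step_sum G x s.
Proof.
move=> es H; have := @step_sum_le e (fun y z => - G y z) m (fun j => - phi j) x s es.
rewrite /step_sum !sumrN lerN2; apply => y z /H[-> ?]; split => //.
by rewrite sumrN lerN2.
Qed.

Lemma power_sumE p f s :
  power_sum p f s = step_sum (fun x y => `|f y - f x| `^ p) 0 s.
Proof. by []. Qed.

Lemma itv_partition_last t s : itv_partition 0 t s -> last 0 s = t.
Proof. by case=> _ /eqP. Qed.

Lemma itv_partition_unit_step t delta s : t <= 1 -> itv_partition 0 t s ->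
  mesh s < delta -> path (unit_step delta) 0 s.
Proof.
move=> t1 st ms; apply/(pathP 0) => i si.
have [/(pathP 0)/(_ i si) lt_i _] := st.
have i1 : (i.+1 < (size s).+1)%N by [].
have i0 : (i < (size s).+1)%N by exact: ltnW.
rewrite /unit_step lt_i; apply/and4P; split => //.
- by have := itv_partition_nth_ge i0 st; rewrite (set_nth_default 0).
- apply: le_trans t1.
  by have := itv_partition_nth_le i1 st; rewrite (set_nth_default 0).
- apply: le_lt_trans ms; rewrite -[leLHS]ger0_norm ?subr_ge0 ?(ltW lt_i)//.
  rewrite /mesh.
  apply: (@le_bigmax_seq _ R _ (index_iota 0 (size s)) 0 i xpredT
     (fun i => `|(0 :: s)`_i.+1 - (0 :: s)`_i|)) => //.
  by rewrite mem_index_iota.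
Qed.

Lemma mesh_lt2 t s : t <= 1 -> itv_partition 0 t s -> mesh s < 2.
Proof.
move=> t1 st; rewrite /mesh big_nat_cond; elim/big_ind: _ => //.
- by move=> x y x2 y2; rewrite gt_max x2.
- move=> i /andP[/andP[_ si] _].
  have i1 : (i.+1 < (size s).+1)%N by [].
  have i0 : (i < (size s).+1)%N by exact: ltnW.
  have [/(pathP 0)/(_ i si) lt_i _] := st.
  rewrite ger0_norm ?subr_ge0 ?(ltW lt_i)//.
  have := itv_partition_nth_ge i0 st; rewrite (set_nth_default 0)//.
  have := itv_partition_nth_le i1 st; rewrite (set_nth_default 0)//=.
  by move=> *; lra.
Qed.

Lemma power_sum_nth_unit t s i : t <= 1 -> itv_partition 0 t s ->
  (i <= size s)%N -> 0 <= (0 :: s)`_i <= 1.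
Proof.
move=> t1 st si; have i1 : (i < (size s).+1)%N by [].
have := itv_partition_nth_ge i1 st; rewrite (set_nth_default 0)// => -> /=.
have := itv_partition_nth_le i1 st; rewrite (set_nth_default 0)// => H.
exact: le_trans t1.
Qed.

Lemma eq_power_sum p t f g s : t <= 1 -> itv_partition 0 t s ->
  (forall u, 0 <= u <= 1 -> f u = g u) -> power_sum p f s = power_sum p g s.
Proof.
move=> t1 st fg; apply: eq_big_nat => i /andP[_ si].
by rewrite !fg// (power_sum_nth_unit t1 st)// ltnW.
Qed.

Lemma power_sum_cvg p t (f_ : nat -> R -> R) f s : 1 <= p ->
  t <= 1 -> itv_partition 0 t s ->
  (forall u, 0 <= u <= 1 -> f_ n u @[n --> \oo] --> f u) ->
  power_sum p (f_ n) s @[n --> \oo] --> power_sum p f s.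
Proof.
move=> p1 t1 st ff; rewrite /power_sum big_nat_cond.
under eq_fun do rewrite big_nat_cond.
apply: (cvg_big add_continuous) => i /andP[/andP[_ si] _].
apply: (continuous_cvg _ (@continuous_powR_norm R p p1 _)).
by apply: cvgB; apply: ff; rewrite (power_sum_nth_unit t1 st)// ltnW.
Qed.

Lemma power_sumD_le p theta f g s : 1 <= p -> 0 < theta < 1 ->
  power_sum p (fun u => f u + g u) s <=
  (1 - theta) `^ (1 - p) * power_sum p f s + theta `^ (1 - p) * power_sum p g s.
Proof.
move=> p1 th; rewrite /power_sum !big_distrr -big_split /=; apply: ler_sum => i _.
by rewrite opprD addrACA; exact: powR_normD_le.
Qed.

End partitions.

Lemma big_nat_double (V : nmodType) (phi : nat -> V) m :
  \sum_(0 <= i < m.*2) phi i = \sum_(0 <= i < m) (phi i.*2 + phi i.*2.+1).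
Proof.
elim: m => [|m IH]; first by rewrite !big_geq.
by rewrite doubleS !big_nat_recr //= IH addrA.
Qed.

(** * Power sums of a single layer and of tails of layers *)

Section layers.
Context {R : realType}.
Implicit Types (p t theta q B : R) (x : seq bool -> R) (s : seq R) (f : R -> R).

Definition level_sum p x k : R := \sum_(0 <= i < 2 ^ k) `|x (word k i)| `^ p.

Lemma level_sum_ge0 p x k : 0 <= level_sum p x k.
Proof. by apply: sumr_ge0 => i _; exact: powR_ge0. Qed.

Lemma sum_layer_powR p x k :
  \sum_(0 <= i < 2 ^ k.+1) `|layer x k i| `^ p = 2 * level_sum p x k.
Proof.
rewrite expnS mul2n big_nat_double /level_sum big_distrr /=.
apply: eq_bigr => i _.
by rewrite /layer /= odd_double !normrM !normrX normrN1 !expr1n !mul1r uphalf_double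
  doubleK mulrDl mul1r.
Qed.

(** A step inside one interval of level [k.+1] costs nothing. Any other step is bounded by the
    values at its two ends; each interval is charged at most once as a start and once as an end, and
    each word labels two intervals, whence the 4. *)
Lemma power_sum_layer_le p t x k s : 1 <= p -> t <= 1 -> itv_partition 0 t s ->
  power_sum p (fun u => layer x k (idx k.+1 u)) s <=
  2 `^ p * 4 * level_sum p x k.
Proof.
move=> p1 t1 st; have p0 : 0 < p by exact: lt_le_trans p1.
have t0 : 0 <= t by exact: itv_partition_le st.
pose h i := `|layer x k i| `^ p.
have h0 i : 0 <= h i by exact: powR_ge0.
have es := itv_partition_unit_step t1 st (mesh_lt2 t1 st).
rewrite power_sumE.
apply: (le_trans (@step_sum_le R (unit_step 2) _ (idx k.+1)
    (fun j => 2 `^ p * (h j + h j.+1)) 0 s es _)).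
  move=> y z /and4P[y0 yz z1 _].
  have yz' := idx_mono k.+1 y0 (ltW yz); split=> //.
  move: yz'; rewrite leq_eqVlt => /predU1P[->|lt_yz].
    by rewrite subrr normr0 powR0 ?gt_eqF// big_geq.
  apply: le_trans (_ : 2 `^ p * (h (idx k.+1 y) + h (idx k.+1 z)) <= _).
    apply: le_trans (powR_addr_le p0 (normr_ge0 _) (normr_ge0 _)).
    apply: ge0_ler_powR; rewrite ?nnegrE ?addr_ge0// ?(ltW p0)//.
    by rewrite [leRHS]addrC ler_normB.
  rewrite -big_distrr /= ler_wpM2l ?powR_ge0// big_split /= lerD//.
    by rewrite big_ltn// lerDl sumr_ge0.
  case: (idx k.+1 z) lt_yz => [//|j] lt_yz.
  by rewrite big_nat_recr//= lerDr sumr_ge0.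
rewrite -big_distrr /= -mulrA ler_wpM2l ?powR_ge0// (itv_partition_last st).
have -> : 4 * level_sum p x k = 2 * (2 * level_sum p x k) by ring.
rewrite -sum_layer_powR mulrDl mul1r big_split /= -!/(h _).
have i0 : idx k.+1 (0 : R) = 0%N.
  by rewrite /idx mulr0 truncn0 min0n.
rewrite i0 lerD//.
  rewrite [leRHS](big_cat_nat (n := idx k.+1 t))//= ?lerDl ?sumr_ge0//.
  by rewrite ltnW// idx_lt.
rewrite -[X in X <= _](big_add1 _ _ 0 (idx k.+1 t).+1 xpredT h).
rewrite [leRHS](big_cat_nat (n := (idx k.+1 t).+1))//= ?idx_lt//.
rewrite ler_wpDr ?sumr_ge0// [leRHS]big_ltn// lerDr//.
Qed.

Definition partial q x n N (u : R) : R :=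
  \sum_(n <= k < N) q ^+ k * layer x k (idx k.+1 u).

(** One more layer costs the convexity factor [(1 - theta)^(1 - p)] and gains the scale [q^p]. *)
Definition tail_ratio theta q p : R := (1 - theta) `^ (1 - p) * q `^ p.
Definition tail_const theta p : R := theta `^ (1 - p) * (2 `^ p * 4).

Lemma tail_const_ge0 theta p : 0 <= tail_const theta p.
Proof. by rewrite !mulr_ge0 ?powR_ge0. Qed.

Lemma powR_onem_ge1 theta p : 1 <= p -> 0 < theta < 1 -> 1 <= (1 - theta) `^ (1 - p).
Proof.
move=> p1 /andP[t0 t1].
rewrite -[leLHS](@powRr0 R (1 - theta)); apply: ger_powR; last by rewrite subr_le0.
by rewrite subr_gt0 t1 lerBlDr lerDl ltW.
Qed.

Lemma power_sum_partial_le p theta q t x n N s : 1 <= p -> 0 < theta < 1 ->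
  0 <= q -> t <= 1 -> itv_partition 0 t s -> (n <= N)%N ->
  power_sum p (partial q x n N) s <=
  tail_const theta p *
    \sum_(n <= k < N) tail_ratio theta q p ^+ k * level_sum p x k.
Proof.
move=> p1 th q0 t1 st nN.
pose K : R := (1 - theta) `^ (1 - p); pose L : R := theta `^ (1 - p).
have K1 : 1 <= K by exact: powR_onem_ge1.
have K0 : 0 <= K by exact: powR_ge0.
apply: (@le_trans _ _ (\sum_(0 <= i < size s) L * \sum_(n <= k < N)
   K ^+ (k - n) * ((q ^+ k) `^ p * `|layer x k (idx k.+1 (0 :: s)`_i.+1)
     - layer x k (idx k.+1 (0 :: s)`_i)| `^ p))).
  apply: ler_sum => i _; rewrite /partial -sumrB.
  apply: le_trans (powR_norm_sum_le _ p1 th nN) _.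
  rewrite ler_wpM2l ?powR_ge0//; apply: ler_sum => k _.
  rewrite -mulrBr normrM powRM// ger0_norm ?exprn_ge0//.
rewrite -big_distrr /= exchange_big /= /tail_const -/L -mulrA.
rewrite ler_wpM2l ?powR_ge0// big_distrr /= big_nat_cond [leRHS]big_nat_cond.
apply: ler_sum => k /andP[/andP[nk _] _].
rewrite -big_distrr -big_distrr /= mulrA [leRHS]mulrCA.
apply: ler_pM.
- by rewrite mulr_ge0 ?powR_ge0 ?exprn_ge0.
- by apply: sumr_ge0 => i _; exact: powR_ge0.
(* The exponent [k - n] of [K >= 1] is raised to [k], so that one series serves all [n]. *)
- rewrite /tail_ratio -/K exprMn.
  have -> : (q ^+ k) `^ p = (q `^ p) ^+ k.
    by rewrite -powR_mulrn// powRAC powR_mulrn ?powR_ge0.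
  by rewrite ler_wpM2r ?exprn_ge0 ?powR_ge0// ler_weXn2l ?leq_subr.
- exact: (power_sum_layer_le x k p1 t1 st).
Qed.

Lemma partial_sub q x n N u : (n <= N)%N ->
  partial q x 0 N u - partial q x 0 n u = partial q x n N u.
Proof.
by move=> nN; rewrite /partial (big_cat_nat (leq0n n) nN) /= addrAC subrr add0r.
Qed.

(** Along a fixed decomposition the power sum is a continuous function of finitely many values, so
    the bound for [partial q x n N] survives the limit in [N]. *)
Lemma power_sum_tail_le p theta q t x n s f B : 1 <= p -> 0 < theta < 1 ->
  0 <= q -> t <= 1 -> itv_partition 0 t s ->
  (forall u, 0 <= u <= 1 -> partial q x 0 N u @[N --> \oo] --> f u) ->
  (forall N, (n <= N)%N ->
    \sum_(n <= k < N) tail_ratio theta q p ^+ k * level_sum p x k <= B) ->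
  power_sum p (fun u => f u - partial q x 0 n u) s <= tail_const theta p * B.
Proof.
move=> p1 th q0 t1 st ff HB.
have cv : power_sum p (fun u => partial q x 0 N u - partial q x 0 n u) s @[N --> \oo]
    --> power_sum p (fun u => f u - partial q x 0 n u) s.
  apply: (power_sum_cvg p1 t1 st) => u u01.
  by apply: cvgB; [exact: ff|exact: cvg_cst].
rewrite -(cvg_lim _ cv)//; apply: limr_le; first by apply/cvg_ex; eexists; exact: cv.
exists n => // N /= nN.
rewrite (eq_power_sum _ (g := partial q x n N) t1 st); last first.
  by move=> u _; exact: partial_sub.
apply: le_trans (power_sum_partial_le x p1 th q0 t1 st nN) _.
by rewrite ler_wpM2l ?tail_const_ge0// HB.
Qed.

End layers.

(** * Paths with jumps at dyadic points *)

Section dyadic_regularity.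
Context {R : realType}.
Implicit Types (p t q e u v : R) (x : seq bool -> R) (f g : R -> R) (s : seq R).

(* Small oscillation on the dyadic intervals of a fine enough level, which are
   closed on the left: f is cadlag with jumps at dyadic points only. *)
Definition dyadic_regular f := forall e, 0 < e -> exists n, forall u v,
  0 <= u <= 1 -> 0 <= v <= 1 -> idx n u = idx n v -> `|f u - f v| <= e.

Lemma idx_eq_le n m u v : 0 <= u -> 0 <= v -> (n <= m)%N ->
  idx m u = idx m v -> idx n u = idx n v.
Proof. by move=> u0 v0 nm E; rewrite !(idx_div _ nm)// E. Qed.

Lemma partial_idx q x n u v : 0 <= u -> 0 <= v -> idx n u = idx n v ->
  partial q x 0 n u = partial q x 0 n v.
Proof.
move=> u0 v0 E; rewrite /partial; apply: eq_big_nat => k /andP[_ kn].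
by rewrite (idx_eq_le u0 v0 kn E).
Qed.

Lemma dyadic_regular_partial q x n : dyadic_regular (partial q x 0 n).
Proof.
move=> e e0; exists n => u v /andP[u0 _] /andP[v0 _] E.
by rewrite (partial_idx q x u0 v0 E) subrr normr0 ltW.
Qed.

Lemma dyadic_regular_approx f : (forall e, 0 < e -> exists2 g,
    dyadic_regular g & forall u, 0 <= u <= 1 -> `|f u - g u| <= e) ->
  dyadic_regular f.
Proof.
move=> H e e0; have e3 : 0 < e / 3 by rewrite divr_gt0.
have [g gr fg] := H _ e3; have [n Hn] := gr _ e3.
exists n => u v u01 v01 E.
have -> : f u - f v = (f u - g u) + (g u - g v) + (g v - f v) by ring.
have -> : e = e / 3 + e / 3 + e / 3 by field.
rewrite (le_trans (ler_normD _ _))// lerD//; last by rewrite distrC fg.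
by rewrite (le_trans (ler_normD _ _))// lerD// ?fg// Hn.
Qed.

Lemma dyadic_regularB f g : dyadic_regular f -> dyadic_regular g ->
  dyadic_regular (fun u => f u - g u).
Proof.
move=> fr gr e e0; have e2 : 0 < e / 2 by rewrite divr_gt0.
have [n Hn] := fr _ e2; have [m Hm] := gr _ e2.
exists (maxn n m) => u v u01 v01 E.
have /andP[u0 _] := u01; have /andP[v0 _] := v01.
have -> : f u - g u - (f v - g v) = (f u - f v) - (g u - g v) by ring.
rewrite (le_trans (ler_normB _ _))// [leRHS]splitr lerD//.
  by apply: Hn => //; apply: idx_eq_le E => //; exact: leq_maxl.
by apply: Hm => //; apply: idx_eq_le E => //; exact: leq_maxr.
Qed.

Lemma dyadic_point_itv n j : (j.+1 < 2 ^ n)%N -> 0 < (j.+1%:R / 2 ^+ n : R) < 1.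
Proof.
move=> jn; rewrite divr_gt0 ?pow2_gt0//= ltr_pdivrMr ?pow2_gt0// mul1r.
by rewrite -pow2E ltr_nat.
Qed.

Lemma idx_left n u w : 0 <= w <= 1 -> 0 <= u -> u < w -> w <= u + (2 ^+ n)^-1 ->
  forall j, (j.+1 < 2 ^ n)%N -> w = j.+1%:R / 2 ^+ n -> idx n u = j.
Proof.
move=> /andP[w0 w1] u0 uw wu j jn E; apply/eqP; rewrite eqn_leq.
rewrite -ltnS ltnNge leq_idx// -E -ltNge uw /= leq_idx//; last exact: ltnW.
by move: wu; rewrite E -natr1 mulrDl mul1r lerD2r.
Qed.

Lemma near_left_idx n j : (j.+1 < 2 ^ n)%N ->
  \forall u \near (j.+1%:R / 2 ^+ n : R)^'-, 0 <= u <= 1 /\ idx n u = j.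
Proof.
move=> jn; have /andP[w0 w1] := dyadic_point_itv jn; set w := _ / _ in w0 w1 *.
near=> u; have uw : u < w by near: u; exact: nbhs_left_lt.
have wu : w - (2 ^+ n)^-1 <= u.
  by near: u; apply: nbhs_left_ge; rewrite ltrBlDr ltrDl pow2V_gt0.
have u0 : 0 <= u.
  apply: le_trans wu; rewrite subr_ge0 /w -[leLHS]mul1r ler_wpM2r ?invr_ge0 ?pow2_ge0//.
  by rewrite ler1n.
split; first by rewrite u0 ltW// (lt_trans uw).
apply: (@idx_left n u w) => //; first by rewrite !ltW.
by rewrite -lerBlDr.
Unshelve. all: end_near. Qed.

(** The numerator stays a successor, so that the point is again the common end of two consecutive
    intervals of level [N]. *)
Lemma dyadic_point_refine n N j : (n <= N)%N ->
  j.+1%:R / 2 ^+ n = ((j.+1 * 2 ^ (N - n)).-1).+1%:R / 2 ^+ N :> R.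
Proof.
move=> nN; rewrite prednK ?muln_gt0 ?expn_gt0// natrM pow2E.
rewrite -{2}(subnK nN) exprD invfM mulrA mulfK ?gt_eqF ?pow2_gt0//.
Qed.

Lemma dyadic_point_refine_lt n N j : (n <= N)%N -> (j.+1 < 2 ^ n)%N ->
  ((j.+1 * 2 ^ (N - n)).-1.+1 < 2 ^ N)%N.
Proof.
move=> nN jn; rewrite prednK ?muln_gt0 ?expn_gt0//.
by rewrite -{2}(subnKC nN) expnD ltn_pmul2r ?expn_gt0.
Qed.

(** At a fine level the oscillation on the interval just left of the point is small, which is the
    Cauchy criterion. *)
Lemma dyadic_regular_left_cvg f n j : dyadic_regular f -> (j.+1 < 2 ^ n)%N ->
  cvg (f u @[u --> (j.+1%:R / 2 ^+ n : R)^'-]).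
Proof.
move=> fr jn; set w : R := _ / _.
apply/cauchy_cvgP/cauchy_exP => e e0.
have [m Hm] := fr _ (divr_gt0 e0 (ltr0Sn R 1)).
pose N := maxn n m; have nN : (n <= N)%N := leq_maxl _ _.
have mN : (m <= N)%N := leq_maxr _ _.
have wE : w = _ := dyadic_point_refine j nN.
have JN := dyadic_point_refine_lt nN jn.
set J := (_.-1) in wE JN.
exists (f (J%:R / 2 ^+ N)).
have JN' : (J < 2 ^ N)%N by exact: ltnW.
rewrite wE; suff : \forall u \near (J.+1%:R / 2 ^+ N : R)^'-,
  ball (f (J%:R / 2 ^+ N)) e (f u) by [].
near=> u; rewrite /ball /=.
have [u01 uJ] : 0 <= u <= 1 /\ idx N u = J by near: u; exact: near_left_idx.
apply: (@le_lt_trans _ _ (e / 2)); last by rewrite ltr_pdivrMr// ltr_pMr// ltr1n.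
have u0 : 0 <= u by case/andP: u01.
have d0 : 0 <= J%:R / 2 ^+ N :> R by rewrite divr_ge0 ?pow2_ge0.
apply: Hm => //; last by apply: idx_eq_le mN _ => //; rewrite uJ idx_dyadic.
by rewrite d0 /= ler_pdivrMr ?pow2_gt0// mul1r -pow2E ler_nat ltnW.
Unshelve. all: end_near. Qed.

Lemma jumpB f g n j : dyadic_regular f -> dyadic_regular g -> (j.+1 < 2 ^ n)%N ->
  jump (fun u => f u - g u) (j.+1%:R / 2 ^+ n) =
  jump f (j.+1%:R / 2 ^+ n) - jump g (j.+1%:R / 2 ^+ n).
Proof.
move=> fr gr jn; rewrite /jump limB; [ring|exact: dyadic_regular_left_cvg..].
Qed.

(** The point begins the interval of [v], and its left limit is taken inside the interval of [u];
    each oscillation is at most [e / 2]. The threshold is the same for all points. *)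
Lemma jump_approx f e : dyadic_regular f -> 0 < e -> exists N, forall n, (N <= n)%N ->
  forall j u v, (j.+1 < 2 ^ n)%N -> 0 <= u <= 1 -> 0 <= v <= 1 ->
  idx n u = j -> idx n v = j.+1 ->
  `|f v - f u - jump f (j.+1%:R / 2 ^+ n)| <= e.
Proof.
move=> fr e0; have [m Hm] := fr _ (divr_gt0 e0 (ltr0Sn R 1)).
exists m => n mn j u v jn u01 v01 uj vj.
have /andP[u0 _] := u01; have /andP[v0 _] := v01.
have cvl := dyadic_regular_left_cvg fr jn.
set w : R := _ / _ in cvl *.
have /andP[w0 w1] : 0 < w < 1 by exact: dyadic_point_itv.
have -> : f v - f u - jump f w = (f v - f w) + (lim (f u @[u --> w^'-]) - f u).
  by rewrite /jump; ring.
rewrite (le_trans (ler_normD _ _))// [leRHS]splitr lerD//.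
  apply: Hm => //; first by rewrite !ltW.
  by apply: idx_eq_le mn _ => //; rewrite ?(ltW w0)// vj idx_dyadic.
have : `|f z - f u| @[z --> w^'-] --> `|lim (f u @[u --> w^'-]) - f u|.
  by apply: cvg_norm; apply: cvgB => //; exact: cvg_cst.
move=> cv; rewrite -(cvg_lim _ cv)//; apply: limr_le.
  by apply/cvg_ex; eexists; exact: cv.
near=> z; have [z01 zj] : 0 <= z <= 1 /\ idx n z = j by near: z; exact: near_left_idx.
by apply: Hm => //; apply: idx_eq_le mn _ => //; [case/andP: z01|rewrite zj].
Unshelve. all: end_near. Qed.

Lemma jump_partial q x n j u v : (j.+1 < 2 ^ n)%N -> 0 <= u <= 1 -> 0 <= v <= 1 ->
  idx n u = j -> idx n v = j.+1 ->
  jump (partial q x 0 n) (j.+1%:R / 2 ^+ n) = partial q x 0 n v - partial q x 0 n u.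
Proof.
move=> jn /andP[u0 _] /andP[v0 _] uj vj; rewrite /jump; congr (_ - _).
  by apply: partial_idx => //; rewrite vj idx_dyadic.
apply: cvg_lim => //; apply: cvg_near_cst.
near=> z; have [/andP[z0 _] zj] : 0 <= z <= 1 /\ idx n z = j.
  by near: z; exact: near_left_idx.
by apply: partial_idx => //; rewrite zj.
Unshelve. all: end_near. Qed.

(** By [leq_idx], for [t] in [0, 1] the range gives the level-n points in (0, t] other than 1. *)
Definition jump_sum p f t n : R :=
  \sum_(0 <= j < idx n t) `|jump f (j.+1%:R / 2 ^+ n)| `^ p.

(* An interval of length less than 2^-N crossing a dyadic point of level
   n <= N does so between two consecutive intervals of level N. *)
Lemma idx_crossing n N (y z : R) j : (n <= N)%N -> 0 <= y -> z <= 1 -> y < z ->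
  z < y + (2 ^+ N)^-1 -> idx n y = j -> idx n z = j.+1 ->
  let J := (j.+1 * 2 ^ (N - n)).-1 in idx N y = J /\ idx N z = J.+1.
Proof.
move=> nN y0 z1 yz zy yj zj J; have z0 : 0 <= z by rewrite (le_trans y0)// ltW.
have := idx_step y0 z0 zy.
have := idx_div y0 nN; have := idx_div z0 nN; rewrite yj zj => Ez Ey.
have p0 : (0 < 2 ^ (N - n))%N by rewrite expn_gt0.
have : (idx N y < j.+1 * 2 ^ (N - n))%N by rewrite -ltn_divLR// -Ey.
have : (j.+1 * 2 ^ (N - n) <= idx N z)%N by rewrite -leq_divRL// -Ez.
rewrite /J; lia.
Qed.

(** A fine decomposition crosses each level-n point in a step of its own, whose increment is close
    to the jump by [jump_approx]. There are fewer than 2^n points, so each may lose [e / 2^n]. *)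
Lemma jump_sum_liminf p f t n e : 1 <= p -> dyadic_regular f -> t <= 1 -> 0 < e ->
  exists2 delta, 0 < delta & forall s, itv_partition 0 t s -> mesh s < delta ->
    jump_sum p f t n - e <= power_sum p f s.
Proof.
move=> p1 fr t1 e0.
pose e' := e / (2 ^ n)%:R; have e'0 : 0 < e' by rewrite divr_gt0// ltr0n expn_gt0.
have [eta eta0 Heta] : exists2 eta, 0 < eta & forall j, (j < 2 ^ n)%N -> forall a,
    `|a - jump f (j.+1%:R / 2 ^+ n)| <= eta ->
    `|jump f (j.+1%:R / 2 ^+ n)| `^ p - e' <= `|a| `^ p.
  have : forall j : 'I_(2 ^ n), \forall eta \near 0^'+, forall a,
      `|a - jump f (j.+1%:R / 2 ^+ n)| <= eta ->
      `|jump f (j.+1%:R / 2 ^+ n)| `^ p - e' <= `|a| `^ p.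
    move=> j; set D := jump _ _.
    have /cvgrPdist_le/(_ _ e'0)/nbhs_ballP[r /= r0 Hr] := continuous_powR_norm p1 (x := D).
    near=> eta => a aD.
    have : ball D r a.
      rewrite /ball /= distrC (le_lt_trans aD)//; near: eta; exact: nbhs_right_lt.
    by move/Hr => /=; rewrite ler_norml => /andP[_]; lra.
  move/filter_forall => H; near (0 : R)^'+ => eta.
  exists eta; first by near: eta; exact: nbhs_right_gt.
  move=> j jn; have : forall i : 'I_(2 ^ n), forall a,
      `|a - jump f (i.+1%:R / 2 ^+ n)| <= eta ->
      `|jump f (i.+1%:R / 2 ^+ n)| `^ p - e' <= `|a| `^ p by near: eta.
  by move=> /(_ (Ordinal jn)).
have [N0 HN] := jump_approx fr eta0.
pose N := maxn n N0; have nN : (n <= N)%N := leq_maxl _ _.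
have N0N : (N0 <= N)%N := leq_maxr _ _.
exists (2 ^+ N)^-1 => [|s st ms]; first exact: pow2V_gt0.
have es := itv_partition_unit_step t1 st ms.
rewrite power_sumE.
apply: le_trans (@step_sum_ge R _ _ (idx n)
  (fun j => `|jump f (j.+1%:R / 2 ^+ n)| `^ p - e') 0 s es _); last first.
  move=> y z /and4P[y0 yz z1 zy]; rewrite ltrBlDl in zy.
  have z0 : 0 <= z by rewrite (le_trans y0)// ltW.
  have yz' := idx_mono n y0 (ltW yz); split=> //.
  have zy' : z < y + (2 ^+ n)^-1.
    apply: lt_le_trans zy _; rewrite lerD2l lef_pV2 ?posrE ?pow2_gt0//.
    by rewrite ler_weXn2l// ler1n.
  have := idx_step y0 z0 zy'; rewrite leq_eqVlt => /predU1P[E|]; last first.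
    by rewrite ltnS => zy''; rewrite big_geq ?powR_ge0.
  rewrite E big_nat1.
  have jn : ((idx n y).+1 < 2 ^ n)%N by rewrite -E idx_lt.
  apply: (Heta _ (ltnW jn)).
  have [yJ zJ] := idx_crossing nN y0 z1 yz zy erefl E.
  rewrite (dyadic_point_refine _ nN).
  apply: HN => //; first exact: dyadic_point_refine_lt.
    by rewrite y0 (le_trans (ltW yz)).
  by rewrite z0.
rewrite (itv_partition_last st).
have -> : idx n (0 : R) = 0%N by rewrite /idx mulr0 truncn0 min0n.
rewrite sumrB lerD2l lerN2 sumr_const_nat subn0 -mulr_natr /e'.
rewrite mulrAC ler_pdivrMr ?ltr0n ?expn_gt0// ler_wpM2l ?(ltW e0)//.
by rewrite ler_nat ltnW// idx_lt.
Unshelve. all: end_near. Qed.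

End dyadic_regularity.

(** * Jumps at dyadic points, ordered by level *)

Section jumps.
Context {R : realType}.
Implicit Types (p t q e u v : R) (x : seq bool -> R) (f g : R -> R) (s : seq R).

(** The midpoint of the cylinder of [word k i]; every dyadic point of (0, 1) comes from exactly one
    pair with [i < 2 ^ k]. *)
Definition odd_dyadic k i : R := i.*2.+1%:R / 2 ^+ k.+1.

Lemma odd_dyadic_inj k l i j : odd_dyadic k i = odd_dyadic l j -> k = l /\ i = j.
Proof.
wlog kl : k l i j / (k <= l)%N.
  move=> H; case/orP: (leq_total k l) => kl; first exact: H.
  by move=> /esym/(H _ _ _ _ kl)[-> ->].
move/eqP; rewrite /odd_dyadic eqr_div ?pow2_neq0// -!pow2E -!natrM eqr_nat.
rewrite -{1}(subnKC kl) -addSn expnD mulnA mulnAC eqn_pmul2r ?expn_gt0// => /eqP.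
case E : (l - k)%N => [|m]; last by rewrite expnS; lia.
have -> : k = l by apply/eqP; rewrite eqn_leq kl -subn_eq0 E.
by rewrite expn0 muln1 => -[/double_inj].
Qed.

Lemma dyadicE : @dyadic R =
  \bigcup_k [set` [seq odd_dyadic k i | i <- iota 0 (2 ^ k)]].
Proof.
apply/seteqP; split => u /=.
  move=> [n _ [i /= i12 <-]]; have {i12} : (0 < i < 2 ^ n)%N by lia.
  elim: n i => [|n IH] i; first by rewrite expn0; lia.
  rewrite expnS => /andP[i0 i1]; have [oi|ei] := boolP (odd i).
    exists n => //=; apply/mapP; exists i./2; first by rewrite mem_iota; lia.
    by rewrite /odd_dyadic -[i in LHS]odd_double_half oi.
  have [|k _ Hk] := IH i./2; first by lia.
  exists k => //=; suff -> : i%:R / (2 ^+ n.+1) = i./2%:R / (2 ^+ n) :> R by [].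
  rewrite -[i in LHS]odd_double_half (negbTE ei) add0n -mul2n natrM exprS.
  by rewrite invfM mulrACA divff ?mul1r.
move=> [k _ /mapP[i]]; rewrite mem_iota add0n => /andP[_ ik] ->.
exists k.+1 => //; exists i.*2.+1 => //=; rewrite expnS; lia.
Qed.

Definition level_jump_sum p f t k : R :=
  \sum_(0 <= i < 2 ^ k | odd_dyadic k i <= t) `|jump f (odd_dyadic k i)| `^ p.

Lemma level_jump_sum_ge0 p f t k : 0 <= level_jump_sum p f t k.
Proof. by apply: sumr_ge0 => i _; exact: powR_ge0. Qed.

Lemma esum_dyadic p f t :
  \esum_(u in dyadic `&` `[0, t]) (`|jump f u| `^ p)%:E =
  (\sum_(0 <= k <oo) (level_jump_sum p f t k)%:E)%E.
Proof.
rewrite esum_mkcondr dyadicE nneseries_sum_bigcup; last 2 first.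
- move=> k l _ _ [u []] /=.
  by move=> /mapP[i _ ->] /mapP[j _] /odd_dyadic_inj[].
- by move=> u; case: ifP => // _; rewrite lee_fin powR_ge0.
apply: eq_eseriesr => k _; rewrite esum_fset; last 2 first.
- exact: finite_seq.
- by move=> u _; case: ifP => // _; rewrite lee_fin powR_ge0.
rewrite -fsbig_seq; last first.
  by rewrite map_inj_uniq ?iota_uniq// => i j /odd_dyadic_inj[].
rewrite big_map /level_jump_sum [in RHS]big_mkcond -sumEFin /= /index_iota subn0.
apply: eq_bigr => i _.
have -> : (odd_dyadic k i \in `[0, t]%classic) = (odd_dyadic k i <= t).
  rewrite mem_setE in_itv /= /odd_dyadic divr_ge0// pow2_ge0//.
by case: ifP.
Qed.

(** The range no longer depends on [t], so that level [n.+1] splits into even indices, the points of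
    level [n], and odd ones, the new points. *)
Lemma jump_sumE p f t n : 0 <= t -> jump_sum p f t n =
  \sum_(0 <= j < 2 ^ n) if (0 < j)%N && (j%:R / 2 ^+ n <= t)
    then `|jump f (j%:R / 2 ^+ n)| `^ p else 0.
Proof.
move=> t0; rewrite /jump_sum.
rewrite -(big_add1 _ _ 0 (idx n t).+1 xpredT (fun j => `|jump f (j%:R / 2 ^+ n)| `^ p)).
rewrite [RHS](@big_cat_nat _ _ _ (idx n t).+1)//=; last exact: idx_lt.
rewrite [X in _ = _ + X]big_nat_cond [X in _ = _ + X]big1 ?addr0; last first.
  move=> j /andP[/andP[j1 j2] _].
  by rewrite -leq_idx// [(j <= _)%N]leqNgt j1 andbF.
rewrite [RHS]big_ltn//= add0r; apply: eq_big_nat => j /andP[j1 j2].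
rewrite j1 -leq_idx ?(leq_trans j2) ?idx_lt//.
by rewrite ltnS in j2; rewrite j2.
Qed.

Lemma jump_sumS p f t n : 0 <= t ->
  jump_sum p f t n.+1 = jump_sum p f t n + level_jump_sum p f t n.
Proof.
move=> t0; rewrite !jump_sumE// /level_jump_sum; move: (jump f) => a.
rewrite expnS mul2n big_nat_double big_split /=.
have even_part i : i.*2%:R / 2 ^+ n.+1 = i%:R / 2 ^+ n :> R.
  by rewrite -mul2n natrM exprS invfM mulrACA divff ?mul1r.
rewrite (eq_bigr (fun j => if (0 < j)%N && (j%:R / 2 ^+ n <= t)
    then `|a (j%:R / 2 ^+ n)| `^ p else 0)); last first.
  by move=> i _; rewrite double_gt0 even_part.
by rewrite [X in _ = _ + X]big_mkcond.
Qed.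

Lemma jump_sum_level p f t n : 0 <= t ->
  jump_sum p f t n = \sum_(0 <= k < n) level_jump_sum p f t k.
Proof.
move=> t0; elim: n => [|n IH]; last by rewrite jump_sumS// IH big_nat_recr.
by rewrite /jump_sum idx0 !big_geq.
Qed.

(** A point that is not dyadic is interior, relative to [0, 1], to its interval of level [n], so
    nearby points have the same index. *)
Lemma not_dyadic_continuous f t : dyadic_regular f -> 0 <= t <= 1 ->
  ~ dyadic t -> f u @[u --> within `[0, 1] (nbhs t)] --> f t.
Proof.
move=> fr t01 nd; have /andP[t0 t1] := t01.
apply/cvgrPdist_le => /= e e0; have [n Hn] := fr _ e0.
have lo : (0 < idx n t)%N -> (idx n t)%:R / 2 ^+ n < t.
  move=> i0; rewrite lt_neqAle idx_le// andbT; apply/eqP => E; apply: nd.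
  have il := idx_lt n t; exists n => /=; last by exists (idx n t) => //=; lia.
  by case: n {Hn E} i0 il => //; rewrite expn0; lia.
have nlo : \forall u \near t, (0 < idx n t)%N -> (idx n t)%:R / 2 ^+ n < u.
  have [->|/lo it] := posnP (idx n t); first by near=> u.
  by near=> u => _; near: u; exact: lt_nbhsr.
have nhi : \forall u \near t, ((idx n t).+1 < 2 ^ n)%N -> u < (idx n t).+1%:R / 2 ^+ n.
  have [_|/(lt_idxS t0) it] := leqP (2 ^ n) (idx n t).+1; first by near=> u.
  by near=> u => _; near: u; exact: lt_nbhsl.
rewrite near_withinE; near=> u; rewrite /= in_itv /= => u01; apply: Hn => //; have /andP[u0 u1] := u01.
apply/eqP; rewrite eqn_leq; apply/andP; split.
  rewrite leq_idx ?idx_lt//; have [->|i0] := posnP (idx n t); first by rewrite mul0r.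
  by apply: ltW; move: i0; near: u; exact: nlo.
rewrite -ltnS; have := idx_lt n t; rewrite leq_eqVlt => /predU1P[->|it].
  exact: idx_lt.
by rewrite ltnNge leq_idx// -ltNge; move: it; near: u; exact: nhi.
Unshelve. all: end_near. Qed.

Lemma jump_continuous f n j : (j.+1 < 2 ^ n)%N ->
  let t : R := j.+1%:R / 2 ^+ n in
  f u @[u --> within `[0, 1] (nbhs t)] --> f t -> jump f t = 0.
Proof.
move=> jn t ft; rewrite /jump; suff -> : lim (f u @[u --> t^'-]) = f t by rewrite subrr.
apply: cvg_lim => //; apply: cvg_trans ft; apply: cvg_app => A.
rewrite /within /= => HA.
have HA' : \forall u \near t, `[0, 1]%classic u -> A u by [].
near=> u; have uA : `[0, 1]%classic u -> A u.
  by near: u; rewrite /at_left near_withinE; apply: filterS HA' => z Hz _.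
apply: uA; rewrite /= in_itv /=.
suff [] : 0 <= u <= 1 /\ idx n u = j by [].
by near: u; exact: near_left_idx.
Unshelve. all: end_near. Qed.

(** All discontinuities in (0, 1) or at its ends would have to be dyadic; a dyadic point of
    continuity has jump 0 and adds nothing, as [0^p = 0] for [p != 0]. *)
Lemma Wvar_dyadic p f t : p != 0 -> dyadic_regular f -> t <= 1 ->
  Wvar p t f = \esum_(u in dyadic `&` `[0, t]) (`|jump f u| `^ p)%:E.
Proof.
move=> p0 fr t1; rewrite /Wvar esum_mkcond [RHS]esum_mkcond; apply: eq_esum => u _.
have [|un] := boolP (u \in discontinuities f `&` `[0, t]);
  have [|vn] := boolP (u \in dyadic `&` `[0, t]) => //.
- rewrite inE => -[[u01 du] ut]; move: vn => /negP; rewrite inE; case.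
  split=> //; apply: contrapT => nu; apply: du.
  by apply: not_dyadic_continuous => //; rewrite in_itv in u01.
- rewrite inE => -[du ut]; move: un => /negP; rewrite inE => un.
  suff -> : jump f u = 0 by rewrite normr0 powR0.
  have [n n1 [i i2 E]] := du; case: i i2 E => [//|i] /= i2 E.
  rewrite -{}E in ut un *; set w : R := _ / _ in ut un *.
  apply: jump_continuous; first by lia.
  apply: contrapT => Hw; apply: un; split=> //; split=> //.
  have /andP[w0 w1] : 0 < (w : R) < 1 by apply: dyadic_point_itv; lia.
  by rewrite /= in_itv /= !ltW.
Qed.

Lemma Wvar_levels p f t : p != 0 -> dyadic_regular f -> t <= 1 ->
  Wvar p t f = (\sum_(0 <= k <oo) (level_jump_sum p f t k)%:E)%E.
Proof. by move=> p0 fr t1; rewrite Wvar_dyadic// esum_dyadic. Qed.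

End jumps.

(** * Fine decompositions and the mesh filter *)

Section fine_partitions.
Context {R : realType}.
Implicit Types (p t q theta e delta : R) (x : seq bool -> R) (f : R -> R) (s : seq R).

Lemma exists_fine_partition t delta : 0 < t -> 0 < delta ->
  exists2 s, itv_partition 0 t s & mesh s < delta.
Proof.
move=> t0 d0; pose M := (Num.trunc (t / delta)).+1.
have M0 : 0 < M%:R :> R by rewrite ltr0n.
have step0 : 0 < t / M%:R by rewrite divr_gt0.
pose g i : R := t / M%:R * i%:R.
have nth_g i : (i <= M)%N -> (0 :: mkseq (fun i => g i.+1) M)`_i = g i.
  case: i => [|i] iM /=; first by rewrite /g mulr0.
  by rewrite nth_mkseq.
exists (mkseq (fun i => g i.+1) M).
  split.
    apply/(pathP 0) => i; rewrite size_mkseq => iM.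
    rewrite nth_g ?(ltnW iM)// nth_mkseq// /g ltr_pM2l// ltr_nat//.
  rewrite (last_nth 0) size_mkseq nth_g//; apply/eqP.
  by rewrite /g divfK// gt_eqF.
rewrite /mesh size_mkseq big_nat_cond; elim/big_ind: _ => //.
  by move=> y z y2 z2; rewrite gt_max y2.
move=> i /andP[/andP[_ iM] _]; rewrite !nth_g ?(ltnW iM)//.
rewrite /g -mulrBr -natr1 addrAC subrr add0r mulr1 ger0_norm ?(ltW step0)//.
by rewrite ltr_pdivrMr// mulrC -ltr_pdivrMr// /M truncnS_gt.
Qed.

Lemma mesh_to0_filter t : 0 < t -> ProperFilter (mesh_to0 t).
Proof.
move=> t0; apply: filter_from_proper; last first.
  move=> d d0; have [s st ms] := exists_fine_partition t0 d0.
  by exists s.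
apply: filter_from_filter; first by exists 1; exact: ltr01.
move=> a b a0 b0; exists (Num.min a b); first by rewrite /= lt_min a0.
by move=> s [st]; rewrite lt_min => /andP[sa sb].
Qed.

Lemma power_sum_partial_fine p q t x n s : 1 <= p -> t <= 1 -> itv_partition 0 t s ->
  mesh s < (2 ^+ n)^-1 ->
  power_sum p (partial q x 0 n) s = jump_sum p (partial q x 0 n) t n.
Proof.
move=> p1 t1 st ms; have p0 : p != 0 by rewrite gt_eqF// (lt_le_trans _ p1).
have es := itv_partition_unit_step t1 st ms.
rewrite power_sumE; set G := fun _ => _.
have H y z : unit_step (2 ^+ n)^-1 y z -> (idx n y <= idx n z)%N /\
    G y z = \sum_(idx n y <= j < idx n z)
      `|jump (partial q x 0 n) (j.+1%:R / 2 ^+ n)| `^ p.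
  move=> /and4P[y0 yz z1 zy]; have z0 : 0 <= z by rewrite (le_trans y0)// ltW.
  have yz' := idx_mono n y0 (ltW yz); split=> //.
  rewrite ltrBlDl in zy; have := idx_step y0 z0 zy.
  rewrite leq_eqVlt => /predU1P[E|]; last first.
    rewrite ltnS => zy'; have E : idx n y = idx n z by apply/eqP; rewrite eqn_leq yz' zy'.
    by rewrite E big_geq// /G (partial_idx q x y0 z0 E) subrr normr0 powR0.
  rewrite E big_nat1 (@jump_partial _ q x n (idx n y) y z)//.
  - by rewrite -E idx_lt.
  - by rewrite y0 (le_trans (ltW yz)).
  - by rewrite z0.
pose phi j := `|jump (partial q x 0 n) (j.+1%:R / 2 ^+ n)| `^ p.
have i0 : idx n (0 : R) = 0%N by rewrite /idx mulr0 truncn0 min0n.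
have E : jump_sum p (partial q x 0 n) t n =
    \sum_(idx n (0 : R) <= j < idx n (last 0 s)) phi j.
  by rewrite i0 (itv_partition_last st).
rewrite E; apply/eqP; rewrite eq_le; apply/andP; split.
  by apply: (step_sum_le es) => y z /H[? ->].
by apply: (step_sum_ge es) => y z /H[? ->].
Qed.

(** Fine decompositions exist, and their power sums fall below the jump sum by an arbitrarily small
    amount at most; so a bound on small meshes is a bound on jump sums. *)
Lemma jump_sum_le p f t n M : 1 <= p -> dyadic_regular f -> 0 < t <= 1 ->
  (exists2 delta, 0 < delta & forall s, itv_partition 0 t s -> mesh s < delta ->
     power_sum p f s <= M) ->
  jump_sum p f t n <= M.
Proof.
move=> p1 fr /andP[t0 t1] [d d0 Hd]; apply/ler_addgt0Pr => e e0.
have [d' d'0 Hd'] := jump_sum_liminf n p1 fr t1 e0.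
have dd0 : 0 < Num.min d d' by rewrite lt_min d0.
have [s st] := exists_fine_partition t0 dd0.
rewrite lt_min => /andP[sd sd'].
by rewrite -lerBlDr (le_trans (Hd' s st sd'))// Hd.
Qed.

Lemma jump_sumD_le p theta f g t n : 1 <= p -> 0 < theta < 1 ->
  dyadic_regular f -> dyadic_regular g ->
  jump_sum p f t n <= (1 - theta) `^ (1 - p) * jump_sum p g t n +
     theta `^ (1 - p) * jump_sum p (fun u => f u - g u) t n.
Proof.
move=> p1 th fr gr; rewrite /jump_sum !big_distrr -big_split /= !big_mkord.
apply: ler_sum => j _.
have jn : (j.+1 < 2 ^ n)%N by exact: leq_ltn_trans (ltn_ord j) (idx_lt n t).
rewrite (jumpB fr gr jn); apply: le_trans (powR_normD_le _ _ p1 th).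
by rewrite addrC subrK.
Qed.

Lemma jump_sum_distrC p f g t n : dyadic_regular f -> dyadic_regular g ->
  jump_sum p (fun u => f u - g u) t n = jump_sum p (fun u => g u - f u) t n.
Proof.
move=> fr gr; apply: eq_big_nat => j /andP[_ jt].
have jn : (j.+1 < 2 ^ n)%N by exact: leq_ltn_trans jt (idx_lt n t).
by rewrite !jumpB// distrC.
Qed.

Lemma power_sumB_le p theta f g s : 1 <= p -> 0 < theta < 1 ->
  power_sum p f s <= (1 - theta) `^ (1 - p) * power_sum p g s +
     theta `^ (1 - p) * power_sum p (fun u => f u - g u) s.
Proof.
move=> p1 th; apply: le_trans (power_sumD_le g (fun u => f u - g u) s p1 th).
by rewrite le_eqVlt; apply/orP; left; apply/eqP; congr power_sum; apply/funext => u; ring.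
Qed.

Lemma power_sum_distrC p f g s :
  power_sum p (fun u => f u - g u) s = power_sum p (fun u => g u - f u) s.
Proof.
apply: eq_bigr => i _; rewrite -normrN; congr (`|_| `^ _); ring.
Qed.

End fine_partitions.

Section variation_estimate.
Context {R : realType}.
Variables (p q theta0 : R) (x : seq bool -> R) (f : R -> R) (B : nat -> R).
Hypotheses (p1 : 1 <= p) (q0 : 0 <= q) (th0 : 0 < theta0 < 1).
Hypothesis fr : dyadic_regular f.
Hypothesis ff : forall u, 0 <= u <= 1 -> partial q x 0 N u @[N --> \oo] --> f u.
Hypothesis HB : forall n N, (n <= N)%N ->
  \sum_(n <= k < N) tail_ratio theta0 q p ^+ k * level_sum p x k <= B n.

Let C := tail_const theta0 p.

Lemma power_sum_le_total t s : t <= 1 -> itv_partition 0 t s ->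
  power_sum p f s <= C * B 0.
Proof.
move=> t1 st.
have := power_sum_tail_le p1 th0 q0 t1 st ff (HB (n := 0)).
rewrite (eq_power_sum _ (g := f) t1 st)// => u _.
by rewrite /partial big_geq// subr0.
Qed.

Section two_sided.
Variables (theta t : R) (n : nat).
Hypotheses (th : 0 < theta < 1) (t01 : 0 < t <= 1).

Let K := (1 - theta) `^ (1 - p).
Let L := theta `^ (1 - p).
(** Two comparisons are chained, of [f] with the step function and back. Each costs a factor [K],
    and of the two tail terms [L * (C * B n)] one is multiplied by [K]. *)
Let rem := (K + 1) * (L * (C * B n)).

Let K1 : 1 <= K. Proof. exact: powR_onem_ge1. Qed.
Let K0 : 0 <= K. Proof. exact: powR_ge0. Qed.
Let L0 : 0 <= L. Proof. exact: powR_ge0. Qed.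

Let tail_le s : itv_partition 0 t s ->
  power_sum p (fun u => f u - partial q x 0 n u) s <= C * B n.
Proof.
have /andP[_ t1] := t01.
by move=> st; exact: (power_sum_tail_le p1 th0 q0 t1 st ff (HB (n := n))).
Qed.

Let jump_tail_le : jump_sum p (fun u => f u - partial q x 0 n u) t n <= C * B n.
Proof.
apply: jump_sum_le => //.
  by apply: dyadic_regularB => //; exact: dyadic_regular_partial.
by exists 1 => // s st _; exact: tail_le.
Qed.

Lemma power_sum_le_jump_sum s : itv_partition 0 t s -> mesh s < (2 ^+ n)^-1 ->
  power_sum p f s <= K ^+ 2 * jump_sum p f t n + rem.
Proof.
move=> st ms; have /andP[t0 t1] := t01.
have pr := dyadic_regular_partial q x n.
have H1 := power_sumB_le f (partial q x 0 n) s p1 th.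
rewrite (power_sum_partial_fine q x p1 t1 st ms) in H1.
have H2 := jump_sumD_le t n p1 th pr fr.
rewrite (jump_sum_distrC p t n pr fr) in H2.
have T1 := ler_wpM2l L0 (tail_le st); have T2 := ler_wpM2l L0 jump_tail_le.
rewrite -/K -/L in H1 H2.
have H3 := ler_wpM2l K0 (le_trans H2 (lerD (lexx _) T2)).
apply: (le_trans H1); apply: (le_trans (lerD H3 T1)).
by rewrite /rem le_eqVlt; apply/orP; left; apply/eqP; ring.
Qed.

(** All decompositions of mesh below 2^-n give the step function the same power sum. Hence the power
    sum of [f] along any such [s'] is controlled by that along [s], and [jump_sum_le] turns this
    into a bound at every level [m]. *)
Lemma jump_sum_le_power_sum s m : itv_partition 0 t s -> mesh s < (2 ^+ n)^-1 ->
  jump_sum p f t m <= K ^+ 2 * power_sum p f s + rem.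
Proof.
move=> st ms; have /andP[t0 t1] := t01.
have pr := dyadic_regular_partial q x n.
have T s' : itv_partition 0 t s' -> L * _ <= L * _ := fun H => ler_wpM2l L0 (tail_le H).
have H1 := power_sumB_le (partial q x 0 n) f s p1 th.
rewrite power_sum_distrC (power_sum_partial_fine q x p1 t1 st ms) -/K -/L in H1.
have H2 := le_trans H1 (lerD (lexx _) (T s st)).
apply: jump_sum_le => //; exists (2 ^+ n)^-1 => [|s' st' ms']; first exact: pow2V_gt0.
have := power_sumB_le f (partial q x 0 n) s' p1 th.
rewrite (power_sum_partial_fine q x p1 t1 st' ms') -/K -/L => H3.
have H4 := le_trans H3 (lerD (ler_wpM2l K0 H2) (T s' st')).
apply: (le_trans H4).
by rewrite /rem le_eqVlt; apply/orP; left; apply/eqP; ring.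
Qed.

End two_sided.
End variation_estimate.

(** * Comparison of power sums with jump sums *)

Section limits.
Context {R : realType}.
Implicit Types (p t q theta e : R) (x : seq bool -> R) (f : R -> R) (s : seq R).

Lemma exists_small_theta p e : 0 < e ->
  exists2 theta, 0 < theta < 1 & ((1 - theta) `^ (1 - p)) ^+ 2 - 1 <= e.
Proof.
move=> e0.
have c1 : {for 1, continuous (fun y : R => y `^ (1 - p))}.
  apply: differentiable_continuous; apply/derivable1_diffP.
  by apply: derivable_powR; rewrite in_itv /= andbT.
have c0 : 1 - theta @[theta --> (0 : R)] --> (1 - 0 : R).
  by apply: cvgB; [exact: cvg_cst|exact: cvg_id].
rewrite subr0 in c0.
have c2 := continuous_cvg (nbhs_filter (0 : R)) c1 c0; rewrite powR1 /= in c2.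
have cv : ((1 - theta) `^ (1 - p)) ^+ 2 @[theta --> (0 : R)] --> (1 : R).
  rewrite (_ : (fun theta => _) = fun theta : R =>
    (1 - theta) `^ (1 - p) * (1 - theta) `^ (1 - p)).
    have c3 := cvgM c2 c2; rewrite mulr1 in c3; exact: c3.
  by apply/funext => z; rewrite expr2.
have cvr : ((1 - theta) `^ (1 - p)) ^+ 2 @[theta --> (0 : R)^'+] --> (1 : R).
  exact: cvg_at_right_filter.
near (0 : R)^'+ => theta; exists theta.
  apply/andP; split; first by near: theta; exact: nbhs_right_gt.
  by near: theta; apply: nbhs_right_lt; exact: ltr01.
have : `|1 - ((1 - theta) `^ (1 - p)) ^+ 2| <= e.
  by near: theta; move/cvgrPdist_le : cvr; apply.
by rewrite ler_norml => /andP[]; lra.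
Unshelve. all: end_near. Qed.

Lemma Wvar_le p f t (M : R) : p != 0 -> dyadic_regular f -> 0 <= t <= 1 ->
  (forall n, jump_sum p f t n <= M) -> (Wvar p t f <= M%:E)%E.
Proof.
move=> p0 fr /andP[t0 t1] HM; rewrite Wvar_levels//.
apply: lime_le; first by apply: is_cvg_nneseries => k _ _; rewrite lee_fin level_jump_sum_ge0.
by apply: nearW => n; rewrite sumEFin -jump_sum_level// lee_fin.
Qed.

Lemma jump_sum_le_Wvar p f t n : p != 0 -> dyadic_regular f -> 0 <= t <= 1 ->
  ((jump_sum p f t n)%:E <= Wvar p t f)%E.
Proof.
move=> p0 fr /andP[t0 t1]; rewrite Wvar_levels// jump_sum_level// -sumEFin.
by apply: nneseries_lim_ge => k _; rewrite lee_fin level_jump_sum_ge0.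
Qed.

Lemma Wvar_ge0 p f t : (0 <= Wvar p t f)%E.
Proof. by apply: esum_ge0 => u _; rewrite lee_fin powR_ge0. Qed.

Lemma pvarE p f t l : 0 < t ->
  (power_sum p f s)%:E @[s --> mesh_to0 t] --> l ->
  pvar_exists p t f /\ pvar p t f = l.
Proof.
move=> t0 H; have F := mesh_to0_filter t0; split; last exact: cvg_lim.
by apply/cvg_ex; exists l.
Qed.

(** Large jump sums force large power sums on small meshes; the mesh filter is proper, so such
    decompositions exist and the supremum is infinite too. *)
Lemma Wvar_infinite p f t : 1 <= p -> dyadic_regular f -> 0 < t <= 1 ->
  Wvar p t f = +oo%E ->
  [/\ Vvar p t f = +oo%E, pvar_exists p t f & pvar p t f = +oo%E].
Proof.
move=> p1 fr t01 W; have /andP[t0 t1] := t01.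
have p0 : p != 0 by rewrite gt_eqF// (lt_le_trans _ p1).
have F := mesh_to0_filter t0.
have cv : (power_sum p f s)%:E @[s --> mesh_to0 t] --> +oo%E.
  apply/cvgeyPge => A.
  have [n Hn] : exists n, A + 1 < jump_sum p f t n.
    apply: contrapT => H; suff : (Wvar p t f <= (A + 1)%:E)%E by rewrite W.
    apply: Wvar_le => //; first by rewrite ltW.
    by move=> n; rewrite leNgt; apply/negP => ?; apply: H; exists n.
  have [d d0 Hd] := jump_sum_liminf n p1 fr t1 ltr01.
  exists d => // s [st sd] /=; rewrite lee_fin (le_trans _ (Hd s st sd))//.
  by rewrite lerBrDr ltW.
have [ex lim] := pvarE t0 cv; split=> //.
apply/eqyP => A A0; move/cvgeyPge : cv => /(_ A) H.
have [s [st /= sA]] : exists s, itv_partition 0 t s /\ (A%:E <= (power_sum p f s)%:E)%E.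
  have st : \forall s \near mesh_to0 t, itv_partition 0 t s.
    by exists 1; [exact: ltr01|move=> s []].
  have /filter_ex[s ?] : \forall s \near mesh_to0 t,
      itv_partition 0 t s /\ (A%:E <= (power_sum p f s)%:E)%E by exact: filterI.
  by exists s.
by apply: le_trans sA _; apply: ereal_sup_ubound; exists s.
Qed.

End limits.

Section variation_limit.
Context {R : realType}.
Variables (p q theta0 : R) (x : seq bool -> R) (f : R -> R) (B : nat -> R).
Hypotheses (p1 : 1 <= p) (q0 : 0 <= q) (th0 : 0 < theta0 < 1).
Hypothesis fr : dyadic_regular f.
Hypothesis ff : forall u, 0 <= u <= 1 -> partial q x 0 N u @[N --> \oo] --> f u.
Hypothesis HB : forall n N, (n <= N)%N ->
  \sum_(n <= k < N) tail_ratio theta0 q p ^+ k * level_sum p x k <= B n.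

Let C := tail_const theta0 p.

Lemma Wvar_total t : 0 < t <= 1 -> (Wvar p t f <= (C * B 0)%:E)%E.
Proof.
move=> t01; have /andP[t0 t1] := t01.
have p0 : p != 0 by rewrite gt_eqF// (lt_le_trans _ p1).
apply: Wvar_le => //; first by rewrite ltW.
move=> n; apply: jump_sum_le => //; exists 1 => // s st _.
exact: (power_sum_le_total p1 q0 th0 ff HB t1 st).
Qed.

Lemma Wvar_fin_num t : 0 < t <= 1 -> Wvar p t f \is a fin_num.
Proof.
move=> t01; rewrite ge0_fin_numE ?Wvar_ge0//.
exact: le_lt_trans (Wvar_total t01) (ltry _).
Qed.

(** With S the power sum and W the sum of jumps, [S <= K^2 W + rem] and [W <= K^2 S + rem]; the
    excess [K^2 - 1] is paid on the common bound [C * B 0] of S and W. *)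
Lemma power_sum_Wvar_dist theta t n s : 0 < theta < 1 -> 0 < t <= 1 ->
  itv_partition 0 t s -> mesh s < (2 ^+ n)^-1 ->
  `|power_sum p f s - fine (Wvar p t f)| <=
    (((1 - theta) `^ (1 - p)) ^+ 2 - 1) * (C * B 0) +
    ((1 - theta) `^ (1 - p) + 1) * (theta `^ (1 - p) * (C * B n)).
Proof.
move=> th t01 st ms; set K := (1 - theta) `^ (1 - p); have /andP[t0 t1] := t01.
have p0 : p != 0 by rewrite gt_eqF// (lt_le_trans _ p1).
have t01' : 0 <= t <= 1 by rewrite ltW.
have K1 : 1 <= K by exact: powR_onem_ge1.
have K21 : 0 <= K ^+ 2 - 1 by rewrite subr_ge0 exprn_ege1.
have WE := esym (fineK (Wvar_fin_num t01)).
set W := fine _ in WE *; set rem := (K + 1) * _.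
have W1 : W <= C * B 0 by rewrite -lee_fin -WE Wvar_total.
have S1 : power_sum p f s <= C * B 0 := power_sum_le_total p1 q0 th0 ff HB t1 st.
have A1 : power_sum p f s <= K ^+ 2 * W + rem.
  apply: le_trans (power_sum_le_jump_sum p1 q0 th0 fr ff HB th t01 st ms) _.
  rewrite lerD2r ler_wpM2l ?exprn_ge0 ?powR_ge0//.
  by rewrite -lee_fin -WE jump_sum_le_Wvar.
have A2 : W <= K ^+ 2 * power_sum p f s + rem.
  rewrite -lee_fin -WE; apply: Wvar_le => // m.
  exact: (jump_sum_le_power_sum p1 q0 th0 fr ff HB th t01 m st ms).
have M1 := ler_wpM2l K21 W1; have M2 := ler_wpM2l K21 S1.
rewrite ler_norml; apply/andP; split; lra.
Qed.

Lemma power_sum_cvg_Wvar t : 0 < t <= 1 -> B n @[n --> \oo] --> 0 ->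
  (power_sum p f s)%:E @[s --> mesh_to0 t] --> Wvar p t f.
Proof.
move=> t01 B0; have /andP[t0 t1] := t01; have F := mesh_to0_filter t0.
rewrite -(fineK (Wvar_fin_num t01)); apply/cvg_EFin; first exact: nearW.
apply/cvgrPdist_le => /= e e0.
have CB0 : 0 <= C * B 0.
  by rewrite -lee_fin (le_trans _ (Wvar_total t01))// Wvar_ge0.
(* This share fixes [theta], before [n] is chosen in terms of [theta]; the [+ 1] guards against
   [C * B 0 = 0]. *)
have e1 : 0 < e / 2 / (C * B 0 + 1) by rewrite !divr_gt0// ltr_wpDl.
have [theta th Hth] := exists_small_theta p e1.
pose K := (1 - theta) `^ (1 - p).
have cv : (K + 1) * (theta `^ (1 - p) * (C * B n)) @[n --> \oo] -->
    (K + 1) * (theta `^ (1 - p) * (C * 0)).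
  by do 3 (apply: cvgM; first exact: cvg_cst); exact: B0.
rewrite !mulr0 in cv.
have e2 : 0 < e / 2 by rewrite divr_gt0.
move/cvgrPdist_le : cv => /(_ _ e2)[n _ /(_ n (leqnn n))].
rewrite sub0r normrN => Hn.
exists (2 ^+ n)^-1 => [|s [st ms] /=]; first exact: pow2V_gt0.
rewrite distrC (le_trans (power_sum_Wvar_dist th t01 st ms))//.
rewrite [leRHS]splitr lerD//; last exact: le_trans (ler_norm _) Hn.
apply: (@le_trans _ _ (e / 2 / (C * B 0 + 1) * (C * B 0))).
  by rewrite ler_wpM2r.
by rewrite mulrAC ler_pdivrMr ?ltr_wpDl// mulrDr mulr1 lerDl ltW.
Qed.

End variation_limit.

(** * Gaussian laws *)

Section affine_change_of_variable.
Context {R : realType}.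
Local Notation mu := (@lebesgue_measure R).

Lemma measurable_affine (c a : R) :
  measurable_fun setT (fun y : measurableTypeR R => c + a * y : measurableTypeR R).
Proof. by apply: measurable_funD => //; exact: measurable_funM. Qed.

Lemma affine_preimage_itv (c a u v : R) : 0 < a ->
  (fun y => c + a * y) @^-1` `]u, v] = `](u - c) / a, (v - c) / a]%classic.
Proof.
move=> a0; apply/seteqP; split => y /=; rewrite !in_itv /=.
  by rewrite ltr_pdivrMr// ler_pdivlMr// ltrBlDl lerBrDl [y * a]mulrC.
by rewrite ltr_pdivrMr// ler_pdivlMr// ltrBlDl lerBrDl [y * a]mulrC.
Qed.

(** The image measure under [y |-> c + a * y], multiplied by [a], has the right mass on half-open
    intervals; uniqueness of Lebesgue measure does the rest. *)
Lemma lebesgue_measure_affine (c a : R) (a0 : 0 < a) :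
  exists2 m : {measure set (measurableTypeR R) -> \bar R},
    forall A, measurable A -> mu A = m A &
    forall f, measurable_fun [set: R] f -> (forall y, (0 <= f y)%E) ->
      (\int[m]_x f x = a%:E * \int[mu]_y f (c + a * y)%R)%E.
Proof.
pose ph : R -> measurableTypeR R := fun y => c + a * y.
have mph := measurable_affine c a.
unshelve epose (m := (mscale (NngNum (ltW a0)) (pushforward mu ph)
  : {measure set (measurableTypeR R) -> \bar R})).
  exact: mph.
exists m => [A mA|f mf f0].
  apply: lebesgue_measure_unique => //= _ [[u v] _ <-].
  rewrite /m /mscale /= /pushforward /ph affine_preimage_itv// !lebesgue_measure_itv /=.
  rewrite !lte_fin ltr_pM2r ?invr_gt0// ltrD2r.
  case: ifPn => _; last by rewrite mule0.
  rewrite -!EFinB -EFinM; congr (_%:E); field; exact: lt0r_neq0.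
rewrite /m ge0_integral_mscale//=.
by rewrite ge0_integral_pushforward.
Qed.

Lemma ge0_integral_affine (c a : R) (f : R -> \bar R) : 0 < a ->
  measurable_fun [set: R] f -> (forall y, (0 <= f y)%E) ->
  (\int[mu]_x f x = a%:E * \int[mu]_y f (c + a * y)%R)%E.
Proof.
move=> a0 mf f0; have [m mE <-//] := lebesgue_measure_affine c a0.
by apply: eq_measure_integral => A mA _; exact: mE.
Qed.

Lemma ge0_integral_opp (f : R -> \bar R) :
  measurable_fun [set: R] f -> (forall y, (0 <= f y)%E) ->
  (\int[mu]_x f x = \int[mu]_y f (- y)%R)%E.
Proof.
move=> mf f0.
transitivity (\int[pushforward mu (-%R : _ -> measurableTypeR R)]_x f x)%E.
  by apply: eq_measure_integral => A mA _; symmetry; exact: lebesgue_measureN.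
by rewrite ge0_integral_pushforward.
Qed.

End affine_change_of_variable.

Section gaussian.
Context {R : realType}.
Local Notation mu := (@lebesgue_measure R).
Implicit Types (m s a c : R).

(** The density agrees almost everywhere with the Radon-Nikodym derivative, since both have the same
    integrals over measurable sets. *)
Lemma integral_normal_prob m s (f : R -> \bar R) :
  measurable_fun [set: R] f -> (forall y, (0 <= f y)%E) ->
  (\int[normal_prob m s]_x f x = \int[mu]_x (f x * (normal_pdf m s x)%:E))%E.
Proof.
move=> mf f0.
have dom := normal_prob_dominates m s.
rewrite -(Radon_Nikodym_SigmaFinite.change_of_variables dom)//.
have mRN : measurable_fun setT
    (Radon_Nikodym_SigmaFinite.f (normal_prob m s) (@lebesgue_measure R)).
  exact: measurable_int (Radon_Nikodym_SigmaFinite.f_integrable dom).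
have mpdf : measurable_fun setT (fun x => (normal_pdf m s x)%:E).
  by apply/measurable_EFinP; exact: measurable_normal_pdf.
apply: ge0_ae_eq_integral => //.
- exact: emeasurable_funM.
- exact: emeasurable_funM.
- by move=> x _; rewrite mule_ge0// Radon_Nikodym_SigmaFinite.f_ge0.
- by move=> x _; rewrite mule_ge0// lee_fin normal_pdf_ge0.
apply: ae_eqe_mul2l; apply: integral_ae_eq => //.
- exact: Radon_Nikodym_SigmaFinite.f_integrable.
- by move=> E _ mE; rewrite -Radon_Nikodym_SigmaFinite.f_integral.
Qed.

Lemma normal_pdf_affine m a y : 0 < a ->
  a * normal_pdf m a (m + a * y) = normal_pdf 0 1 y.
Proof.
move=> a0; have an0 : a != 0 by rewrite gt_eqF.
rewrite !normal_pdfE ?oner_eq0// /normal_peak /normal_fun.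
have -> : - (m + a * y - m) ^+ 2 / (a ^+ 2 *+ 2) = - (y - 0) ^+ 2 / (1 ^+ 2 *+ 2) :> R.
  by field; rewrite an0.
rewrite mulrA; congr (_ * _).
rewrite expr1n mul1r -mulrnAr sqrtrM ?sqr_ge0// sqrtr_sqr gtr0_norm//.
by rewrite invfM mulrA divff ?mul1r.
Qed.

Lemma normal_pdfN m s : s != 0 -> normal_pdf m (- s) = normal_pdf m s.
Proof.
move=> s0; rewrite !normal_pdfE ?oppr_eq0//; apply/funext => x.
by rewrite /normal_peak /normal_fun sqrrN.
Qed.

Lemma normal_pdf01N y : normal_pdf 0 1 (- y) = normal_pdf 0 1 y :> R.
Proof. by rewrite !normal_pdfE ?oner_eq0// /normal_fun !subr0 sqrrN. Qed.

Lemma measurable_normal_pdf_EFin m s :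
  measurable_fun setT (fun x : R => (normal_pdf m s x)%:E).
Proof. by apply/measurable_EFinP; exact: measurable_normal_pdf. Qed.

Lemma normal_prob_indic m s (A : set R) :
  normal_prob m s A = (\int[mu]_x ((\1_A x)%:E * (normal_pdf m s x)%:E))%E.
Proof.
rewrite /normal_prob integral_mkcond; apply: eq_integral => x _.
by rewrite epatch_indic muleC.
Qed.

Lemma normal_prob_affine m a A : a != 0 -> measurable A ->
  normal_prob m a A = normal_prob 0 1 ((fun y => m + a * y) @^-1` A).
Proof.
move=> an0 mA.
have mind (B : set R) : measurable B ->
    measurable_fun setT (fun x : R => (\1_B x)%:E : \bar R).
  by move=> mB'; apply/measurable_EFinP; exact: measurable_indic.
have g0 m' s (B : set R) y : (0 <= (\1_B y)%:E * (normal_pdf m' s y)%:E :> \bar R)%E.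
  by rewrite mule_ge0// lee_fin ?normal_pdf_ge0.
have mg m' s (B : set R) : measurable B ->
    measurable_fun setT (fun y => (\1_B y)%:E * (normal_pdf m' s y)%:E : \bar R)%E.
  by move=> mB; apply: emeasurable_funM; [exact: mind|exact: measurable_normal_pdf_EFin].
have mB b : measurable ((fun y : R => m + b * y) @^-1` A).
  by rewrite -[X in measurable X]setTI; exact: measurable_affine.
have pos b : 0 < b -> normal_prob m b A = normal_prob 0 1 ((fun y => m + b * y) @^-1` A).
  move=> b0; rewrite !normal_prob_indic (ge0_integral_affine m b0)//; last exact: mg.
  rewrite -ge0_integralZl//; last 2 first.
  - exact: (measurableT_comp (mg _ _ _ mA) (measurable_affine m b)).
  - by rewrite lee_fin ltW.
  apply: eq_integral => y _; rewrite muleCA -EFinM normal_pdf_affine//.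
(* Negative slopes do occur, for the coefficient [- 2 q^k] of a jump; the symmetry of the density
   reduces them to positive ones. *)
have [a0|a0|E] := ltrgt0P a; [exact: pos| |by rewrite E eqxx in an0].
have na0 : 0 < - a by rewrite oppr_gt0.
transitivity (normal_prob m (- a) A).
  by apply: eq_integral => x _; rewrite normal_pdfN.
rewrite (pos _ na0) !normal_prob_indic ge0_integral_opp//; last exact: mg.
apply: eq_integral => y _; rewrite normal_pdf01N !indicE; congr (_%:R%:E * _)%E.
by congr nat_of_bool; apply/idP/idP; rewrite !inE /preimage /= mulrNN.
Qed.

(* Completing the square: the product of the densities of N(0, s) at x and of
   N(x, a) at z is the density of N(0, sqrt (s^2 + a^2)) at z times a normal
   density in x. *)
Lemma normal_pdf_convolution s a x z : s != 0 -> a != 0 ->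
  let sg := Num.sqrt (s ^+ 2 + a ^+ 2) in
  normal_pdf 0 s x * normal_pdf x a z =
  normal_pdf 0 sg z * normal_pdf (z * s ^+ 2 / sg ^+ 2) (s * a / sg) x.
Proof.
move=> s0 a0 sg.
have s2 : 0 < s ^+ 2 by rewrite exprn_even_gt0.
have a2 : 0 < a ^+ 2 by rewrite exprn_even_gt0.
have sa2 : 0 < s ^+ 2 + a ^+ 2 by rewrite addr_gt0.
have sg0 : 0 < sg by rewrite sqrtr_gt0.
have sgE : sg ^+ 2 = s ^+ 2 + a ^+ 2 by rewrite sqr_sqrtr// ltW.
have sgn0 : sg != 0 by rewrite gt_eqF.
have tn0 : s * a / sg != 0 by rewrite !mulf_neq0// invr_eq0.
rewrite !normal_pdfE// /normal_peak /normal_fun !subr0.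
rewrite mulrACA -expRD [RHS]mulrACA -expRD; congr (_ * _).
  rewrite -!invfM; congr (_^-1); rewrite -!sqrtrM; last 2 first.
  - by rewrite mulrn_wge0// mulr_ge0 ?sqr_ge0 ?pi_ge0.
  - by rewrite mulrn_wge0// mulr_ge0 ?sqr_ge0 ?pi_ge0.
  congr Num.sqrt; rewrite !exprMn exprVn; field.
  by rewrite sgn0.
congr expR; rewrite !exprMn exprVn sgE; field.
by rewrite s0 a0 !gt_eqF.
Qed.

(** By Tonelli [x] is integrated first; after completing the square this leaves a normal density in
    [x], of total mass 1. *)
Lemma normal_prob_convolution s a A : s != 0 -> a != 0 -> measurable A ->
  (\int[normal_prob 0 s]_x normal_prob x a A)%E =
  normal_prob 0 (Num.sqrt (s ^+ 2 + a ^+ 2)) A.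
Proof.
move=> s0 a0 mA; set sg := Num.sqrt _.
pose g (w : measurableTypeR R * measurableTypeR R) : \bar R :=
  ((\1_A w.2)%:E * (normal_pdf 0 s w.1 * normal_pdf w.1 a w.2)%:E)%E.
pose h (w : measurableTypeR R * measurableTypeR R) : \bar R := ((\1_A w.2)%:E * (normal_pdf w.1 a w.2)%:E)%E.
have mind : measurable_fun setT (fun w : measurableTypeR R * measurableTypeR R => (\1_A w.2)%:E : \bar R).
  by apply/measurable_EFinP; apply: (measurableT_comp (measurable_indic mA)).
have mpdf : measurable_fun setT (fun w : measurableTypeR R * measurableTypeR R => normal_pdf w.1 a w.2).
  rewrite (_ : (fun w => _) = fun w : measurableTypeR R * measurableTypeR R =>
      normal_peak a * expR (- (w.2 - w.1) ^+ 2 / (a ^+ 2 *+ 2))); last first.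
    by apply/funext => w; rewrite normal_pdfE.
  apply: measurable_funM => //; apply: measurableT_comp => //=.
  apply: measurable_funM => //=; apply: measurableT_comp => //=.
  by apply: measurable_funX => //=; apply: measurable_funB.
have mh : measurable_fun setT h.
  by apply: emeasurable_funM => //; exact/measurable_EFinP.
have h0 w : (0 <= h w)%E by rewrite mule_ge0// lee_fin normal_pdf_ge0.
have mg : measurable_fun setT g.
  apply: emeasurable_funM => //; apply/measurable_EFinP; apply: measurable_funM => //.
  by apply: (measurableT_comp (measurable_normal_pdf 0 s)).
have g0 w : (0 <= g w)%E.
  by rewrite mule_ge0// lee_fin// mulr_ge0// normal_pdf_ge0.
have FE x : ((normal_prob x a A) * (normal_pdf 0 s x)%:E = \int[mu]_z g (x, z))%E.
  rewrite normal_prob_indic -ge0_integralZr//; last 3 first.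
  - apply: emeasurable_funM; last exact: measurable_normal_pdf_EFin.
    by apply/measurable_EFinP; exact: measurable_indic.
  - by move=> z _; rewrite mule_ge0// lee_fin// normal_pdf_ge0.
  - by rewrite lee_fin normal_pdf_ge0.
  by apply: eq_integral => z _; rewrite /g /= EFinM -muleA [X in (_ * X)%E]muleC.
rewrite integral_normal_prob; last 2 first.
- rewrite (_ : (fun x => _) = fun x => \int[mu]_z h (x, z))%E; last first.
    by apply/funext => x; rewrite normal_prob_indic.
  exact: measurable_fun_fubini_tonelli_F.
- by move=> x; exact: measure_ge0.
transitivity (\int[mu]_x \int[mu]_z g (x, z))%E.
  by apply: eq_integral => x _; exact: FE.
rewrite (fubini_tonelli _ mg g0) normal_prob_indic; apply: eq_integral => z _.
transitivity (\int[mu]_x ((\1_A z)%:E * (normal_pdf 0 sg z)%:E *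
    (normal_pdf (z * s ^+ 2 / sg ^+ 2) (s * a / sg) x)%:E))%E.
  apply: eq_integral => x _; rewrite /g /= -muleA; congr (_ * _)%E.
  by rewrite -EFinM normal_pdf_convolution.
rewrite ge0_integralZl//; last 3 first.
- exact: measurable_normal_pdf_EFin.
- by move=> x _; rewrite lee_fin normal_pdf_ge0.
- by rewrite mule_ge0// lee_fin normal_pdf_ge0.
by rewrite integral_normal_pdf mule1.
Qed.

Lemma ge0_integral_normal_scale s (f : R -> \bar R) : s != 0 ->
  measurable_fun [set: R] f -> (forall y, (0 <= f y)%E) ->
  (\int[normal_prob 0 s]_x f x = \int[normal_prob 0 1]_x f (s * x)%R)%E.
Proof.
move=> s0 mf f0; pose ph (y : measurableTypeR R) : measurableTypeR R := 0 + s * y.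
have mph : measurable_fun setT ph by exact: measurable_affine.
transitivity (\int[pushforward (normal_prob 0 1) ph]_x f x)%E.
  by apply: eq_measure_integral => A mA _; exact: (normal_prob_affine 0 s0 mA).
rewrite ge0_integral_pushforward//.
by apply: eq_integral => x _; rewrite /= /ph add0r.
Qed.

Definition gaussian_moment (p : R) : \bar R :=
  (\int[normal_prob 0 1]_x (`|x| `^ p)%:E)%E.

Lemma measurable_powR_norm (p : R) : measurable_fun setT (fun x : R => `|x| `^ p).
Proof.
by apply: (@measurableT_comp _ _ _ _ _ _ (@powR R ^~ p)).
Qed.

Lemma gaussian_moment_scale s (p : R) : s != 0 ->
  (\int[normal_prob 0 s]_x (`|x| `^ p)%:E = (`|s| `^ p)%:E * gaussian_moment p)%E.
Proof.
move=> s0; have mp : measurable_fun setT (fun x : R => (`|x| `^ p)%:E).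
  by apply/measurable_EFinP; exact: measurable_powR_norm.
rewrite ge0_integral_normal_scale//.
rewrite /gaussian_moment -ge0_integralZl//.
by apply: eq_integral => x _; rewrite normrM powRM// EFinM.
Qed.

(* Comparison with the density of variance 2, through x^p <= C e^(x^2/4). *)
Lemma gaussian_moment_fin (p : R) : 0 < p -> (gaussian_moment p < +oo)%E.
Proof.
move=> p0; have mp : measurable_fun setT (fun x : R => (`|x| `^ p)%:E).
  by apply/measurable_EFinP; exact: measurable_powR_norm.
have r2 : Num.sqrt 2 != 0 :> R by rewrite gt_eqF// sqrtr_gt0.
pose C : R := expR (p ^+ 2) * normal_peak 1 / normal_peak (Num.sqrt 2).
have C0 : 0 <= C by rewrite !mulr_ge0 ?expR_ge0 ?invr_ge0 ?normal_peak_ge0.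
rewrite /gaussian_moment integral_normal_prob//.
apply: (@le_lt_trans _ _ (\int[mu]_x (C%:E * (normal_pdf 0 (Num.sqrt 2) x)%:E))%E).
  apply: ge0_le_integral => //.
  - by move=> x _; rewrite mule_ge0// lee_fin ?powR_ge0 ?normal_pdf_ge0.
  - by apply: emeasurable_funM => //; exact: measurable_normal_pdf_EFin.
  - by apply: emeasurable_funM => //; exact: measurable_normal_pdf_EFin.
  move=> x _; rewrite -!EFinM lee_fin !normal_pdfE ?oner_eq0//.
  have key : `|x| `^ p * normal_fun 0 1 x <= expR (p ^+ 2) * normal_fun 0 (Num.sqrt 2) x.
    apply: (@le_trans _ _ (expR (p * `|x|) * normal_fun 0 1 x)).
      rewrite ler_wpM2r ?normal_fun_ge0// mulrC expRM.
      apply: ge0_ler_powR; rewrite ?nnegrE ?expR_ge0// ?(ltW p0)//.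
      by rewrite (le_trans _ (expR_ge1Dx _))// lerDr.
    rewrite /normal_fun -!expRD ler_expR sqr_sqrtr// !subr0 expr1n.
    rewrite -[x ^+ 2]real_normK ?num_real//.
    move: `|x| => y; rewrite -[1 *+ 2]/(2 : R) !mulNr.
    have -> : 2 *+ 2 = 4 :> R by ring.
    (* The constant [p ^+ 2] comes from this square. *)
    have E : (p - y / 2) ^+ 2 = p ^+ 2 - p * y + y ^+ 2 / 4 by field.
    by have := sqr_ge0 (p - y / 2); rewrite E; lra.
  have n2 : normal_peak (Num.sqrt 2) != 0 :> R by rewrite gt_eqF ?normal_peak_gt0.
  have -> : C * (normal_peak (Num.sqrt 2) * normal_fun 0 (Num.sqrt 2) x) =
    normal_peak 1 * (expR (p ^+ 2) * normal_fun 0 (Num.sqrt 2) x).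
    by rewrite /C; field.
  by rewrite mulrCA ler_wpM2l ?normal_peak_ge0.
rewrite ge0_integralZl//.
- by rewrite integral_normal_pdf mule1 ltry.
- exact: measurable_normal_pdf_EFin.
- by move=> x _; rewrite lee_fin normal_pdf_ge0.
Qed.

(** The density is at most its peak [1 / (s sqrt(2 pi))], hence at most [1 / s], on an interval of
    length [2 c]. *)
Lemma normal_prob_small_ball s c : 0 < c -> 0 < s ->
  (normal_prob 0 s `[(- c)%R, c]%classic <= (2 * c / s)%R%:E)%E.
Proof.
move=> c0 s0; have sn : s != 0 by rewrite gt_eqF.
rewrite /normal_prob.
apply: (@le_trans _ _ (\int[mu]_(x in `[(- c)%R, c]%classic) (cst (s^-1)%:E) x)%E).
  apply: ge0_le_integral => //=.
  - by move=> x _; rewrite lee_fin normal_pdf_ge0.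
  - by apply: measurable_funTS; exact: measurable_normal_pdf_EFin.
  move=> x _; rewrite lee_fin (le_trans (normal_pdf_ub _ _ sn))//.
  rewrite /normal_peak lef_pV2 ?posrE// ?sqrtr_gt0; last first.
    by rewrite mulrn_wgt0// mulr_gt0 ?pi_gt0// exprn_gt0.
  rewrite -[leLHS](gtr0_norm s0) -sqrtr_sqr ler_wsqrtr// -mulrnAr ler_peMr ?exprn_ge0 ?ltW//.
  by have := pi_ge2 R; rewrite mulr2n; lra.
rewrite integral_cst//= lebesgue_measure_itv/= lte_fin.
rewrite gtrN//= -EFinB -EFinM lee_fin opprK.
by rewrite le_eqVlt; apply/orP; left; apply/eqP; ring.
Qed.

End gaussian.

Lemma normal_prob_norm (R : realType) (m s : R) A : s != 0 ->
  normal_prob m `|s| A = normal_prob m s A.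
Proof.
move=> s0; apply: eq_integral => x _; case: (ger0P s) => // _.
by rewrite normal_pdfN.
Qed.

Section independent_normals.
Context d (T : measurableType d) (R : realType) (P : probability T R).
Context (I : choiceType) (xi : I -> {RV P >-> R}).
Hypothesis xi_normal : forall i, standard_normal (xi i).
Hypothesis xi_indep : mutually_independent xi.
Implicit Types (J K : seq I) (A : I -> set R) (a : I -> R).

Definition joint_event K A : set T := \bigcap_(i in [set` K]) (xi i @^-1` A i).

Lemma measurable_preimage_RV i (B : set R) : measurable B -> measurable (xi i @^-1` B).
Proof. by move=> mB; exact: measurable_funPTI. Qed.

Lemma measurable_joint_event K A : (forall i, measurable (A i)) ->
  measurable (joint_event K A).
Proof.
move=> mA; apply: fin_bigcap_measurable; first exact: finite_seq.
by move=> i _; exact: measurable_preimage_RV.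
Qed.

Lemma joint_event_cons i K A (B : set R) : i \notin K ->
  joint_event (i :: K) (fun j => if j == i then B else A j) =
  xi i @^-1` B `&` joint_event K A.
Proof.
move=> iK; rewrite /joint_event; apply/seteqP; split => w /=.
  move=> H; split; first by have := H i (mem_head _ _); rewrite eqxx.
  move=> j jK; have := H j; rewrite /= inE jK orbT => /(_ isT).
  by case: eqP => // ji; rewrite -ji jK in iK.
move=> [iB H] j /=; rewrite inE => /predU1P[->|jK]; first by rewrite eqxx.
by case: eqP => [->//|_]; exact: H.
Qed.

Lemma prob_joint_event_cons i K A (B : set R) : i \notin K -> uniq K ->
  (forall j, measurable (A j)) -> measurable B ->
  P (xi i @^-1` B `&` joint_event K A) = (normal_prob 0 1 B * P (joint_event K A))%E.
Proof.
move=> iK uK mA mB; rewrite -joint_event_cons//.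
rewrite /joint_event xi_indep//; last 2 first.
- by rewrite /= iK.
- by move=> j; case: ifP.
rewrite xi_indep// big_cons eqxx; congr (_ * _)%E; first exact: xi_normal.
rewrite !big_seq; apply: eq_bigr => j jK.
by case: eqP => // ji; rewrite -ji jK in iK.
Qed.

Definition linear_comb a J (w : T) : R := \sum_(i <- J) a i * xi i w.

Lemma measurable_linear_comb a J : measurable_fun setT (linear_comb a J).
Proof.
by apply: measurable_sum => i; apply: measurable_funM.
Qed.

Lemma sum_sqr_gt0 a i J : (forall j, a j != 0) -> 0 < \sum_(j <- i :: J) a j ^+ 2.
Proof.
move=> a0; rewrite big_cons ltr_pwDl ?exprn_even_gt0//=.
by apply: sumr_ge0 => j _; exact: sqr_ge0.
Qed.

(** The event on the other variables makes the induction work. To add [xi i] to a shorter sum, their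
    joint law must be a product; this is tested on rectangles, where the condition on [xi i] is
    moved into the event. *)
Lemma linear_comb_normal a i J K A (B : set R) : (forall j, a j != 0) ->
  uniq ((i :: J) ++ K) -> (forall j, measurable (A j)) -> measurable B ->
  P (linear_comb a (i :: J) @^-1` B `&` joint_event K A) =
  (normal_prob 0 (Num.sqrt (\sum_(j <- i :: J) a j ^+ 2)) B * P (joint_event K A))%E.
Proof.
move=> a0; elim: J i K A B => [|k J IH] i K A B uJK mA mB.
  have mB' : measurable ((fun y => 0 + a i * y) @^-1` B).
    by rewrite -[X in measurable X]setTI; exact: measurable_affine.
  rewrite big_seq1 sqrtr_sqr normal_prob_norm// normal_prob_affine//.
  case/andP: uJK => iK uK; rewrite -(prob_joint_event_cons iK uK mA mB').
  congr (P (_ `&` _)); apply/seteqP; split => w; rewrite /preimage /= /linear_comb big_seq1 add0r//.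
have mC := measurable_joint_event K mA; set C := joint_event K A in mC *.
set s := Num.sqrt (\sum_(j <- k :: J) a j ^+ 2).
have s0 : s != 0 by rewrite gt_eqF// sqrtr_gt0 sum_sqr_gt0.
have uKJ : uniq ((k :: J) ++ i :: K) by rewrite -[i :: K]cat1s uniq_catCA.
have [iK uK] : i \notin K /\ uniq K.
  by move: uKJ; rewrite cat_uniq => /and3P[_ _ /andP[]].
pose pr w : measurableTypeR R * measurableTypeR R :=
  (linear_comb a (k :: J) w, xi i w).
have mpair : measurable_fun setT pr.
  apply: measurable_fun_pair; first exact: (measurable_linear_comb a (k :: J)).
  exact: (measurable_funP (xi i)).
(* The joint law of the shorter sum and [xi i] on the event [C]. It is shown equal to [P C] times a
   product of normal laws, on the rectangles, which are stable under intersection and generate. *)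
unshelve epose (m2 := (pushforward (mrestr P mC) pr
   : {measure set (measurableTypeR R * measurableTypeR R) -> \bar R})).
  exact: mpair.
have c0 : (0 <= fine (P C)) by rewrite fine_ge0.
pose m1 : {measure set (measurableTypeR R * measurableTypeR R) -> \bar R} :=
  mscale (NngNum c0) (normal_prob 0 s \x normal_prob 0 1)%E.
have mCE : ((fine (P C))%:E = P C)%E by rewrite fineK ?fin_num_measure.
have m1X (A1 A2 : set (measurableTypeR R)) : measurable A1 -> measurable A2 ->
    m1 (A1 `*` A2) = ((fine (P C))%:E * (normal_prob 0 s A1 * normal_prob 0 1 A2))%E.
  by move=> mA1 mA2; congr (_ * _)%E; exact: product_measure1E.
pose G : set (set (measurableTypeR R * measurableTypeR R)) :=
  [set X | exists A1 : set (measurableTypeR R), measurable A1 /\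
      exists A2 : set (measurableTypeR R), measurable A2 /\ X = A1 `*` A2].
have m12 : forall D, measurable D -> m1 D = m2 D.
  apply: (measure_unique G (fun=> setT)).
  - rewrite measurable_prod_measurableType; congr (<<s _ >>).
    apply/seteqP; split => [X [A1 mA1 [A2 mA2 <-]]|X [A1 [mA1 [A2 [mA2 ->]]]]].
      by exists A1; split=> //; exists A2.
    by exists A1 => //; exists A2.
  - move=> _ _ [A1 [mA1 [A2 [mA2 ->]]]] [B1 [mB1 [B2 [mB2 ->]]]].
    exists (A1 `&` B1); split; first exact: measurableI.
    exists (A2 `&` B2); split; first exact: measurableI.
    by rewrite setXI.
  - by move=> _; exists setT; split=> //; exists setT; split=> //; rewrite setXTT.
  - by rewrite bigcup_const.
  - move=> _ [A1 [mA1 [A2 [mA2 ->]]]].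
    rewrite m1X// /m2 /= /pushforward /mrestr mCE.
    rewrite (_ : _ @^-1` _ `&` C = linear_comb a (k :: J) @^-1` A1 `&`
       (xi i @^-1` A2 `&` C)); last by rewrite setIA; congr (_ `&` _); apply/seteqP; split.
    rewrite -joint_event_cons// IH//; last by move=> j; case: ifP.
    rewrite joint_event_cons// prob_joint_event_cons// -/s.
    by rewrite [in RHS]muleA [RHS]muleC.
  - by move=> _; rewrite -setXTT m1X// !probability_setT !mule1 ltry.
have mf : measurable_fun setT (fun w : measurableTypeR R * measurableTypeR R => w.1 + a i * w.2).
  by apply: measurable_funD => //; exact: measurable_funM.
pose D : set (measurableTypeR R * measurableTypeR R) :=
  (fun w => w.1 + a i * w.2) @^-1` B.
have mD : measurable D by rewrite -[X in measurable X]setTI; exact: mf.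
transitivity (m2 D).
  rewrite /m2 /= /pushforward /mrestr; congr (P (_ `&` _)).
  have E w : linear_comb a [:: i, k & J] w = linear_comb a (k :: J) w + a i * xi i w.
    by rewrite /linear_comb big_cons addrC.
  by apply/seteqP; split => w; rewrite /preimage /= E.
transitivity ((fine (P C))%:E * (normal_prob 0 s \x normal_prob 0 1) D)%E.
  by rewrite -(m12 D mD) /m1.
rewrite mCE [RHS]muleC; congr (_ * _)%E.
rewrite (_ : \sum_(j <- i :: k :: J) a j ^+ 2 = s ^+ 2 + a i ^+ 2); last first.
  by rewrite big_cons sqr_sqrtr 1?addrC// ltW// sum_sqr_gt0.
rewrite -(normal_prob_convolution s0 (a0 i) mB).
rewrite /product_measure1; apply: eq_integral => x _.
rewrite [RHS](normal_prob_affine x (a0 i) mB) /=; congr (normal_prob 0 1 _).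
by apply/seteqP; split => y; rewrite /xsection /= inE.
Qed.

Lemma linear_comb_law a i J (B : set R) : (forall j, a j != 0) ->
  uniq (i :: J) -> measurable B ->
  P (linear_comb a (i :: J) @^-1` B) =
  normal_prob 0 (Num.sqrt (\sum_(j <- i :: J) a j ^+ 2)) B.
Proof.
move=> a0 uJ mB.
have := @linear_comb_normal a i J [::] (fun=> setT) B a0.
rewrite cats0 => /(_ uJ (fun=> measurableT) mB).
rewrite (_ : joint_event [::] _ = setT) ?setIT ?probability_setT ?mule1//.
by apply/seteqP; split.
Qed.

Lemma linear_comb_moment a i J (p : R) : (forall j, a j != 0) -> uniq (i :: J) ->
  (\int[P]_w (`|linear_comb a (i :: J) w| `^ p)%:E =
   ((Num.sqrt (\sum_(j <- i :: J) a j ^+ 2)) `^ p)%:E * gaussian_moment p)%E.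
Proof.
move=> a0 uJ; set s := Num.sqrt _.
have s0 : 0 < s by rewrite sqrtr_gt0 sum_sqr_gt0.
rewrite -[X in (X `^ p)%:E]gtr0_norm// -gaussian_moment_scale ?gt_eqF//.
pose S : T -> measurableTypeR R := linear_comb a (i :: J).
have mS : measurable_fun setT S by exact: measurable_linear_comb.
transitivity (\int[pushforward P S]_x (`|x| `^ p)%:E)%E.
  rewrite ge0_integral_pushforward//.
  by apply/measurable_EFinP; exact: measurable_powR_norm.
by apply: eq_measure_integral => B mB _; exact: linear_comb_law.
Qed.

End independent_normals.

Local Arguments word : simpl never.

(** * The jumps as Gaussian combinations *)

Section jump_expansion.
Context {R : realType}.
Implicit Types (p q t e : R) (x : seq bool -> R) (f g : R -> R) (k i m j : nat) (v : seq bool).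

Lemma jump_norm_le g n j e : dyadic_regular g -> (j.+1 < 2 ^ n)%N ->
  (forall u, 0 <= u <= 1 -> `|g u| <= e) -> `|jump g (j.+1%:R / 2 ^+ n)| <= e + e.
Proof.
move=> gr jn ge; have cv := dyadic_regular_left_cvg gr jn.
have := dyadic_point_itv (R := R) jn; set w : R := _ / _ in cv * => /andP[w0 w1].
rewrite /jump (le_trans (ler_normB _ _))// lerD//; first by rewrite ge// !ltW.
have cvn : `|g u| @[u --> w^'-] --> `|lim (g u @[u --> w^'-])| by exact: cvg_norm.
rewrite -(cvg_lim _ cvn)//; apply: limr_le; first by apply/cvg_ex; eexists; exact: cvn.
near=> z; apply: ge.
suff [] : 0 <= z <= 1 /\ idx n z = j by [].
by near: z; exact: near_left_idx.
Unshelve. all: end_near. Qed.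

Lemma odd_dyadicE k i : odd_dyadic k i = i.*2.+1%:R / 2 ^+ k.+1 :> R.
Proof. by []. Qed.

Lemma odd_dyadic_lt k i : (i < 2 ^ k)%N -> (i.*2.+1 < 2 ^ k.+1)%N.
Proof. by rewrite expnS; lia. Qed.

Lemma jump_powR_le_jump_sum p f k i : (i < 2 ^ k)%N ->
  `|jump f (odd_dyadic k i)| `^ p <= jump_sum p f 1 k.+1.
Proof.
move=> ik; rewrite /jump_sum big_mkord.
have i1 : (i.*2 < idx k.+1 (1 : R))%N.
  rewrite /idx mulr1 -pow2E natrK; have := odd_dyadic_lt ik; lia.
by rewrite (bigD1 (Ordinal i1))//= lerDl sumr_ge0// => j _; exact: powR_ge0.
Qed.

(* The words whose coefficients enter the jump at odd_dyadic k i of the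
   approximation of level k.+1 + m: the word v whose cylinder has this
   midpoint, and v10..0 and v01..1. *)
Fixpoint jump_words k i m : seq (seq bool) :=
  if m is j.+1 then
    [:: word (k.+1 + j) (i.*2.+1 * 2 ^ j),
        word (k.+1 + j) (i.*2.+1 * 2 ^ j).-1 & jump_words k i j]
  else [:: word k i].

(** Layer [k] passes from [+N_v] to [-N_v] at the midpoint, a change of factor -2. A finer layer has
    sign + just right of the point and - just left of it, so both of its words enter with a positive
    coefficient. *)
Definition jump_coef q k (v : seq bool) : R :=
  if size v == k then - (q ^+ k *+ 2) else q ^+ size v.

Lemma jump_coef_neq0 q k v : 0 < q -> jump_coef q k v != 0.
Proof.
move=> q0; rewrite /jump_coef; case: ifP => _; last by rewrite gt_eqF// exprn_gt0.
by rewrite lt_eqF// oppr_lt0 mulrn_wgt0// exprn_gt0.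
Qed.

Lemma size_jump_words k i m v : v \in jump_words k i m -> (k <= size v < k.+1 + m)%N.
Proof.
elim: m => [|j IH] /=; first by rewrite inE => /eqP ->; rewrite size_word; lia.
rewrite !inE => /or3P[/eqP ->|/eqP ->|/IH]; rewrite ?size_word; lia.
Qed.

Lemma jump_words_uniq k i m : (i < 2 ^ k)%N -> uniq (jump_words k i m).
Proof.
move=> ik; elim: m => //= j IH; rewrite IH andbT.
have notin l : word (k.+1 + j) l \notin jump_words k i j.
  by apply/negP => /size_jump_words; rewrite size_word ltnn andbF.
rewrite inE negb_or !notin !andbT /=.
have j0 := expn_gt0 2 j; have ub := odd_dyadic_lt ik.
apply/eqP => /word_inj E.
have H : (i.*2.+1 * 2 ^ j < 2 ^ (k.+1 + j))%N by rewrite expnD ltn_pmul2r.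
have := E H; have : ((i.*2.+1 * 2 ^ j).-1 < 2 ^ (k.+1 + j))%N by lia.
have X0 : (0 < i.*2.+1 * 2 ^ j)%N by rewrite muln_gt0.
by move=> H2 /(_ H2); move: X0; set X := (_ * _)%N; lia.
Qed.

Lemma jump_words_cons k i m : exists v J, jump_words k i m = v :: J.
Proof. by case: m => [|j]; do 2 eexists. Qed.

(** The 4 is the square of the factor -2 of the central word; the 2 counts the two words of each
    finer layer. *)
Lemma sum_sqr_jump_coef q k i m :
  \sum_(v <- jump_words k i m) jump_coef q k v ^+ 2 =
  (q ^+ 2) ^+ k * (4 + 2 * \sum_(0 <= j < m) (q ^+ 2) ^+ j.+1).
Proof.
elim: m => [|j IH].
  rewrite big_seq1 /jump_coef size_word eqxx big_geq// mulr0 addr0 -exprM mulnC exprM.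
  ring.
rewrite [in RHS]big_nat_recr//= !big_cons IH /jump_coef !size_word.
have -> : (k.+1 + j == k)%N = false by apply/eqP; lia.
rewrite addSnnS exprD exprMn -!exprM.
have -> : (2 * k = k * 2)%N by lia.
have -> : (2 * j.+1 = j.+1 * 2)%N by lia.
rewrite !exprM; ring.
Qed.

Lemma jump_partial_words q x k i m : (i < 2 ^ k)%N ->
  jump (partial q x 0 (k.+1 + m)) (odd_dyadic k i) =
  \sum_(v <- jump_words k i m) jump_coef q k v * x v.
Proof.
move=> ik; have ub := odd_dyadic_lt ik.
pose N := (k.+1 + m)%N; have kN : (k.+1 <= N)%N by rewrite leq_addr.
pose J := (i.*2.+1 * 2 ^ m).-1.
have m0 := expn_gt0 2 m.
have JS : (J.+1 = i.*2.+1 * 2 ^ m)%N by rewrite prednK// muln_gt0.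
have JN : (J.+1 < 2 ^ N)%N by rewrite JS /N expnD ltn_pmul2r.
pose u : R := J%:R / 2 ^+ N; pose v : R := J.+1%:R / 2 ^+ N.
have uJ : idx N u = J by rewrite idx_dyadic// ltnW.
have vJ : idx N v = J.+1 by rewrite idx_dyadic.
have v01 : 0 <= v <= 1 by have /andP[? ?] := dyadic_point_itv (R := R) JN; rewrite !ltW.
have u01 : 0 <= u <= 1.
  rewrite /u divr_ge0 ?pow2_ge0//= ler_pdivrMr ?pow2_gt0// mul1r -pow2E ler_nat; lia.
have vE : odd_dyadic k i = v.
  by rewrite /odd_dyadic (dyadic_point_refine _ kN) /v /N addKn -JS.
rewrite vE (jump_partial q x JN u01 v01 uJ vJ) /partial -sumrB.
under eq_bigr => l _ do rewrite -mulrBr.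
have /andP[u0 _] := u01; have /andP[v0 _] := v01.
have iu l : (l < N)%N -> idx l.+1 u = (J %/ 2 ^ (N - l.+1))%N.
  by move=> lN; rewrite (idx_div u0 lN) uJ.
have iv l : (l < N)%N -> idx l.+1 v = (J.+1 %/ 2 ^ (N - l.+1))%N.
  by move=> lN; rewrite (idx_div v0 lN) vJ.
rewrite (big_cat_nat (leq0n k)) /=; last by rewrite /N; lia.
(* Layers below [k] do not change across the point, both sides having the same first [k] digits. *)
rewrite big_nat_cond big1 ?add0r; last first.
  move=> l /andP[/andP[_ lk] _].
  have lN : (l < N)%N by rewrite /N; lia.
  suff -> : idx l.+1 u = idx l.+1 v by rewrite subrr mulr0.
  rewrite iu// iv//; have [a aE] : exists a, (N - l.+1 = m + a.+1)%N.
    by exists (k - l.+1)%N; rewrite /N; lia.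
  rewrite aE JS expnD !divnMA mulnK//.
  have -> : (J %/ 2 ^ m = i.*2)%N.
    apply/eqP; rewrite eqn_leq; apply/andP; split.
      by rewrite -ltnS ltn_divLR// -JS.
    rewrite leq_divRL// -ltnS JS mulSn; lia.
  by rewrite expnS !divnMA !divn2 doubleK /= uphalf_double.
(* Each finer layer adds the words of the intervals on the two sides of the point, the right one
   with even index and the left one with odd index. *)
have H j : (j <= m)%N -> \sum_(k <= l < k.+1 + j)
    q ^+ l * (layer x l (idx l.+1 v) - layer x l (idx l.+1 u)) =
    \sum_(w <- jump_words k i j) jump_coef q k w * x w.
  elim: j => [|j IH] jm.
    rewrite addn0 big_nat1 big_seq1 /jump_coef size_word eqxx iu ?iv; [|rewrite /N; lia..].
    rewrite /N addKn JS mulnK//.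
    have -> : (J %/ 2 ^ m = i.*2)%N.
      apply/eqP; rewrite eqn_leq; apply/andP; split.
        by rewrite -ltnS ltn_divLR// -JS.
      rewrite leq_divRL// -ltnS JS mulSn; lia.
    rewrite /layer /= odd_double /= uphalf_double doubleK expr1 expr0; ring.
  rewrite addnS big_nat_recr/=; last by lia.
  rewrite IH 1?ltnW// !big_cons /jump_coef !size_word.
  have -> : (k.+1 + j == k)%N = false by apply/eqP; lia.
  rewrite addrC [RHS]addrA; congr (_ + _); rewrite -mulrDr; congr (_ * _).
  rewrite iu ?iv; [|rewrite /N; lia..].
  have -> : (N - (k.+1 + j).+1 = m - j.+1)%N by rewrite /N; lia.
  have mj : (m = j.+1 + (m - j.+1))%N by rewrite subnKC.
  have aE : (J.+1 %/ 2 ^ (m - j.+1) = i.*2.+1 * 2 ^ j.+1)%N.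
    by rewrite JS {1}mj expnD mulnA mulnK// expn_gt0.
  have bE : (J %/ 2 ^ (m - j.+1) = (i.*2.+1 * 2 ^ j.+1).-1)%N.
    have d0 : (0 < 2 ^ (m - j.+1))%N by rewrite expn_gt0.
    have Jd : (J.+1 = i.*2.+1 * 2 ^ j.+1 * 2 ^ (m - j.+1))%N.
      by rewrite JS {1}mj expnD mulnA.
    have pos : (0 < i.*2.+1 * 2 ^ j.+1)%N by rewrite muln_gt0 expn_gt0.
    apply/eqP; rewrite eqn_leq; apply/andP; split.
      by rewrite -ltnS prednK// ltn_divLR// -Jd.
    rewrite leq_divRL// -ltnS Jd -{2}(prednK pos) mulSn; lia.
  rewrite aE bE /layer expnS mulnCA mul2n odd_double doubleK expr0 mul1r.
  have pos : (0 < i.*2.+1 * 2 ^ j)%N by rewrite muln_gt0 expn_gt0.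
  have -> : odd (i.*2.+1 * 2 ^ j).*2.-1 by case: (_ * _)%N pos => // b _; rewrite doubleS /= odd_double.
  have -> : ((i.*2.+1 * 2 ^ j).*2.-1)./2 = (i.*2.+1 * 2 ^ j).-1.
    by case: (_ * _)%N pos => // b _; rewrite doubleS /= uphalf_double.
  by rewrite expr1 mulN1r opprK.
by rewrite -H// /N.
Qed.

End jump_expansion.

(** * Comparison of integrals off a null set *)

Section nonmeasurable_integral.
Context d (T : measurableType d) (R : realType) (mu : {measure set T -> \bar R}).
Local Open Scope ereal_scope.
Import HBNNSimple.

(* The integral is the supremum of the integrals of the simple functions below
   the integrand, so no measurability of f or g is needed. *)
Lemma ge0_le_integral_negligible (f g : T -> \bar R) (N : set T) :
  measurable N -> mu N = 0 -> (forall x, 0 <= f x) -> (forall x, 0 <= g x) ->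
  (forall x, ~ N x -> f x <= g x) -> \int[mu]_x f x <= \int[mu]_x g x.
Proof.
move=> mN N0 f0 g0 fg; rewrite ge0_integralTE//.
apply: ge_ereal_sup => _ [h /= hf <-].
(* Setting [h] to 0 on the null set keeps its integral and puts it below [g] everywhere. *)
pose h' := proj_nnsfun h (measurableC mN).
have -> : sintegral mu h = sintegral mu h'.
  rewrite -!integralT_nnsfun; apply: ge0_ae_eq_integral => //.
  - exact/measurable_EFinP.
  - exact/measurable_EFinP.
  - by move=> x _; rewrite lee_fin.
  - by move=> x _; rewrite lee_fin.
  exists N; split=> // x; apply: contra_notP => Nx _.
  by rewrite /= mindicE mem_set ?mulr1.
rewrite ge0_integralTE//; apply: ereal_sup_ubound; exists h' => //= x.
rewrite mindicE; have [Nx|Nx] := pselect (N x).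
  by rewrite memNset ?mulr0//; apply.
by rewrite mem_set// mulr1 (le_trans (hf x))// fg.
Qed.

Lemma ge0_eq_integral_negligible (f g : T -> \bar R) (N : set T) :
  measurable N -> mu N = 0 -> (forall x, 0 <= f x) -> (forall x, 0 <= g x) ->
  (forall x, ~ N x -> f x = g x) -> \int[mu]_x f x = \int[mu]_x g x.
Proof.
move=> mN N0 f0 g0 fg; apply/eqP; rewrite eq_le; apply/andP.
by split; apply: (ge0_le_integral_negligible mN N0) => // x /fg ->.
Qed.

Lemma eq_integral_negligible (f g : T -> \bar R) (N : set T) :
  measurable N -> mu N = 0 -> (forall x, ~ N x -> f x = g x) ->
  \int[mu]_x f x = \int[mu]_x g x.
Proof.
move=> mN N0 fg; rewrite integralE [RHS]integralE; congr (_ - _).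
  by apply: (ge0_eq_integral_negligible mN N0) => // x /fg E; rewrite !funeposE E.
by apply: (ge0_eq_integral_negligible mN N0) => // x /fg E; rewrite !funenegE E.
Qed.

End nonmeasurable_integral.

Section probability_liminf.
Context d (T : measurableType d) (R : realType) (P : probability T R).

(** The limit inferior is an increasing union of intersections, each contained in one of the
    events. *)
Lemma probability_liminf_le (E : (set T)^nat) (b : \bar R) :
  (forall n, measurable (E n)) -> (forall n, (P (E n) <= b)%E) ->
  measurable (\bigcup_n \bigcap_(k in [set k | (n <= k)%N]) E k) /\
  (P (\bigcup_n \bigcap_(k in [set k | (n <= k)%N]) E k) <= b)%E.
Proof.
move=> mE Eb; pose F n := \bigcap_(k in [set k | (n <= k)%N]) E k.
have mF n : measurable (F n).
  by apply: bigcap_measurable => //; exists n => /=.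
have mU : measurable (\bigcup_n F n) by exact: bigcupT_measurable.
split=> //; have ndF : nondecreasing_seq F.
  apply/nondecreasing_seqP => n; apply/subsetPset => x Fx k /= nk.
  by apply: Fx => /=; exact: ltnW.
have cv := nondecreasing_cvg_mu (mu := P) mF mU ndF.
rewrite -(cvg_lim _ cv)//; apply: lime_le; first by apply/cvg_ex; eexists; exact: cv.
apply: nearW => n /=; apply: le_trans (Eb n).
by apply: le_measure; rewrite ?inE// => x; apply => /=.
Qed.

End probability_liminf.

Section ratio.
Context {R : realType}.

Lemma exists_theta_ratio (p a : R) : 1 <= p -> 0 <= a < 1 ->
  exists2 theta, 0 < theta < 1 & (1 - theta) `^ (1 - p) * a < 1.
Proof.
move=> p1 /andP[a0 a1]; have e0 : 0 < (1 - a) / 2 by lra.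
have [theta th Hth] := exists_small_theta p e0; exists theta => //.
have K1 := powR_onem_ge1 p1 th; set K := _ `^ _ in Hth K1 *.
have KK : K <= K ^+ 2 by rewrite ler_eXnr.
have KE : K <= 1 + (1 - a) / 2 by lra.
apply: le_lt_trans (ler_wpM2r a0 KE) _; nra.
Qed.

Lemma level_sum_powR_le (p m : R) (x : seq bool -> R) k : 1 <= m ->
  level_sum p x k `^ m <= (2 `^ (m - 1)) ^+ k * level_sum (p * m) x k.
Proof.
move=> m1; rewrite /level_sum.
have := @powR_sum_le R m nat (index_iota 0 (2 ^ k)) (fun i => `|x (word k i)| `^ p) m1.
rewrite size_iota subn0 => /(_ (fun i => powR_ge0 _ _)) /le_trans; apply.
have -> : (2 ^ k)%:R `^ (m - 1) = (2 `^ (m - 1)) ^+ k :> R.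
  by rewrite natrX -powR_mulrn// powRAC powR_mulrn ?powR_ge0.
rewrite ler_wpM2l ?exprn_ge0 ?powR_ge0// ler_sum// => i _.
by rewrite powRrM.
Qed.

End ratio.

Section series_integral.
Context d (T : measurableType d) (R : realType) (mu : {measure set T -> \bar R}).

Lemma integral_nneseries_from (f : nat -> T -> \bar R) n :
  (forall k, measurable_fun setT (f k)) -> (forall k x, (0 <= f k x)%E) ->
  (\int[mu]_x \sum_(n <= k <oo) f k x = \sum_(n <= k <oo) \int[mu]_x f k x)%E.
Proof.
move=> mf f0; rewrite monotone_convergence//.
- by congr (limn _); apply/funext => N; rewrite ge0_integral_sum.
- by move=> N; exact: emeasurable_sum.
- by move=> N x _; exact: sume_ge0.
- by move=> x _; exact: ereal_nondecreasing_series.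
Qed.

End series_integral.

(** * The random tail series and its moments *)

Section tail_series.
Context d (T : measurableType d) (R : realType) (P : probability T R).
Context (xi : seq bool -> {RV P >-> R}).
Hypothesis xi_normal : forall v, standard_normal (xi v).
Implicit Types (p r m : R) (n k : nat).

Definition tail_series r p n (w : T) : \bar R :=
  (\sum_(n <= k <oo) (r ^+ k * level_sum p (fun v => xi v w) k)%R%:E)%E.

Lemma integral_normal_powR v p :
  (\int[P]_w (`|xi v w| `^ p)%:E = gaussian_moment p)%E.
Proof.
pose S : T -> measurableTypeR R := xi v.
have mS : measurable_fun setT S by exact: (measurable_funP (xi v)).
transitivity (\int[pushforward P S]_x (`|x| `^ p)%:E)%E.
  rewrite ge0_integral_pushforward//.
  by apply/measurable_EFinP; exact: measurable_powR_norm.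
by apply: eq_measure_integral => B mB _; exact: xi_normal.
Qed.

Lemma measurable_xi_powR v p : measurable_fun setT (fun w => `|xi v w| `^ p).
Proof.
apply: (measurableT_comp (measurable_powR_norm p)).
exact: (measurable_funP (xi v)).
Qed.

Lemma measurable_level_sum p k :
  measurable_fun setT (fun w => level_sum p (fun v => xi v w) k).
Proof. by apply: measurable_sum => i; exact: measurable_xi_powR. Qed.

Lemma integral_level_sum p k :
  (\int[P]_w (level_sum p (fun v => xi v w) k)%:E = (2 ^+ k)%R%:E * gaussian_moment p)%E.
Proof.
rewrite /level_sum; under eq_integral do rewrite -sumEFin.
rewrite ge0_integral_sum//; last first.
  by move=> i; apply/measurable_EFinP; exact: measurable_xi_powR.
under eq_bigr do rewrite integral_normal_powR.
under eq_bigr do rewrite -[gaussian_moment p]mul1e.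
by rewrite -ge0_sume_distrl// sumEFin sumr_const_nat subn0 natrX.
Qed.

Lemma measurable_tail_series r p n : 0 <= r -> measurable_fun setT (tail_series r p n).
Proof.
move=> r0; apply: (emeasurable_fun_cvg (fun N w =>
  \sum_(n <= k < N) (r ^+ k * level_sum p (fun v => xi v w) k)%R%:E)%E).
  move=> N; apply: emeasurable_sum => k; apply/measurable_EFinP.
  by apply: measurable_funM => //; exact: measurable_level_sum.
move=> w _; apply: is_cvg_nneseries => k _ _.
by rewrite lee_fin mulr_ge0 ?exprn_ge0 ?level_sum_ge0.
Qed.

Lemma integral_tail_series r p n : 0 <= r ->
  (\int[P]_w tail_series r p n w =
   \sum_(n <= k <oo) ((2 * r) ^+ k)%R%:E * gaussian_moment p)%E.
Proof.
move=> r0; rewrite /tail_series integral_nneseries_from; last 2 first.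
- move=> k; apply/measurable_EFinP; apply: measurable_funM => //.
  exact: measurable_level_sum.
- by move=> k w; rewrite lee_fin mulr_ge0 ?exprn_ge0 ?level_sum_ge0.
apply: eq_eseriesr => k _; under eq_integral do rewrite EFinM.
rewrite ge0_integralZl//; last 3 first.
- by apply/measurable_EFinP; exact: measurable_level_sum.
- by move=> w _; rewrite lee_fin level_sum_ge0.
- by rewrite lee_fin exprn_ge0.
by rewrite integral_level_sum muleA -EFinM -exprMn mulrC.
Qed.

Lemma gaussian_moment_ge0 p : (0 <= gaussian_moment p :> \bar R)%E.
Proof. by apply: integral_ge0 => x _; rewrite lee_fin powR_ge0. Qed.

Lemma integral_tail_series_lty r p : 0 < r -> 2 * r < 1 -> 0 < p ->
  (\int[P]_w tail_series r p 0 w < +oo)%E.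
Proof.
move=> r0 r1 p0; rewrite integral_tail_series ?ltW//.
have M1 : (fine (gaussian_moment p : \bar R))%:E = gaussian_moment p.
  by rewrite fineK// ge0_fin_numE ?gaussian_moment_ge0// gaussian_moment_fin.
under eq_eseriesr do rewrite muleC -M1.
rewrite nneseriesZl => [|k _]; last by rewrite lee_fin exprn_ge0// mulr_ge0// ltW.
rewrite lte_mul_pinfty// ?M1 ?gaussian_moment_ge0//.
have r20 : 0 < 2 * r by rewrite mulr_gt0.
apply: (@le_lt_trans _ _ (1 * (1 - 2 * r)^-1)%:E); last exact: ltry.
apply: lime_le.
  by apply: is_cvg_nneseries => k _ _; rewrite lee_fin exprn_ge0// ltW.
apply: nearW => n; rewrite sumEFin lee_fin.
have := @geometric_le_lim R n 1 (2 * r) ler01 r20.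
rewrite gtr0_norm// => /(_ r1); apply: le_trans.
by rewrite /series /= le_eqVlt; apply/orP; left; apply/eqP; apply: eq_bigr => k _; rewrite mul1r.
Qed.

Lemma integral_tail_series_cvg0 r p : 0 < r -> 2 * r < 1 -> 0 < p ->
  (\int[P]_w tail_series r p n w)%E @[n --> \oo] --> 0%E.
Proof.
move=> r0 r1 p0; have := integral_tail_series_lty r0 r1 p0.
rewrite integral_tail_series ?ltW// => H.
under eq_fun do rewrite integral_tail_series ?ltW//.
apply: nneseries_tail_cvg => // k _.
by rewrite mule_ge0 ?gaussian_moment_ge0// lee_fin exprn_ge0// mulr_ge0// ltW.
Qed.

Lemma tail_series_term_ge0 r p w k : 0 <= r ->
  (0 <= (r ^+ k * level_sum p (fun v => xi v w) k)%R%:E)%E.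
Proof. by move=> r0; rewrite lee_fin mulr_ge0 ?exprn_ge0 ?level_sum_ge0. Qed.

Lemma tail_series_ge0 r p n w : 0 <= r -> (0 <= tail_series r p n w)%E.
Proof. by move=> r0; apply: nneseries_ge0 => k _ _; exact: tail_series_term_ge0. Qed.

Lemma tail_series_le0 r p n w : 0 <= r -> (tail_series r p n w <= tail_series r p 0 w)%E.
Proof.
move=> r0; rewrite {2}/tail_series (@nneseries_split _ _ 0 n); last first.
  by move=> k _; exact: tail_series_term_ge0.
rewrite add0n leeDr// sumEFin lee_fin sumr_ge0// => k _.
by rewrite mulr_ge0 ?exprn_ge0 ?level_sum_ge0.
Qed.

Lemma tail_series_partial r p n N w : 0 <= r -> (tail_series r p 0 w < +oo)%E ->
  \sum_(n <= k < N) r ^+ k * level_sum p (fun v => xi v w) k <=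
  fine (tail_series r p n w).
Proof.
move=> r0 fin; rewrite -lee_fin fineK; last first.
  rewrite ge0_fin_numE ?tail_series_ge0//.
  exact: le_lt_trans (tail_series_le0 _ _ _ r0) fin.
rewrite -sumEFin; apply: nneseries_lim_ge => k _ _; exact: tail_series_term_ge0.
Qed.

Lemma tail_series_cvg0 r p w : 0 <= r -> (tail_series r p 0 w < +oo)%E ->
  fine (tail_series r p n w) @[n --> \oo] --> 0.
Proof.
move=> r0 fin; have : tail_series r p n w @[n --> \oo] --> 0%E.
  by apply: nneseries_tail_cvg => // k _; exact: tail_series_term_ge0.
by move/fine_cvg.
Qed.

(** Moments of tails thus reduce to first moments. Convexity across levels costs [K] per level, and
    across the [2^k] words of a level another [2^(m - 1)] per level; hence [2 * r' = K * (2 * r)^m],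
    which is below 1 for a suitable [theta]. *)
Lemma tail_series_powR r p m : 0 < r -> 2 * r < 1 -> 1 <= m ->
  exists r' L, [/\ 0 < r', 2 * r' < 1, 0 <= L & forall n w,
    (tail_series r p 0 w < +oo)%E ->
    ((fine (tail_series r p n w) `^ m)%:E <= L%:E * tail_series r' (p * m) n w)%E].
Proof.
move=> r0 r1 m1; have m0 : 0 < m by exact: lt_le_trans m1.
have a01 : 0 <= (2 * r) `^ m < 1.
  have r20 : 2 * r \is Num.nneg by rewrite nnegrE mulr_ge0// ltW.
  have := gt0_ltr_powR m0 r20 (ler01 : 1 \is Num.nneg) r1.
  by rewrite powR1 powR_ge0.
have [theta th Hth] := exists_theta_ratio m1 a01.
pose K := (1 - theta) `^ (1 - m); pose L := theta `^ (1 - m).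
have K1 : 1 <= K := powR_onem_ge1 m1 th.
have K0 : 0 < K := lt_le_trans ltr01 K1.
pose r' := K * (r `^ m * 2 `^ (m - 1)).
have r'0 : 0 < r' by rewrite /r' mulr_gt0// mulr_gt0// powR_gt0.
exists r', L; split=> //.
- apply: le_lt_trans Hth; rewrite -/K /r' powRM ?(ltW r0)// -[2 `^ m](mulr_powRB1 _ m0)//.
  by rewrite le_eqVlt; apply/orP; left; apply/eqP; ring.
- exact: powR_ge0.
move=> n w fin; set x := fun v => xi v w.
pose S N := \sum_(n <= k < N) r ^+ k * level_sum p x k.
have B N : (n <= N)%N -> ((S N `^ m)%:E <= L%:E * tail_series r' (p * m) n w)%E.
  move=> nN; apply: (@le_trans _ _ (L * \sum_(n <= k < N) r' ^+ k * level_sum (p * m) x k)%:E).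
    rewrite lee_fin; have := powR_norm_sum_le (fun k => r ^+ k * level_sum p x k) m1 th nN.
    rewrite ger0_norm; last first.
      by apply: sumr_ge0 => k _; rewrite mulr_ge0 ?exprn_ge0 ?level_sum_ge0// ltW.
    move=> /le_trans; apply; rewrite ler_wpM2l ?powR_ge0//; apply: ler_sum => k _.
    rewrite ger0_norm ?mulr_ge0 ?exprn_ge0 ?level_sum_ge0 ?(ltW r0)//.
    rewrite powRM ?exprn_ge0 ?level_sum_ge0 ?(ltW r0)//.
    have -> : (r ^+ k) `^ m = (r `^ m) ^+ k.
      by rewrite -powR_mulrn ?(ltW r0)// powRAC powR_mulrn ?powR_ge0.
    rewrite /r' !exprMn -!mulrA; apply: ler_pM.
    - by rewrite exprn_ge0// ltW.
    - by rewrite mulr_ge0 ?exprn_ge0 ?powR_ge0.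
    - by rewrite ler_weXn2l ?leq_subr.
    by rewrite ler_wpM2l ?exprn_ge0 ?powR_ge0// level_sum_powR_le.
  rewrite EFinM lee_wpmul2l ?lee_fin ?powR_ge0// -sumEFin.
  by apply: nneseries_lim_ge => k _ _; apply: tail_series_term_ge0; exact: ltW.
have tfin : tail_series r p n w \is a fin_num.
  rewrite ge0_fin_numE ?tail_series_ge0 ?ltW//.
  exact: le_lt_trans (tail_series_le0 _ _ _ (ltW r0)) fin.
have cS : S N @[N --> \oo] --> fine (tail_series r p n w).
  have : (S N)%:E @[N --> \oo] --> (fine (tail_series r p n w))%:E.
    rewrite fineK//; under eq_fun do rewrite -sumEFin.
    by apply: is_cvg_nneseries => k _ _; apply: tail_series_term_ge0; exact: ltW.
  by move/fine_cvg.
have cSm : (`|S N| `^ m)%:E @[N --> \oo] --> (`|fine (tail_series r p n w)| `^ m)%:E.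
  apply/cvg_EFin; first exact: nearW.
  exact: (continuous_cvg _ (continuous_powR_norm m1 (x := _)) cS).
rewrite -[X in (X `^ m)%:E]ger0_norm ?fine_ge0 ?(tail_series_ge0 _ _ _ (ltW r0))//.
rewrite -(cvg_lim _ cSm)//; apply: lime_le; first by apply/cvg_ex; eexists; exact: cSm.
exists n => // N /= nN; rewrite ger0_norm ?B//.
by apply: sumr_ge0 => k _; rewrite mulr_ge0 ?exprn_ge0 ?level_sum_ge0// ltW.
Qed.

End tail_series.

(** * The limit process *)

Section limit_paths.
Context d (T : measurableType d) (R : realType) (P : probability T R).
Variables (alpha : R) (xi : seq bool -> {RV P >-> R}) (Z : R -> {RV P >-> R}).
Let q : R := 2^-1 `^ (1 - alpha / 2).

Definition good_path w : Prop := forall e, 0 < e -> exists n0, forall n, (n0 <= n)%N ->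
  forall u, 0 <= u <= 1 -> `|Z u w - partial q (fun v => xi v w) 0 n u| <= e.

Lemma good_path_ae : limit_process alpha xi Z ->
  exists N, [/\ measurable N, P N = 0%E & forall w, ~ N w -> good_path w].
Proof.
move=> [N [mN N0 sN]]; exists N; split=> // w Nw e e0.
have uc : {uniform `[0, 1], (fun n => Zapprox alpha (fun v => xi v w) n) @ \oo -->
    (fun t => Z t w)} by apply: contrapT => H; apply: Nw; apply: sN.
have : nbhs ((fun t => Z t w) : {uniform` `[0, 1]%classic -> R})
    [set h | forall y, `[0, 1]%classic y -> ball (Z y w) e (h y)].
  apply/uniform_nbhs; exists [set xy | ball xy.1 e xy.2]; split=> //.
  exact: entourage_ball (PosNum e0).
move/uc => [n0 _ Hn0]; exists n0 => n n0n u u01.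
have := Hn0 n n0n u; rewrite /= in_itv /= => /(_ u01).
rewrite /ball /= /partial => /ltW.
by rewrite Zapprox_layer.
Qed.

Section good.
Variable w : T.
Hypothesis gw : good_path w.
Local Notation x := (fun v => xi v w).
Local Notation z := (fun u => Z u w).

Lemma good_path_cvg u : 0 <= u <= 1 -> partial q x 0 N u @[N --> \oo] --> z u.
Proof.
move=> u01; apply/cvgrPdist_le => /= e e0; have [n0 H] := gw e0.
by exists n0 => // n /= n0n; exact: H.
Qed.

Lemma good_path_regular : dyadic_regular z.
Proof.
apply: dyadic_regular_approx => e e0; have [n0 H] := gw e0.
exists (partial q x 0 n0); first exact: dyadic_regular_partial.
by move=> u u01; exact: H.
Qed.

(** A jump is at most twice the supremum norm, so jumps pass to uniform limits. *)
Lemma good_path_jump_cvg k i : (i < 2 ^ k)%N ->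
  jump (partial q x 0 (k.+1 + m)) (odd_dyadic k i) @[m --> \oo] -->
  jump z (odd_dyadic k i).
Proof.
move=> ik; apply/cvgrPdist_le => /= e e0.
have [n0 H] := gw (divr_gt0 e0 (ltr0Sn R 1)).
exists n0 => // m /= n0m.
have ub := odd_dyadic_lt ik; rewrite /odd_dyadic.
rewrite -jumpB//; [|exact: good_path_regular|exact: dyadic_regular_partial].
rewrite [leRHS]splitr; apply: jump_norm_le => //.
  by apply: dyadic_regularB; [exact: good_path_regular|exact: dyadic_regular_partial].
by move=> u u01; apply: H => //; rewrite (leq_trans n0m)// leq_addl.
Qed.

End good.

Section jump_variables.
Variables (k i : nat) (N : set T).
Hypothesis ik : (i < 2 ^ k)%N.
Hypothesis (mN : measurable N) (N0 : P N = 0%E) (gN : forall w, ~ N w -> good_path w).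

Definition jump_approximant m (w : T) : R :=
  linear_comb xi (jump_coef q k) (jump_words k i m) w.

Lemma jump_approximantE m w :
  jump (partial q (fun v => xi v w) 0 (k.+1 + m)) (odd_dyadic k i) =
  jump_approximant m w.
Proof. exact: jump_partial_words. Qed.

(* Z is only controlled off the null set N. *)
Definition jump_variable (w : T) : R :=
  \1_(~` N) w * jump (fun u => Z u w) (odd_dyadic k i).

Lemma jump_variableE w : ~ N w ->
  jump_variable w = jump (fun u => Z u w) (odd_dyadic k i).
Proof. by move=> Nw; rewrite /jump_variable indicE mem_set// mul1r. Qed.

Lemma jump_variable_cvg w :
  \1_(~` N) w * jump_approximant m w @[m --> \oo] --> jump_variable w.
Proof.
rewrite /jump_variable indicE; have [Nw|Nw] := pselect (N w).
  rewrite memNset; last by apply.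
  by rewrite mul0r; under eq_fun do rewrite mul0r; exact: cvg_cst.
rewrite mem_set// mul1r; under eq_fun do rewrite mul1r -jump_approximantE.
exact: (good_path_jump_cvg (gN Nw) ik).
Qed.

Lemma measurable_jump_approximant m : measurable_fun setT (jump_approximant m).
Proof. exact: measurable_linear_comb. Qed.

Lemma measurable_jump_variable : measurable_fun setT jump_variable.
Proof.
apply: (measurable_fun_cvg (h := fun m w => \1_(~` N) w * jump_approximant m w)).
  move=> m; apply: measurable_funM; last exact: measurable_jump_approximant.
  by apply: measurable_indic; exact: measurableC.
by move=> w _; exact: jump_variable_cvg.
Qed.

End jump_variables.
End limit_paths.

Lemma exists_tail_ratio (R : realType) (p q : R) : 1 <= p -> 0 < q ->
  2 * q `^ p < 1 ->
  exists2 theta, 0 < theta < 1 & 0 < tail_ratio theta q p /\ 2 * tail_ratio theta q p < 1.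
Proof.
move=> p1 q0 q1; have a01 : 0 <= 2 * q `^ p < 1 by rewrite mulr_ge0 ?powR_ge0.
have [theta th H] := exists_theta_ratio p1 a01; exists theta => //; split.
  by rewrite /tail_ratio mulr_gt0 ?powR_gt0//; lra.
by rewrite /tail_ratio mulrCA.
Qed.

(** * The supercritical case *)

Section supercritical.
Context d (T : measurableType d) (R : realType) (P : probability T R).
Variables (alpha p theta0 : R) (xi : seq bool -> {RV P >-> R}) (Z : R -> {RV P >-> R}).
Let q : R := 2^-1 `^ (1 - alpha / 2).
Let r : R := tail_ratio theta0 q p.
Let C : R := tail_const theta0 p.
Hypothesis xi_normal : forall v, standard_normal (xi v).
Hypotheses (p1 : 1 <= p) (th0 : 0 < theta0 < 1) (r0 : 0 < r) (r1 : 2 * r < 1).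
Local Notation z w := (fun u => Z u w).
Local Notation good_path := (good_path alpha xi Z).

Let q0 : 0 <= q. Proof. exact: powR_ge0. Qed.
Let p0 : 0 < p. Proof. exact: lt_le_trans p1. Qed.

Definition tame_path w : Prop := good_path w /\ (tail_series xi r p 0 w < +oo)%E.

Lemma tame_path_ae : limit_process alpha xi Z ->
  exists N, [/\ measurable N, P N = 0%E & forall w, ~ N w -> tame_path w].
Proof.
move=> /good_path_ae[N1 [mN1 N10 gN1]].
have r0' := ltW r0.
have it : P.-integrable setT (tail_series xi r p 0).
  apply/integrableP; split; first exact: measurable_tail_series.
  under eq_integral do rewrite gee0_abs ?tail_series_ge0//.
  exact: integral_tail_series_lty.
have [N2 [mN2 N20 sN2]] := integrable_ae measurableT it.
exists (N1 `|` N2); split; first exact: measurableU.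
  by rewrite measureU0.
move=> w; rewrite not_orE => -[/gN1 gw Nw]; split=> //.
rewrite -ge0_fin_numE ?tail_series_ge0//.
by apply: contrapT => H; apply: Nw; apply: sN2 => /= /(_ Logic.I).
Qed.

Definition tail w n : R := fine (tail_series xi r p n w).

Section tame.
Variable w : T.
Hypothesis tw : tame_path w.

Let HB n N : (n <= N)%N -> \sum_(n <= k < N)
  tail_ratio theta0 q p ^+ k * level_sum p (fun v => xi v w) k <= tail w n.
Proof. by move=> _; apply: tail_series_partial; [exact: ltW|case: tw]. Qed.

Lemma tame_path_Vvar : (Vvar p 1 (z w) < +oo)%E.
Proof.
apply: (@le_lt_trans _ _ (C * tail w 0)%:E); last exact: ltry.
apply: ge_ereal_sup => _ [s st <-]; rewrite lee_fin.
exact: (power_sum_le_total p1 q0 th0 (good_path_cvg tw.1) HB (lexx 1) st).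
Qed.

Lemma tame_path_dyadic t : t <= 1 ->
  Wvar p t (z w) = \esum_(s in dyadic `&` `[0, t]) (`|jump (z w) s| `^ p)%:E.
Proof.
by move=> t1; apply: Wvar_dyadic => //; [rewrite gt_eqF|exact: good_path_regular tw.1].
Qed.

Lemma tame_path_pvar t : 0 < t <= 1 ->
  pvar_exists p t (z w) /\ pvar p t (z w) = Wvar p t (z w).
Proof.
move=> t01; have /andP[t0 _] := t01; apply: pvarE => //.
apply: (power_sum_cvg_Wvar p1 q0 th0 (good_path_regular tw.1) (good_path_cvg tw.1) HB) => //.
by apply: tail_series_cvg0; [exact: ltW|case: tw].
Qed.

Lemma tame_path_dist theta t n s : 0 < theta < 1 -> 0 < t <= 1 ->
  itv_partition 0 t s -> mesh s < (2 ^+ n)^-1 ->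
  (`|(power_sum p (z w) s)%:E - pvar p t (z w)| <=
    ((((1 - theta) `^ (1 - p)) ^+ 2 - 1) * (C * tail w 0) +
     ((1 - theta) `^ (1 - p) + 1) * (theta `^ (1 - p) * (C * tail w n)))%:E)%E.
Proof.
move=> th t01 st ms; rewrite (tame_path_pvar t01).2.
have fr := good_path_regular tw.1; have ff := good_path_cvg tw.1.
rewrite -(fineK (Wvar_fin_num p1 q0 th0 fr ff HB t01)) -EFinB abse_EFin lee_fin.
exact: (power_sum_Wvar_dist p1 q0 th0 fr ff HB th t01 st ms).
Qed.

End tame.

(** A single jump is below the sum of all jumps on [0, 1], which the tail series bounds uniformly in
    [m]: this is the domination used to pass to the limit in the moments. *)
Lemma jump_approximant_le k i m w : (i < 2 ^ k)%N -> (tail_series xi r p 0 w < +oo)%E ->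
  `|jump_approximant alpha xi k i m w| `^ p <= C * tail w 0.
Proof.
move=> ik fin; rewrite -jump_approximantE//.
set x := fun v => xi v w; set n := (k.+1 + m)%N.
have pr := dyadic_regular_partial q x n.
apply: le_trans (jump_powR_le_jump_sum _ _ ik) _.
apply: jump_sum_le => //; first by rewrite ltr01 lexx.
exists 1 => // s st _.
apply: le_trans (power_sum_partial_le _ p1 th0 q0 (lexx 1) st (leq0n n)) _.
by rewrite ler_wpM2l ?tail_const_ge0// tail_series_partial// ltW.
Qed.

End supercritical.

Lemma cvge0_le (R : realType) (I : Type) (F : set_system I) (f : I -> \bar R) :
  Filter F -> (forall x, (0 <= f x)%E) ->
  (forall e, 0 < e -> \forall x \near F, (f x <= e%:E)%E) -> f x @[x --> F] --> 0%E.
Proof.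
move=> FF f0 H; apply/fine_cvgP; split.
  apply: filterS (H 1 ltr01) => x fx; rewrite ge0_fin_numE//.
  exact: le_lt_trans fx (ltry _).
apply/cvgrPdist_le => /= e e0; apply: filterS (H e e0) => x fx.
rewrite sub0r normrN ger0_norm ?fine_ge0// -lee_fin fineK//.
by rewrite ge0_fin_numE// (le_lt_trans fx (ltry _)).
Qed.

(** * Convergence of all moments *)

Section moments.
Context d (T : measurableType d) (R : realType) (P : probability T R).
Variables (alpha p theta0 : R) (xi : seq bool -> {RV P >-> R}) (Z : R -> {RV P >-> R}).
Let q : R := 2^-1 `^ (1 - alpha / 2).
Let r : R := tail_ratio theta0 q p.
Let C : R := tail_const theta0 p.
Hypothesis xi_normal : forall v, standard_normal (xi v).
Hypotheses (p1 : 1 <= p) (th0 : 0 < theta0 < 1) (r0 : 0 < r) (r1 : 2 * r < 1).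
Local Notation z w := (fun u => Z u w).
Local Notation tame w := (tame_path alpha p theta0 xi Z w).

Let p0 : 0 < p. Proof. exact: lt_le_trans p1. Qed.

Variable t : R.
Hypothesis t01 : 0 < t <= 1.

Let dist s w : \bar R := `|(power_sum p (z w) s)%:E - pvar p t (z w)|%E.

(** One [g] serves all decompositions of mesh below 2^-n, because the bound in [tame_path_dist]
    depends on the decomposition only through [n]. *)
Lemma exists_dominating_ge1 m e : 1 <= m -> 0 < e -> exists g n,
  [/\ measurable_fun setT g, forall w, (0 <= g w)%E, (\int[P]_w g w <= e%:E)%E &
      forall s w, tame w -> itv_partition 0 t s -> mesh s < (2 ^+ n)^-1 ->
        (dist s w `^ m <= g w)%E].
Proof.
move=> m1 e0; have m0 : 0 < m by exact: lt_le_trans m1.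
have pm0 : 0 < p * m by exact: mulr_gt0.
have [r' [L [r'0 r'1 L0 HL]]] := tail_series_powR xi p r0 r1 m1.
have r'0' := ltW r'0.
pose I n : \bar R := (\int[P]_w tail_series xi r' (p * m) n w)%E.
have I0 n : (0 <= I n)%E by apply: integral_ge0 => w _; exact: tail_series_ge0.
have Ifin : (I 0%N < +oo)%E by exact: integral_tail_series_lty.
have Icvg : I n @[n --> \oo] --> 0%E by exact: integral_tail_series_cvg0.
have /fineK IE : I 0%N \is a fin_num by rewrite ge0_fin_numE.
have C0 : 0 <= C by exact: tail_const_ge0.
(* Collects [(u + v)^m <= 2^m (u^m + v^m)], the constant [C] of the path estimate and [L] from
   [tail_series_powR]. *)
pose G := 2 `^ m * C `^ m * L.
have G0 : 0 <= G by rewrite !mulr_ge0 ?powR_ge0.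
set I0' := fine _ in IE; have I0'0 : 0 <= I0' by rewrite fine_ge0.
(* [a] will bound [K^2 - 1], so that the first half of [g] has integral at most [e / 2]. This fixes
   [theta] and with it [b]; only then is [n] chosen to make the second half small. *)
pose a := (e / 2 / (G * I0' + 1)) `^ m^-1.
have GI : 0 < G * I0' + 1 by rewrite ltr_wpDl// mulr_ge0.
have a0 : 0 < a by rewrite powR_gt0// !divr_gt0.
have aE : a `^ m = e / 2 / (G * I0' + 1).
  by rewrite /a -powRrM mulVf ?gt_eqF// powRr1// !divr_ge0 ?ltW.
have [theta th Hth] := exists_small_theta p a0.
set K := (1 - theta) `^ (1 - p) in Hth.
have K1 : 1 <= K := powR_onem_ge1 p1 th.
have A0 : 0 <= K ^+ 2 - 1 by rewrite subr_ge0 exprn_ege1.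
pose b := (K + 1) * theta `^ (1 - p).
have b0 : 0 <= b by rewrite mulr_ge0 ?powR_ge0// addr_ge0// (le_trans ler01).
have [n Hn] : exists n, ((G * b `^ m)%:E * I n <= (e / 2)%:E)%E.
  have : ((G * b `^ m)%:E * I n)%E @[n --> \oo] --> ((G * b `^ m)%:E * 0)%E.
    by apply: cvgeZl.
  rewrite mule0 => /fine_cvgP[[n1 _ H1]] /cvgrPdist_le /= /(_ _ (divr_gt0 e0 (ltr0Sn R 1))).
  move=> [n2 _ H2]; exists (maxn n1 n2).
  have F1 := H1 _ (leq_maxl n1 n2); have := H2 _ (leq_maxr n1 n2).
  rewrite sub0r normrN => /(le_trans (ler_norm _)); rewrite -lee_fin fineK//.
pose g w := ((G * a `^ m)%:E * tail_series xi r' (p * m) 0 w +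
             (G * b `^ m)%:E * tail_series xi r' (p * m) n w)%E.
have ca : (0 <= (G * a `^ m)%:E :> \bar R)%E by rewrite lee_fin mulr_ge0 ?powR_ge0.
have cb : (0 <= (G * b `^ m)%:E :> \bar R)%E by rewrite lee_fin mulr_ge0 ?powR_ge0.
have mts l := measurable_tail_series xi (p * m) l r'0'.
have ts0 l w := tail_series_ge0 xi (p * m) l w r'0'.
exists g, n; split.
- by apply: emeasurable_funD; exact: measurable_funeM.
- by move=> w; rewrite adde_ge0// mule_ge0.
- rewrite /g ge0_integralD//; last 4 first.
  + by move=> w _; rewrite mule_ge0.
  + exact: measurable_funeM.
  + by move=> w _; rewrite mule_ge0.
  + exact: measurable_funeM.
  rewrite !ge0_integralZl// -/(I 0%N) -/(I n) (splitr e) EFinD leeD//.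
  rewrite -IE -EFinM lee_fin aE.
  rewrite (_ : G * _ * _ = e / 2 * (G * I0') / (G * I0' + 1)); last by ring.
  by rewrite ler_pdivrMr// ler_wpM2l ?lerDl// ?divr_ge0 ?ltW.
move=> s w tw st ms; have := tame_path_dist p1 th0 r0 tw th t01 st ms.
rewrite -/K -/C /dist; set D := (_ - _)%E.
have Dge0 : (0 <= `|D|)%E by exact: abse_ge0.
move=> HD; have Dfin : `|D|%E \is a fin_num.
  by rewrite ge0_fin_numE// (le_lt_trans HD (ltry _)).
rewrite -(fineK Dfin) lee_fin in HD; have y0 : 0 <= fine `|D|%E by rewrite fine_ge0.
rewrite -(fineK Dfin); set y := fine _ in HD y0 *; rewrite poweR_EFin.
have tl l : 0 <= tail alpha p theta0 xi w l.
  by apply: fine_ge0; apply: tail_series_ge0; exact: (ltW r0).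
have H0' := HL 0%N w tw.2; have Hn' := HL n w tw.2.
change (fine (tail_series xi r p 0 w)) with (tail alpha p theta0 xi w 0) in H0'.
change (fine (tail_series xi r p n w)) with (tail alpha p theta0 xi w n) in Hn'.
have t0n := tl 0%N; have tnn := tl n.
move: (tail alpha p theta0 xi w 0) (tail alpha p theta0 xi w n) => T0 Tn in HD H0' Hn' t0n tnn *.
apply: (@le_trans _ _ (2 `^ m * ((a * (C * T0)) `^ m + (b * (C * Tn)) `^ m))%:E).
  have u0 : 0 <= a * (C * T0) by apply: mulr_ge0; [exact: ltW|exact: mulr_ge0].
  have un : 0 <= b * (C * Tn) by apply: mulr_ge0 => //; exact: mulr_ge0.
  rewrite lee_fin; apply: le_trans (powR_addr_le m0 u0 un).
  apply: ge0_ler_powR; rewrite ?nnegrE ?(ltW m0) ?addr_ge0//.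
  apply: (le_trans HD); apply: lerD; last by rewrite /b -!mulrA.
  by apply: ler_wpM2r => //; exact: mulr_ge0.
have scale (c y' : R) Y : 0 <= c -> 0 <= y' -> ((y' `^ m)%:E <= L%:E * Y)%E ->
    ((2 `^ m * (c * (C * y')) `^ m)%:E <= (G * c `^ m)%:E * Y)%E.
  move=> c0 y'0 HY; rewrite powRM ?(mulr_ge0 C0 y'0)// powRM//.
  rewrite (_ : _ * _ = 2 `^ m * C `^ m * c `^ m * y' `^ m); last by ring.
  rewrite EFinM (_ : G * _ = 2 `^ m * C `^ m * c `^ m * L); last by rewrite /G; ring.
  by rewrite [in leRHS]EFinM -muleA lee_wpmul2l// lee_fin !mulr_ge0 ?powR_ge0.
by rewrite mulrDr EFinD; apply: leeD; apply: scale => //; exact: ltW.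
Qed.

Lemma exists_dominating m e : 0 < m -> 0 < e -> exists g n,
  [/\ measurable_fun setT g, forall w, (0 <= g w)%E, (\int[P]_w g w <= e%:E)%E &
      forall s w, tame w -> itv_partition 0 t s -> mesh s < (2 ^+ n)^-1 ->
        (dist s w `^ m <= g w)%E].
Proof.
move=> m0 e0; have [m1|m1] := leP 1 m; first exact: exists_dominating_ge1.
(* In [powR_le_affine] the constant term then takes [e / 2]; the case of exponent 1, applied with
   [e / 2 / c], pays for the linear term. *)
pose eta := (e / 2) `^ m^-1; have e2 : 0 < e / 2 by rewrite divr_gt0.
have eta0 : 0 < eta by rewrite powR_gt0.
have etaE : eta `^ m = e / 2 by rewrite /eta -powRrM mulVf ?gt_eqF// powRr1// ltW.
pose c := eta `^ (m - 1); have c0 : 0 < c by rewrite powR_gt0.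
have [g [n [mg g0 ig Hg]]] := exists_dominating_ge1 (lexx 1) (divr_gt0 e2 c0).
have e20 : (0 <= (e / 2)%:E :> \bar R)%E by rewrite lee_fin ltW.
exists (fun w => (e / 2)%:E + c%:E * g w)%E, n; split.
- by apply: emeasurable_funD => //; exact: measurable_funeM.
- by move=> w; rewrite adde_ge0// mule_ge0// lee_fin ltW.
- rewrite ge0_integralD//; last 2 first.
  + by move=> w _; rewrite mule_ge0// lee_fin ltW.
  + exact: measurable_funeM.
  have -> : (\int[P]_w (e / 2)%:E = (e / 2)%:E)%E.
    rewrite integral_cst//; transitivity ((e / 2)%:E * 1)%E; last by rewrite mule1.
    by congr (_ * _)%E; exact: probability_setT.
  rewrite ge0_integralZl//; last by rewrite lee_fin ltW.
  rewrite [e in leRHS]splitr EFinD leeD2l//.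
  apply: (@le_trans _ _ (c%:E * (e / 2 / c)%:E)%E).
    by rewrite lee_wpmul2l// lee_fin ltW.
  by rewrite -EFinM lee_fin mulrC divfK// gt_eqF.
move=> s w tw st ms; have := Hg s w tw st ms; rewrite poweRe1 ?abse_ge0//.
move=> H; have Dge0 : (0 <= dist s w)%E by exact: abse_ge0.
have [gfin|] := boolP (g w \is a fin_num); last first.
  rewrite ge0_fin_numE// -leNgt leye_eq => /eqP ->.
  by rewrite gt0_muley ?lte_fin// addey ?leey.
rewrite -(fineK gfin) in H *.
have Dfin : dist s w \is a fin_num by rewrite ge0_fin_numE// (le_lt_trans H (ltry _)).
rewrite -(fineK Dfin) in H *; rewrite lee_fin in H.
rewrite poweR_EFin -EFinM -EFinD lee_fin -etaE.
have m01 : 0 < m <= 1 by rewrite m0 ltW.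
apply: le_trans (powR_le_affine m01 eta0 (fine_ge0 Dge0)) _.
by rewrite lerD2l ler_wpM2l// ltW.
Qed.

Lemma moment_cvg m : limit_process alpha xi Z -> 0 < m ->
  (\int[P]_w (`|(power_sum p (z w) s)%:E - pvar p t (z w)| `^ m))%E
    @[s --> mesh_to0 t] --> 0%E.
Proof.
move=> lim m0; have /andP[t0 _] := t01; have F := mesh_to0_filter t0.
have [N [mN N0 tN]] := tame_path_ae xi_normal p1 r0 r1 lim.
apply: cvge0_le => [s|e e0]; first by apply: integral_ge0 => w _; exact: poweR_ge0.
have [g [n [mg g0 ig Hg]]] := exists_dominating m0 e0.
exists (2 ^+ n)^-1 => [|s [st ms] /=]; first exact: pow2V_gt0.
apply: le_trans ig; apply: (ge0_le_integral_negligible mN N0) => // w; first exact: poweR_ge0.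
move=> Nw; by apply: Hg => //; exact: tN.
Qed.

End moments.

(** * Variance of the jumps and mean of the variation *)

Section variance.
Context {R : realType}.

(** The origin of gamma: [4 + 2 (kappa + kappa^2 + ...) = 4 + 2 kappa / (1 - kappa)]. *)
Lemma cvg_variance (kappa : R) k : 0 < kappa < 1 ->
  kappa ^+ k * (4 + 2 * \sum_(0 <= j < m) kappa ^+ j.+1) @[m --> \oo] -->
  kappa ^+ k * ((4 - 2 * kappa) / (1 - kappa)).
Proof.
move=> /andP[k0 k1]; apply: cvgM; first exact: cvg_cst.
have -> : (4 - 2 * kappa) / (1 - kappa) = 4 + 2 * (kappa / (1 - kappa)).
  by field; rewrite gt_eqF// subr_gt0.
apply: cvgD; first exact: cvg_cst.
apply: cvgM; first exact: cvg_cst.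
have n1 : `|kappa| < 1 by rewrite gtr0_norm.
rewrite (_ : (fun m => _) = series (geometric kappa kappa)).
  exact: cvg_geometric_series.
by apply/funext => m; apply: eq_bigr => j _; rewrite exprS.
Qed.

(** The condition [(2 i + 1) / 2^(k+1) <= t] amounts to [i + 1 <= 2^k t + 1/2], so the floor counts
    the admissible [i]. *)
Lemma count_odd_dyadic (t c : R) k : 0 <= t <= 1 ->
  \sum_(0 <= i < 2 ^ k | odd_dyadic k i <= t) c =
  c * (Num.floor (2 ^+ k * t + 2^-1))%:~R.
Proof.
move=> /andP[t0 t1]; set y := 2 ^+ k * t + 2^-1.
have y0 : 0 <= y by rewrite addr_ge0// mulr_ge0// exprn_ge0.
have oE i : (odd_dyadic k i <= t) = (i < Num.trunc y)%N.
  rewrite truncn_gt_nat odd_dyadicE ler_pdivrMr ?pow2_gt0// exprS /y.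
  have -> : i.*2.+1%:R = 2 * i%:R + 1 :> R by rewrite -natr1 -mul2n natrM.
  have -> : i.+1%:R = i%:R + 1 :> R by rewrite natr1.
  have -> : t * (2 * 2 ^+ k) = 2 * (2 ^+ k * t) by ring.
  by set u := 2 ^+ k * t; apply/idP/idP; lra.
have le : (Num.trunc y <= 2 ^ k)%N.
  rewrite -ltnS truncn_lt_nat// /y.
  have -> : (2 ^ k).+1%:R = 2 ^+ k + 1 :> R by rewrite -natr1 natrX.
  have : 2 ^+ k * t <= 2 ^+ k :> R by rewrite ler_piMr// exprn_ge0.
  lra.
have -> : (Num.floor y)%:~R = (Num.trunc y)%:R :> R.
  by rewrite truncn_floor y0 -[in LHS](gez0_abs (m := Num.floor y)) ?floor_ge0.
under eq_bigl do rewrite oE.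
set f := Num.trunc y in le *.
rewrite (big_cat_nat _ le)//= (_ : \sum_(f <= i < 2 ^ k | (i < f)%N) c = 0) ?addr0; last first.
  by rewrite big_nat_cond big1// => i H; exfalso; move: H; lia.
rewrite big_nat_cond (eq_bigl (fun i => 0 <= i < f)%N); last by move=> i; lia.
by rewrite -big_nat sumr_const_nat subn0 mulr_natr.
Qed.

End variance.

Section mean.
Context d (T : measurableType d) (R : realType) (P : probability T R).
Variables (alpha p theta0 : R) (xi : seq bool -> {RV P >-> R}) (Z : R -> {RV P >-> R}).
Let q : R := 2^-1 `^ (1 - alpha / 2).
Let r : R := tail_ratio theta0 q p.
Let C : R := tail_const theta0 p.
Hypothesis xi_normal : forall v, standard_normal (xi v).
Hypothesis xi_indep : mutually_independent xi.
Hypotheses (p1 : 1 <= p) (th0 : 0 < theta0 < 1) (r0 : 0 < r) (r1 : 2 * r < 1).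
Hypothesis q1 : q < 1.
Local Notation z w := (fun u => Z u w).
Local Notation tame w := (tame_path alpha p theta0 xi Z w).
Let kappa : R := q ^+ 2.
Let gamma : R := (4 - 2 * kappa) / (1 - kappa).

Let p0 : 0 < p. Proof. exact: lt_le_trans p1. Qed.
Let q0 : 0 < q. Proof. by rewrite powR_gt0. Qed.
Let kappa01 : 0 < kappa < 1.
Proof. by rewrite exprn_gt0// exprn_ilt1// ltW. Qed.
Let gamma0 : 0 < gamma.
Proof. by have /andP[? ?] := kappa01; rewrite divr_gt0//; lra. Qed.

Variable N : set T.
Hypotheses (mN : measurable N) (N0 : P N = 0%E) (tN : forall w, ~ N w -> tame w).

Lemma jump_approximant_moment k i m : (i < 2 ^ k)%N ->
  (\int[P]_w (`|jump_approximant alpha xi k i m w| `^ p)%:E =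
   (Num.sqrt (kappa ^+ k * (4 + 2 * \sum_(0 <= j < m) kappa ^+ j.+1)) `^ p)%:E
   * gaussian_moment p)%E.
Proof.
move=> ik; rewrite /jump_approximant.
have [v [J E]] := jump_words_cons k i m.
rewrite -(sum_sqr_jump_coef q k i) E.
apply: linear_comb_moment => //; first by move=> u; exact: jump_coef_neq0.
by rewrite -E jump_words_uniq.
Qed.

(** The approximants have explicit Gaussian moments and are all dominated by the integrable variable
    [g], so dominated convergence applies. *)
Lemma jump_variable_moment k i : (i < 2 ^ k)%N ->
  (\int[P]_w (`|jump_variable Z k i N w| `^ p)%:E =
   ((gamma * kappa ^+ k) `^ (p / 2))%:E * gaussian_moment p)%E.
Proof.
move=> ik; have r0' := ltW r0.
have gN w : ~ N w -> good_path alpha xi Z w by move=> /tN[].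
pose f m w := (`|\1_(~` N) w * jump_approximant alpha xi k i m w| `^ p)%:E.
pose g w := (C%:E * tail_series xi r p 0 w)%E.
have C0 : (0 <= C%:E :> \bar R)%E by rewrite lee_fin tail_const_ge0.
have mg : measurable_fun setT g.
  by apply: measurable_funeM; exact: measurable_tail_series.
have mf m : measurable_fun setT (f m).
  apply/measurable_EFinP; apply: (measurableT_comp (measurable_powR_norm p)).
  apply: measurable_funM; last exact: measurable_jump_approximant.
  by apply: measurable_indic; exact: measurableC.
have ig : P.-integrable setT g.
  apply/integrableP; split=> //.
  under eq_integral do rewrite gee0_abs ?mule_ge0 ?tail_series_ge0//.
  rewrite ge0_integralZl//; last 2 first.
  - exact: measurable_tail_series.
  - by move=> w _; exact: tail_series_ge0.
  by rewrite lte_mul_pinfty//; exact: integral_tail_series_lty.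
have f_g : {ae P, forall w, forall m, setT w -> (`|f m w| <= g w)%E}.
  exists N; split=> // w; apply: contra_notP => Nw m _.
  rewrite gee0_abs ?lee_fin ?powR_ge0// /f indicE mem_set// mul1r /g.
  have [gw fin] := tN Nw.
  rewrite -(fineK (x := tail_series xi r p 0 w)) ?ge0_fin_numE ?tail_series_ge0//.
  rewrite -EFinM lee_fin.
  exact: (jump_approximant_le p1 th0 r0 m ik fin).
have cvf : {ae P, forall w, setT w ->
    f m w @[m --> \oo] --> (`|jump_variable Z k i N w| `^ p)%:E}.
  apply: aeW => w _; apply/cvg_EFin; first exact: nearW.
  have := @jump_variable_cvg _ _ _ _ _ _ _ _ _ _ ik gN w; move: (jump_variable _ _ _ _ _) => l cl.
  exact: (continuous_cvg _ (continuous_powR_norm p1 (x := l)) cl).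
have mlim : measurable_fun setT (fun w => (`|jump_variable Z k i N w| `^ p)%:E).
  apply/measurable_EFinP; apply: (measurableT_comp (measurable_powR_norm p)).
  exact: (measurable_jump_variable ik mN gN).
have [_ _ cv] := dominated_convergence measurableT mf mlim cvf ig f_g.
have fE m : (\int[P]_w f m w = (Num.sqrt (kappa ^+ k * (4 + 2 * \sum_(0 <= j < m)
    kappa ^+ j.+1)) `^ p)%:E * gaussian_moment p)%E.
  rewrite -(jump_approximant_moment m ik).
  by apply: (eq_integral_negligible mN N0) => w Nw; rewrite /f indicE mem_set// mul1r.
have gf : gaussian_moment p \is a fin_num.
  by rewrite ge0_fin_numE ?gaussian_moment_ge0// gaussian_moment_fin.
apply: (cvg_unique _ cv) => //=.
under eq_fun do rewrite fE.
apply: cvgeZr => //; apply/cvg_EFin; first exact: nearW.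
rewrite (_ : (gamma * kappa ^+ k) `^ (p / 2) = `|Num.sqrt (kappa ^+ k * gamma)| `^ p); last first.
  have kg : 0 <= kappa ^+ k * gamma.
    have /andP[/ltW k0 _] := kappa01.
    by apply: mulr_ge0; [exact: exprn_ge0|exact: ltW].
  rewrite ger0_norm ?sqrtr_ge0// -powR12_sqrt//.
  by rewrite -powRrM mulrC [2^-1 * p]mulrC.
under eq_fun do rewrite /= -[Num.sqrt _]ger0_norm ?sqrtr_ge0//.
apply: (continuous_cvg _ (continuous_powR_norm p1 (x := _))).
apply: (continuous_cvg _ (sqrt_continuous (x := _))).
exact: cvg_variance.
Qed.

Lemma measurable_jump_powR k i : (i < 2 ^ k)%N ->
  measurable_fun setT (fun w => `|jump_variable Z k i N w| `^ p).
Proof.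
move=> ik; apply: (measurableT_comp (measurable_powR_norm p)).
by apply: (measurable_jump_variable ik mN (alpha := alpha) (xi := xi)) => w /tN[].
Qed.

Lemma integral_pvar t : 0 < t <= 1 ->
  (\int[P]_w pvar p t (z w) =
   (gamma `^ (p / 2))%:E * gaussian_moment p *
   \sum_(0 <= k <oo) (kappa `^ (p * k%:R / 2) *
      (Num.floor (2 ^+ k * t + 2^-1))%:~R)%:E)%E.
Proof.
move=> t01; have /andP[t0 t1] := t01; have t01' : 0 <= t <= 1 by rewrite ltW.
pose F k (i : 'I_(2 ^ k)) w : R :=
  if odd_dyadic k i <= t then `|jump_variable Z k i N w| `^ p else 0.
have F0 k i w : 0 <= F k i w by rewrite /F; case: ifP => // _; exact: powR_ge0.
have mF k i : measurable_fun setT (F k i).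
  by rewrite /F; case: (_ <= t) => //; apply: measurable_jump_powR; exact: ltn_ord.
pose S k w := \sum_(i < 2 ^ k) F k i w.
have S0 k w : (0 <= (S k w)%:E)%E by rewrite lee_fin sumr_ge0.
have mS k : measurable_fun setT (fun w => (S k w)%:E).
  by apply/measurable_EFinP; exact: measurable_sum.
(* Off the null set the variation limit equals this series of measurable nonnegative terms, which
   can be integrated term by term. *)
transitivity (\int[P]_w \sum_(0 <= k <oo) (S k w)%:E)%E.
  apply: (eq_integral_negligible mN N0) => w Nw.
  have tw := tN Nw; rewrite (tame_path_pvar p1 th0 r0 tw t01).2.
  rewrite Wvar_levels ?gt_eqF//; last exact: good_path_regular tw.1.
  apply: eq_eseriesr => k _; congr EFin; rewrite /S /F -big_mkcond /level_jump_sum big_mkord.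
  by apply: eq_bigr => i _; rewrite jump_variableE.
rewrite integral_nneseries_from//.
have M0 := gaussian_moment_ge0 p : (0 <= gaussian_moment p :> \bar R)%E.
have gf : (fine (gaussian_moment p : \bar R))%:E = gaussian_moment p.
  by rewrite fineK// ge0_fin_numE// gaussian_moment_fin.
rewrite -gf -EFinM -nneseriesZl; last first.
  by move=> k _; rewrite lee_fin mulr_ge0 ?powR_ge0// ler0z floor_ge0 addr_ge0// mulr_ge0 ?exprn_ge0// ltW.
apply: eq_eseriesr => k _; rewrite /S.
under eq_integral do rewrite -sumEFin.
rewrite ge0_integral_sum//; last 2 first.
- by move=> i; apply/measurable_EFinP; exact: mF.
- by move=> i w _; rewrite lee_fin.
rewrite (_ : (\sum_(i < _) _)%E = (\sum_(0 <= i < 2 ^ k | odd_dyadic k i <= t)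
    (gamma * kappa ^+ k) `^ (p / 2) * fine (gaussian_moment p : \bar R))%:E); last first.
  rewrite -sumEFin big_mkord [RHS]big_mkcond; apply: eq_bigr => i _; rewrite /F.
  case: ifP => _; last by rewrite integral0.
  by rewrite jump_variable_moment// -gf.
rewrite count_odd_dyadic// powRM ?(ltW gamma0)//; last first.
  by rewrite exprn_ge0// ltW//; case/andP: kappa01.
have -> : (kappa ^+ k) `^ (p / 2) = kappa `^ (p * k%:R / 2).
  rewrite -powR_mulrn; last by case/andP: kappa01 => /ltW.
  by rewrite -powRrM; congr (_ `^ _); ring.
by rewrite -EFinM; congr EFin; ring.
Qed.

End mean.

(** * The critical case *)

Section many_events.
Context d (T : measurableType d) (R : realType) (P : probability T R).
Variables (n : nat) (A : nat -> set T) (c : R).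
Hypotheses (mA : forall i, (i < n)%N -> measurable (A i)).
Hypotheses (Ac : forall i, (i < n)%N -> (P (A i) <= c%:E)%E).

Definition many_events : set T :=
  [set w | n%:R / 2 <= \sum_(i < n) \1_(A i) w :> R].

Let measurable_count : measurable_fun setT (fun w => \sum_(i < n) \1_(A i) w : R).
Proof. by apply: measurable_sum => i; apply: measurable_indic; exact: mA. Qed.

Lemma measurable_many_events : measurable many_events.
Proof.
rewrite -[many_events]setTI.
have -> : many_events = (fun w => \sum_(i < n) \1_(A i) w : R) @^-1` `[n%:R / 2, +oo[.
  by apply/seteqP; split => w; rewrite /many_events /= in_itv /= andbT.
exact: measurable_count.
Qed.

Lemma prob_many_events : (0 < n)%N -> (P many_events <= (2 * c)%:E)%E.
Proof.
move=> n0; have n2 : 0 < n%:R / 2 :> R by rewrite divr_gt0 ?ltr0n.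
have H : ((n%:R / 2)%:E * P many_events <= (n%:R * c)%:E)%E.
  apply: (@le_trans _ _ (\int[P]_w (\sum_(i < n) \1_(A i) w)%:E)%E).
    have -> : P many_events = (\int[P]_w (\1_many_events w)%:E)%E.
      by rewrite integral_indic ?setIT//; exact: measurable_many_events.
    rewrite -ge0_integralZl ?lee_fin ?(ltW n2)//; last first.
      by apply/measurable_EFinP; apply: measurable_indic; exact: measurable_many_events.
    apply: ge0_le_integral => //.
    - apply: measurable_funeM; apply/measurable_EFinP; apply: measurable_indic.
      exact: measurable_many_events.
    - by apply/measurable_EFinP; exact: measurable_count.
    move=> w _; rewrite -EFinM lee_fin indicE.
    have [|] := boolP (w \in many_events); first by rewrite inE mulr1.
    by move=> _; rewrite mulr0 sumr_ge0.
  under eq_integral do rewrite -sumEFin.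
  rewrite ge0_integral_sum//; last first.
    by move=> i; apply/measurable_EFinP; apply: measurable_indic; exact: mA.
  apply: (@le_trans _ _ (\sum_(i < n) c%:E)%E); last first.
    by rewrite sumEFin sumr_const card_ord mulr_natl.
  by apply: lee_sum => i _; rewrite integral_indic ?setIT//; [exact: Ac|exact: mA].
have Pfin : P many_events \is a fin_num.
  by rewrite fin_num_measure//; exact: measurable_many_events.
rewrite -(fineK Pfin) -EFinM !lee_fin in H *.
have nR : 0 < n%:R :> R by rewrite ltr0n.
rewrite -(ler_pM2l nR); lra.
Qed.

End many_events.

Section critical.
Context d (T : measurableType d) (R : realType) (P : probability T R).
Variables (alpha p : R) (xi : seq bool -> {RV P >-> R}) (Z : R -> {RV P >-> R}).
Let q : R := 2^-1 `^ (1 - alpha / 2).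
Hypothesis xi_normal : forall v, standard_normal (xi v).
Hypothesis xi_indep : mutually_independent xi.
Hypotheses (p1 : 1 <= p) (qp : q `^ p = 2^-1).
Local Notation z w := (fun u => Z u w).

Let q0 : 0 < q. Proof. by rewrite powR_gt0. Qed.
Let p0 : 0 < p. Proof. exact: lt_le_trans p1. Qed.

Variable N : set T.
Hypotheses (mN : measurable N) (gN : forall w, ~ N w -> good_path alpha xi Z w).

Lemma jump_approximant_small_ball k i m c : (i < 2 ^ k)%N -> 0 < c ->
  (P (jump_approximant alpha xi k i m @^-1` `[(- (c * q ^+ k))%R, (c * q ^+ k)%R]) <= c%:E)%E.
Proof.
move=> ik c0; rewrite /jump_approximant.
have [v [J E]] := jump_words_cons k i m.
have uJ : uniq (v :: J) by rewrite -E jump_words_uniq.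
rewrite -/q E linear_comb_law//; last by move=> u; exact: jump_coef_neq0.
have qk : 0 < q ^+ k by rewrite exprn_gt0.
(* The central word alone contributes [4 q^(2k)] to the variance. *)
have s2 : 2 * q ^+ k <= Num.sqrt (\sum_(j <- v :: J) jump_coef q k j ^+ 2).
  have S0 : 0 <= \sum_(0 <= j < m) (q ^+ 2) ^+ j.+1.
    by rewrite sumr_ge0// => j _; rewrite !exprn_ge0// ltW.
  rewrite -E sum_sqr_jump_coef -[leLHS]gtr0_norm ?mulr_gt0// -sqrtr_sqr ler_wsqrtr//.
  rewrite exprMn exprAC mulrC ler_wpM2l ?exprn_ge0 ?(ltW q0)//.
  set S := \sum_(0 <= j < m) _ in S0 *; rewrite expr2; lra.
have s0 : 0 < Num.sqrt (\sum_(j <- v :: J) jump_coef q k j ^+ 2).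
  by rewrite (lt_le_trans _ s2)// mulr_gt0.
apply: (le_trans (normal_prob_small_ball _ s0)); first by rewrite mulr_gt0.
by rewrite lee_fin ler_pdivrMr// mulrCA ler_wpM2l// ltW.
Qed.

Definition small_jump c k i : set T :=
  ~` N `&` [set w | `|jump_variable Z k i N w| < c * q ^+ k].

Lemma measurable_small_jump c k i : (i < 2 ^ k)%N -> measurable (small_jump c k i).
Proof.
move=> ik; apply: measurableI; first exact: measurableC.
have mJ := measurable_jump_variable ik mN gN.
rewrite -[X in measurable X]setTI.
have -> : [set w | `|jump_variable Z k i N w| < c * q ^+ k] =
    (fun w => `|jump_variable Z k i N w|) @^-1` `]-oo, c * q ^+ k[.
  by apply/seteqP; split => w; rewrite /= in_itv.
by apply: (measurableT_comp (f := @Num.norm R R)) => //; exact: measurable_normr.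
Qed.

(** The strict inequality for the limit puts the approximants into the closed ball from some index
    on, so the event lies in a limit inferior of events of probability at most [c]. *)
Lemma prob_small_jump c k i : (i < 2 ^ k)%N -> 0 < c ->
  (P (small_jump c k i) <= c%:E)%E.
Proof.
move=> ik c0; pose E m := jump_approximant alpha xi k i m @^-1`
  `[(- (c * q ^+ k))%R, (c * q ^+ k)%R].
have mE m : measurable (E m).
  by rewrite -[X in measurable X]setTI; apply: measurable_jump_approximant.
have [mL PL] := probability_liminf_le mE
  (fun m => jump_approximant_small_ball m ik c0).
apply: le_trans PL; apply: le_measure; rewrite ?inE//; first exact: measurable_small_jump.
move=> w [Nw /= Hw]; have cv := good_path_jump_cvg (gN Nw) ik.
rewrite (jump_variableE _ _ _ Nw) in Hw.
have d0 : 0 < c * q ^+ k - `|jump (z w) (odd_dyadic k i)| by rewrite subr_gt0.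
move/cvgrPdist_le : cv => /(_ _ d0)[n _ Hn]; exists n => // m /= nm.
rewrite /E /= in_itv /= -ler_norml -jump_approximantE//.
have := Hn m nm; rewrite /= distrC => Hd.
have := ler_normD (jump (partial q (fun v => xi v w) 0 (k.+1 + m)) (odd_dyadic k i)
  - jump (z w) (odd_dyadic k i)) (jump (z w) (odd_dyadic k i)).
by rewrite subrK => /le_trans; apply; rewrite -lerBrDr.
Qed.

(** For [m <= k] the indices [i < 2 ^ (k - m)] are those of the jumps of level [k] in [0, 2^-m],
    which count for all [t >= 2^-m] at once. *)
Definition degenerate_level m c k : set T :=
  many_events R (2 ^ (k - m)) (small_jump c k).

(** More than half of the [2^(k - m)] jumps have size at least [c q^k], and [(c q^k)^p = c^p 2^-k]
    at the critical exponent, so that [k] cancels. *)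
Lemma level_jump_sum_ge m t c k w : ~ N w -> (m <= k)%N -> (2 ^+ m)^-1 <= t -> 0 < c ->
  ~ degenerate_level m c k w ->
  (2 ^+ m)^-1 / 2 * c `^ p <= level_jump_sum p (z w) t k.
Proof.
move=> Nw mk mt c0 /negP; rewrite -ltNge => H.
set n := (2 ^ (k - m))%N in H.
have nE : (2 ^+ m)^-1 = n%:R * (2 ^+ k)^-1 :> R.
  have -> : 2 ^+ k = n%:R * 2 ^+ m :> R by rewrite -!pow2E -natrM -expnD subnK.
  by rewrite invfM mulrA divff ?mul1r// pnatr_eq0 -lt0n expn_gt0.
have nk : (n <= 2 ^ k)%N by rewrite leq_exp2l// leq_subr.
have qk : 0 < q ^+ k by rewrite exprn_gt0.
pose b i : R := \1_(small_jump c k i) w.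
apply: (@le_trans _ _ (\sum_(0 <= i < n) (1 - b i) * (c `^ p * 2^-1 ^+ k))).
  rewrite -mulr_suml sumrB sumr_const_nat subn0 big_mkord nE exprVn.
  have u0 : 0 < c `^ p * (2 ^+ k)^-1 by rewrite mulr_gt0 ?powR_gt0// pow2V_gt0.
  have := ler_wpM2r (ltW u0) (ltW H); rewrite -/b => H1.
  rewrite mulrBl; set B := _ * (_ * _) in H1 *.
  lra.
rewrite /level_jump_sum (big_cat_nat (leq0n n) nk) /=.
apply: (@le_trans _ _ (\sum_(0 <= i < n | odd_dyadic k i <= t) `|jump (z w) (odd_dyadic k i)| `^ p)); last first.
  by rewrite lerDl sumr_ge0// => i _; exact: powR_ge0.
rewrite [leRHS]big_mkcond /= !big_nat; apply: ler_sum => i /andP[_ iN].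
have it : odd_dyadic k i <= t.
  apply: le_trans mt; rewrite odd_dyadicE nE exprS invfM mulrA.
  rewrite ler_wpM2r ?invr_ge0 ?pow2_ge0// ler_pdivrMr// -natrM ler_nat; lia.
rewrite it /b indicE.
have [_|] := boolP (w \in small_jump c k i); first by rewrite subrr mul0r powR_ge0.
rewrite notin_setE /small_jump /= => /not_andP[//|/negP]; rewrite -leNgt jump_variableE// => Hc.
rewrite subr0 mul1r.
have -> : c `^ p * 2^-1 ^+ k = (c * q ^+ k) `^ p.
  rewrite powRM ?(ltW c0) ?(ltW qk)//; congr (_ * _).
  by rewrite -[q ^+ k]powR_mulrn ?(ltW q0)// powRAC qp powR_mulrn.
by apply: ge0_ler_powR; rewrite ?nnegrE ?(ltW p0)// mulr_ge0// ltW.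
Qed.

(** When [Wvar] is finite the level sums tend to 0, hence eventually drop below the constant that a
    nondegenerate level would contribute. *)
Lemma not_degenerate_Wvar m t w c : ~ N w -> (2 ^+ m)^-1 <= t -> t <= 1 -> 0 < c ->
  (Wvar p t (z w) < +oo)%E ->
  (\bigcup_n \bigcap_(k in [set k | (n <= k)%N]) degenerate_level m c k) w.
Proof.
move=> Nw mt t1 c0; rewrite Wvar_levels ?gt_eqF//; last exact: good_path_regular (gN Nw).
move=> fin; pose l k := (level_jump_sum p (z w) t k)%:E.
have l0 k : (0 <= l k)%E by rewrite lee_fin level_jump_sum_ge0.
have cv : (\sum_(n <= k <oo) l k)%E @[n --> \oo] --> 0%E.
  by apply: nneseries_tail_cvg => // k _; exact: l0.
have eta0 : 0 < (2 ^+ m)^-1 / 2 * c `^ p :> R.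
  by rewrite mulr_gt0 ?powR_gt0// divr_gt0// pow2V_gt0.
have /fine_cvgP[[n1 _ H1]] := cv.
move/cvgrPdist_lt => /(_ _ eta0)[n2 _ H2].
exists (maxn m (maxn n1 n2)) => // k /=; rewrite !geq_max => /and3P[mk n1k n2k].
apply: contrapT => ng; have := H2 k n2k; rewrite /= sub0r normrN ltNge => /negP; apply.
apply: (le_trans (level_jump_sum_ge Nw mk mt c0 ng)).
rewrite (le_trans _ (ler_norm _))// -lee_fin fineK; last exact: (H1 k n1k).
have := nneseries_lim_ge (P := xpredT) (m := k) (u_ := l).
by move=> /(_ k.+1 (fun i _ _ => l0 i)); rewrite big_nat1.
Qed.

(** For each [c] the paths with finite [Wvar] lie, off [N], in one event of probability at most
    [2 c], the same for all [t >= 2^-m]; intersecting over [c = 1/(j+1)] gives one null set for all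
    these [t]. *)
Lemma critical_negligible m : exists F, [/\ measurable F, P F = 0%E &
  forall w t, ~ N w -> ~ F w -> (2 ^+ m)^-1 <= t -> t <= 1 -> Wvar p t (z w) = +oo%E].
Proof.
pose c j : R := j.+1%:R^-1.
have c0 j : 0 < c j by rewrite invr_gt0.
pose E j := \bigcup_n \bigcap_(k in [set k | (n <= k)%N]) degenerate_level m (c j) k.
have ik k i : (i < 2 ^ (k - m))%N -> (i < 2 ^ k)%N.
  by move=> /leq_trans; apply; rewrite leq_exp2l// leq_subr.
have EP j : measurable (E j) /\ (P (E j) <= (2 * c j)%:E)%E.
  apply: probability_liminf_le => k.
    by apply: measurable_many_events => i /ik; exact: measurable_small_jump.
  apply: prob_many_events; last by rewrite expn_gt0.
    by move=> i /ik; exact: measurable_small_jump.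
  by move=> i /ik iN; exact: prob_small_jump.
exists (\bigcap_j E j); have mF : measurable (\bigcap_j E j).
  by apply: bigcapT_measurable => j; exact: (EP j).1.
split=> //.
  apply/eqP; rewrite eq_le measure_ge0 andbT; apply/lee_addgt0Pr => e e0.
  rewrite add0e; have [j Hj] : exists j, 2 * c j <= e.
    exists (Num.trunc (2 / e)); rewrite /c ler_pdivrMr// mulrC -ler_pdivrMr//.
    by rewrite ltW// truncnS_gt.
  apply: (@le_trans _ _ (P (E j))); last by rewrite (le_trans (EP j).2)// lee_fin.
  apply: le_measure; rewrite ?inE//; first exact: (EP j).1.
  by move=> w /(_ j Logic.I).
move=> w t Nw Fw mt t1; apply/eqP; rewrite -leye_eq leNgt; apply/negP => fin.
by apply: Fw => j _; exact: (not_degenerate_Wvar Nw mt t1 (c0 j) fin).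
Qed.

End critical.

(** * Arithmetic of the scale and of the critical exponent *)

Section scale.
Context {R : realType}.
Implicit Types alpha p : R.

Lemma scale_lt1 alpha : alpha <= 2^-1 -> (2^-1 `^ (1 - alpha / 2) : R) < 1.
Proof.
move=> a2; have e0 : 0 < 1 - alpha / 2 by lra.
have := @gt0_ltr_powR _ _ e0 2^-1 1; rewrite powR1 !nnegrE; apply; lra.
Qed.

Lemma scale_sqr alpha : (2^-1 `^ (1 - alpha / 2)) ^+ 2 = 2^-1 `^ (2 - alpha) :> R.
Proof.
by rewrite -powR_mulrn ?powR_ge0// -powRrM; congr (_ `^ _); field.
Qed.

Lemma scale_critical alpha : alpha <= 2^-1 ->
  (2^-1 `^ (1 - alpha / 2)) `^ (2 / (2 - alpha)) = 2^-1 :> R.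
Proof.
move=> a2; rewrite -powRrM (_ : _ * _ = 1) ?powRr1//.
by field; rewrite gt_eqF//; lra.
Qed.

Lemma scale_supercritical alpha p : alpha <= 2^-1 -> 2 / (2 - alpha) < p ->
  2 * (2^-1 `^ (1 - alpha / 2)) `^ p < 1 :> R.
Proof.
move=> a2 pp; rewrite -powRrM.
have e0 : 0 < (1 - alpha / 2) * p - 1.
  have a0 : 0 < 2 - alpha by lra.
  move: pp; rewrite ltr_pdivrMr// => H; nra.
have -> : (1 - alpha / 2) * p = 1 + ((1 - alpha / 2) * p - 1) by ring.
rewrite powRD; last by apply/implyP => _; rewrite gt_eqF.
rewrite powRr1// mulrA divff// mul1r.
set e := _ - 1 in e0 *.
have := @gt0_ltr_powR _ _ e0 2^-1 1; rewrite powR1 !nnegrE; apply; lra.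
Qed.

Lemma critical_exponent_ge1 alpha : 0 < alpha -> alpha <= 2^-1 -> 1 <= 2 / (2 - alpha).
Proof. by move=> a0 a2; rewrite ler_pdivlMr; lra. Qed.

End scale.

Theorem theorem4p4 (R : realType) (d : measure_display) (T : measurableType d)
  (P : probability T R) (d' : measure_display) (T' : measurableType d')
  (Q : probability T' R) (alpha : R) (xi : seq bool -> {RV P >-> R})
  (Z : R -> {RV P >-> R}) (N : {RV Q >-> R}) :
  0 < alpha -> alpha <= 2^-1 ->
  (forall v, standard_normal (xi v)) -> mutually_independent xi ->
  limit_process alpha xi Z ->
  standard_normal N ->
  let kappa := 2^-1 `^ (2 - alpha) in
  let gamma := (4 - 2 * kappa) / (1 - kappa) in
  let p_alpha := 2 / (2 - alpha) in
  let Zpath w t := Z t w in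
  (forall p, p_alpha < p ->
    [/\ {ae P, forall w,
          (Vvar p 1 (Zpath w) < +oo)%E /\
          forall t, 0 < t <= 1 ->
            [/\ pvar_exists p t (Zpath w),
                pvar p t (Zpath w) = Wvar p t (Zpath w) &
                Wvar p t (Zpath w) =
                  \esum_(s in dyadic `&` `[0, t]) (`|jump (Zpath w) s| `^ p)%:E]},
        forall t m, 0 < t <= 1 -> 0 < m ->
          (\int[P]_w (`|(power_sum p (Zpath w) s)%:E - pvar p t (Zpath w)| `^ m))%E
            @[s --> mesh_to0 t] --> 0%E &
        forall t, 0 < t <= 1 ->
          (\int[P]_w pvar p t (Zpath w) =
           (gamma `^ (p / 2))%:E * 'E_Q[fun w => (`|N w| `^ p)%R] *
           (* A jump at an odd multiple of 2^-i has variance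
              gamma * kappa^(i-1), hence the exponent i-1 of kappa. *)
           \sum_(1 <= i <oo)
             (kappa `^ (p * i.-1%:R / 2) *
              (Num.floor (2 ^+ i.-1 * t + 2^-1))%:~R)%:E)%E]) /\
  {ae P, forall w, forall t, 0 < t <= 1 ->
    [/\ Vvar p_alpha t (Zpath w) = +oo%E,
        Wvar p_alpha t (Zpath w) = +oo%E,
        pvar_exists p_alpha t (Zpath w) &
        pvar p_alpha t (Zpath w) = +oo%E]}.
Proof.
move=> a0 a2 xi_normal xi_indep lim N_normal kappa gamma p_alpha Zpath.
have pa1 : 1 <= p_alpha := critical_exponent_ge1 a0 a2.
split=> [p pp|].
  have p1 : 1 <= p by rewrite (le_trans pa1)// ltW.
  have q0 : 0 < 2^-1 `^ (1 - alpha / 2) :> R by rewrite powR_gt0.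
  have [theta0 th0 [r0 r1]] := exists_tail_ratio p1 q0 (scale_supercritical a2 pp).
  have [N' [mN' N'0 tN']] := tame_path_ae xi_normal p1 r0 r1 lim.
  split=> [|t m t01 m0|t t01].
  - exists N'; split=> // w; apply: contra_notP => /tN' tw.
    split; first exact: (tame_path_Vvar p1 th0 r0 tw).
    move=> t t01; have [ex eq] := tame_path_pvar p1 th0 r0 tw t01.
    have /andP[_ t1] := t01.
    by split=> //; exact: (tame_path_dyadic p1 tw t1).
  - exact: (moment_cvg xi_normal p1 th0 r0 r1 t01 lim m0).
  - rewrite (integral_pvar xi_normal xi_indep p1 th0 r0 r1 (scale_lt1 a2) mN' N'0 tN' t01).
    (* [N] lives on its own probability space; only its law matters, and it is viewed as a constant
       family indexed by words. *)
    have -> : ('E_Q[fun w => (`|N w| `^ p)%R] = gaussian_moment p)%E.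
      by rewrite unlock; exact: (integral_normal_powR (fun=> N_normal) [::] p).
    rewrite !scale_sqr; congr (_ * _)%E; rewrite -[RHS]nneseries_addn.
      by apply: eq_eseriesr => k _; rewrite addn1.
    move=> i; rewrite lee_fin mulr_ge0 ?powR_ge0// ler0z floor_ge0.
    by case/andP: t01 => t0 _; rewrite addr_ge0// mulr_ge0 ?exprn_ge0// ltW.
have [N' [mN' N'0 gN']] := good_path_ae lim.
have cr := critical_negligible xi_normal xi_indep pa1 (scale_critical a2) mN' gN'.
(* The null sets for all [m] are united: each [t > 0] lies above some 2^-m, so one null set serves
   every [t]. *)
have [F HF] := choice cr.
have [F' [mF' F'0 sF']] : P.-negligible (\bigcup_m F m).
  by apply: negligible_bigcup => m; have [mF F0 _] := HF m; exists (F m); split.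
exists (N' `|` F'); split; [exact: measurableU|by rewrite measureU0|].
move=> w; apply: contra_notP; rewrite not_orE => -[Nw Fw] t t01.
have /andP[t0 t1] := t01.
have [m _ /(_ m (leqnn m)) /ltW Hm] := near_infty_natSinv_expn_lt (PosNum t0).
rewrite /= mul1r in Hm.
have [_ _ H] := HF m.
have W := H w t Nw (fun Fm => Fw (sF' _ (ex_intro2 _ _ m Logic.I Fm))) Hm t1.
have [V ex pv] := Wvar_infinite pa1 (good_path_regular (gN' w Nw)) t01 W.
by split.
Qed.
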